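(* The Weighted $\mathcal{C}$-Coalition Formation problem parameterized by $\mathrm{vc}+\mathcal{C}$ does not admit a polynomial kernel unless the polynomial hierarchy collapses, where $\mathrm{vc}$ is the vertex cover number of the input graph.
   Context: Weighted $\mathcal{C}$-Coalition Formation: the input is an undirected graph $G=(V,E)$, an edge-weight function $w:E\to\mathbb{N}$, a capacity $\mathcal{C}\in\mathbb{N}$ (and in decision form a target $t$). A $\mathcal{C}$-partition of $V$ is a partition $\mathcal{P}=\{C_1,\dots,C_p\}$ with $|C_i|\le\mathcal{C}$; its value is $v(\mathcal{P})=\sum_i\sum_{e\in E(G[C_i])}w(e)$; the goal is to maximize the value (decision: is there a $\mathcal{C}$-partition of value at least $t$). A polynomial kernel is a polynomial-time algorithm mapping an instance to an equivalent instance of size polynomial in the parameter. *)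

(* Defs.v *)
From mathcomp Require Import all_boot all_order all_algebra.

Set Implicit Arguments.
Unset Strict Implicit.
Unset Printing Implicit Defensive.

Definition string := seq bool.

(** * Deterministic multi-tape Turing machines *)

Inductive move := MoveL | MoveS | MoveR.

(* The tape alphabet is [option (bool + tm_extra)]: [None] is the blank,
   [Some (inl b)] are the input/output bits, [Some (inr a)] the auxiliary
   symbols.  The machine has [tm_tapes.+1] tapes. *)
Record tm := TM {
  tm_state : finType;
  tm_extra : finType;
  tm_tapes : nat;
  tm_start : tm_state;
  tm_halt : pred tm_state;
  tm_delta : tm_state -> {ffun 'I_tm_tapes.+1 -> option (bool + tm_extra)} ->
    tm_state * {ffun 'I_tm_tapes.+1 -> option (bool + tm_extra) * move}
}.

Definition tm_sym (M : tm) : finType := option (bool + tm_extra M).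

(* A two-way infinite tape: the cells to the left of the head (nearest first),
   the scanned cell, the cells to its right (nearest first); all the cells
   beyond the two lists are blank. *)
Record tape (M : tm) := Tape {
  tape_left : seq (tm_sym M);
  tape_head : tm_sym M;
  tape_right : seq (tm_sym M)
}.

Definition tape_of (M : tm) (s : seq (tm_sym M)) : tape M :=
  Tape [::] (head None s) (behead s).

Definition write_move (M : tm) (t : tape M) (am : tm_sym M * move) : tape M :=
  let l := tape_left t in
  let r := tape_right t in
  match am.2 with
  | MoveL => Tape (behead l) (head None l) (am.1 :: r)
  | MoveS => Tape l am.1 r
  | MoveR => Tape (am.1 :: l) (head None r) (behead r)
  end.

Record config (M : tm) := Config {
  cfg_state : tm_state M;
  cfg_tapes : 'I_(tm_tapes M).+1 -> tape M
}.

Definition tm_step (M : tm) (c : config M) : config M :=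
  if tm_halt (cfg_state c) then c else
  let qa := tm_delta (cfg_state c) [ffun i => tape_head (cfg_tapes c i)] in
  Config qa.1 (fun i => write_move (cfg_tapes c i) (qa.2 i)).

(* The input is on tape 0, the head scanning its first bit. *)
Definition tm_init (M : tm) (x : string) : config M :=
  Config (tm_start M)
    (fun i => tape_of (if i == ord0 then [seq Some (inl b) | b <- x] else [::])).

Fixpoint bit_prefix (A : Type) (s : seq (option (bool + A))) : string :=
  if s is Some (inl b) :: s' then b :: bit_prefix s' else [::].

(* The output is the maximal string of bits on tape 0 that starts at the
   scanned cell. *)
Definition tm_output (M : tm) (c : config M) : string :=
  let t := cfg_tapes c ord0 in bit_prefix (tape_head t :: tape_right t).

(* Halting configurations are fixed by [tm_step], hence "within [n] steps". *)
Definition tm_computes_within (M : tm) (n : nat) (x y : string) : Prop :=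
  let c := iter n (@tm_step M) (tm_init M x) in
  tm_halt (cfg_state c) /\ tm_output c = y.

Definition polytime (A B : Type) (encA : A -> string) (encB : B -> string)
    (f : A -> B) : Prop :=
  exists (M : tm) (p : {poly nat}), forall a : A,
    tm_computes_within M (p.[size (encA a)])%R (encA a) (encB (f a)).

(** * The polynomial hierarchy *)

Definition language := string -> Prop.

Definition inP (L : language) : Prop :=
  exists chi : string -> bool,
    polytime (fun x : string => x) (fun b : bool => [:: b]) chi /\
    (forall x, L x <-> chi x).

(* Prefix-free code: every bit is preceded by [true], and [false] ends it. *)
Definition delimit (x : string) : string :=
  flatten [seq [:: true; b] | b <- x] ++ [:: false].

Definition spair (x y : string) : string := delimit x ++ y.

(* [Sigma_k.+1]: a polynomially bounded existential quantifier in front of a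
   language [V] in [Pi_k], i.e. whose complement is in [Sigma_k]. *)
Fixpoint SigmaP (k : nat) (L : language) : Prop :=
  if k is k'.+1 then
    exists (V : language) (p : {poly nat}),
      SigmaP k' (fun z => ~ V z) /\
      (forall x, L x <->
        exists y : string, size y <= (p.[size x])%R /\ V (spair x y))
  else inP L.

Definition PH (L : language) : Prop := exists k, SigmaP k L.

Definition PH_collapses : Prop :=
  exists k, forall L : language, PH L -> SigmaP k L.

(** * Kernels *)

(* A parameterized problem is given by its instances with their encoding, the
   yes-instances, and the parameter as a function of the instance. *)
Definition admits_polynomial_kernel (I : Type) (enc : I -> string)
    (yes : I -> Prop) (param : I -> nat) : Prop :=
  exists K : I -> I,
    [/\ polytime enc enc K,
        forall x, yes x <-> yes (K x) &
        exists p : {poly nat}, forall x, size (enc (K x)) <= (p.[param x])%R].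

(** * Weighted C-Coalition Formation *)

Section Graph.
Variables (T : finType) (E : {set {set T}}).

Definition vertex_cover (S : {set T}) : bool :=
  [forall e in E, S :&: e != set0].

(* [setT] is only the starting point of the minimization; it is a vertex cover
   as soon as no edge is empty. *)
Definition vc_number : nat :=
  #|[arg min_(S < [set: T] | vertex_cover S) #|S|]|.

Definition cap_partition (c : nat) (P : {set {set T}}) : Prop :=
  partition P [set: T] /\ (forall C, C \in P -> #|C| <= c).

Definition partition_value (w : {e : {set T} | e \in E} -> nat)
    (P : {set {set T}}) : nat :=
  \sum_(C in P) \sum_(e : {e : {set T} | e \in E} | val e \subset C) w e.

End Graph.

Record wccf := WCCF {
  wccf_n : nat;
  wccf_edges : {set {set 'I_wccf_n}};
  wccf_edges2 : forall e, e \in wccf_edges -> #|e| = 2;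
  wccf_weight : {e : {set 'I_wccf_n} | e \in wccf_edges} -> nat;
  wccf_capacity : nat;
  wccf_target : nat
}.

Definition wccf_yes (x : wccf) : Prop :=
  exists P : {set {set 'I_(wccf_n x)}},
    cap_partition (wccf_capacity x) P /\
    wccf_target x <= partition_value (@wccf_weight x) P.

Definition wccf_vc_plus_capacity (x : wccf) : nat :=
  vc_number (wccf_edges x) + wccf_capacity x.

(* Binary representation, least significant bit first, without leading zeros;
   [up_log 2 n.+1] is the number of binary digits of [n]. *)
Definition bits (n : nat) : string :=
  mkseq (fun i => odd (n %/ 2 ^ i)) (up_log 2 n.+1).

Definition enc_entry (x : wccf) (i j : 'I_(wccf_n x)) : string :=
  if (insub [set i; j] : option {e | e \in wccf_edges x}) is Some e
  then true :: delimit (bits (wccf_weight e)) else [:: false].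

(* The number of vertices, the capacity and the target in binary, followed by
   the adjacency matrix, row by row, with binary edge weights. *)
Definition wccf_enc (x : wccf) : string :=
  delimit (bits (wccf_n x)) ++ delimit (bits (wccf_capacity x)) ++
  delimit (bits (wccf_target x)) ++
  flatten [seq enc_entry i j | i <- enum 'I_(wccf_n x),
                               j <- enum 'I_(wccf_n x)].

(* Main.v *)
Require Import Defs.
From Stdlib Require Import FunctionalExtensionality Classical.
From mathcomp Require Import all_boot all_order all_algebra zify.

(** Suppose that K is a polynomial kernel and let A be an NP language, given by
    a polynomial-time machine M and a polynomial bound on the witnesses.

    A Cook-Levin argument turns "M accepts (z, y) for some y" into the existence
    of a clique in a multipartite compatibility graph.  A vertex describes one
    tape of M at one time step: the state, the symbols scanned by all the heads,
    the position of the head and the time of its last visit there; this last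
    component makes the correctness of a computation a pairwise condition.  The
    graph depends on |z| only: z itself is a single further vertex.  Hence
    z_1, ..., z_t together are handled by one coalition instance in which the
    vertices of z_1, ..., z_t are outside the vertex cover.  A hub vertex r pays
    c for each neighbour in its coalition, which is exactly what a vertex of the
    cover earns in a coalition with its own c private fillers; so only the edges
    inside the coalition of r matter, and their number is maximal iff the
    coalition is r together with a clique.  Thus the parameter is polynomial in
    |z_i| and independent of t, and K compresses the disjunction of the
    "z_i in A" to polynomially many bits in |z_i|.

    By the counting argument of Fortnow and Santhanam, a short list of
    kernels of all-negative tuples certifies every string outside A.  For
    A defined by the innermost quantifier of a Sigma_4 formula, guessing this list
    along with the first quantifier gives a Sigma_3 formula: the soundness of the
    list is universally quantified, and its completeness is not needed.

    Polynomial time is handled by a stack language with exact costs; it is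
    compiled to Turing machines and simulates them, so that its functions are
    closed under composition and bounded iteration. *)

Set Implicit Arguments.
Unset Strict Implicit.
Unset Printing Implicit Defensive.

(** Written out, a Sigma_4 formula says that some [y0] has for every [y1] some [y2] such that
    [z = (x, y0, y1, y2)] lies outside an NP language A. A short proof of the latter is a tuple that
    contains [z] and whose kernel is on the list; it is guessed together with [y2], and this removes
    the fourth quantifier. As the list itself is guessed, the formula stays uniform.

    A kernel is treated as a mere bit string that is compared with other bit strings, so what
    matters is that equal encodings have equal answers. The bound [q s] on its length is known
    before the number of composed strings is chosen, and [t = q s + 1] strings are enough: as
    [t]-tuples have at most [2 ^ t] different images, some image is shared by tuples that together
    contain at least half of the negative strings. *)

(** * Polynomial bounds as closed expressions *)

Inductive pol : (nat -> nat) -> Prop :=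
| pol_id : pol (fun n => n)
| pol_cst c : pol (fun=> c)
| pol_add f g : pol f -> pol g -> pol (fun n => f n + g n)
| pol_mul f g : pol f -> pol g -> pol (fun n => f n * g n).

Lemma pol_mono f : pol f -> forall m n, m <= n -> f m <= f n.
Proof.
elim=> // {}f g _ Hf _ Hg m n le_mn.
- by apply: leq_add; [apply: Hf | apply: Hg].
- by apply: leq_mul; [apply: Hf | apply: Hg].
Qed.

Lemma pol_comp f g : pol f -> pol g -> pol (fun n => f (g n)).
Proof.
move=> Hf Hg; elim: Hf => [|c|f1 f2 _ H1 _ H2|f1 f2 _ H1 _ H2] //.
- exact: pol_cst.
- exact: (pol_add H1 H2).
- exact: (pol_mul H1 H2).
Qed.

Lemma pol_horner (p : {poly nat}) : pol (fun n => (p.[n])%R).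
Proof.
elim/poly_ind: p => [|p c IHp].
  by rewrite (_ : (fun n => _) = fun=> 0);
    [exact: pol_cst | apply: functional_extensionality => n; rewrite horner0].
rewrite (_ : (fun n => _) = fun n => (p.[n])%R * n + c).
  exact: pol_add (pol_mul IHp pol_id) (pol_cst c).
by apply: functional_extensionality => n; rewrite hornerMXaddC.
Qed.

Lemma pol_poly f : pol f -> exists p : {poly nat}, forall n, f n = (p.[n])%R.
Proof.
elim=> [|c|{}f g _ [p Hp] _ [q Hq]|{}f g _ [p Hp] _ [q Hq]].
- by exists 'X%R => n; rewrite hornerX.
- by exists (c%:P)%R => n; rewrite hornerC.
- by exists (p + q)%R => n; rewrite hornerD Hp Hq.
- by exists (p * q)%R => n; rewrite hornerM Hp Hq.
Qed.

(** * A stack language and its compilation to Turing machines *)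

Definition store := nat -> string.

Definition upd (st : store) r s : store := fun i => if i == r then s else st i.

(** The registers are stacks of bits, one per tape of the compiled machine. Control depends only on
    the top of a stack or its emptiness, which the scanned cell shows. *)
Inductive cmd :=
| Skip
| Push of nat & bool
| Pop of nat
| Seq of cmd & cmd
| Case of nat & cmd & cmd & cmd
| While of nat & cmd.

Definition branch (s : string) (c0 cf ct : cmd) : cmd :=
  match s with [::] => c0 | false :: _ => cf | true :: _ => ct end.

(* The costs are the exact numbers of machine steps of the compiled code. *)
Inductive exec : cmd -> store -> nat -> store -> Prop :=
| exec_skip st : exec Skip st 0 st
| exec_push r b st : exec (Push r b) st 2 (upd st r (b :: st r))
| exec_pop r st : exec (Pop r) st 1 (upd st r (behead (st r)))
| exec_seq c1 c2 st n1 st1 n2 st2 :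
    exec c1 st n1 st1 -> exec c2 st1 n2 st2 -> exec (Seq c1 c2) st (n1 + n2) st2
| exec_case r c0 cf ct st n st' :
    exec (branch (st r) c0 cf ct) st n st' -> exec (Case r c0 cf ct) st n.+2 st'
| exec_while0 r c st : st r = [::] -> exec (While r c) st 1 st
| exec_whileS r c st n1 st1 n2 st2 :
    st r <> [::] -> exec c st n1 st1 -> exec (While r c) st1 n2 st2 ->
    exec (While r c) st (1 + n1 + 1 + n2) st2.

Lemma exec_size c st n st' r : exec c st n st' -> size (st' r) <= size (st r) + n.
Proof.
elim=> {c st n st'} /=.
- by move=> st; rewrite addn0.
- by move=> r' b st; rewrite /upd; case: eqP => [->|_] /=; lia.
- by move=> r' st; rewrite /upd; case: eqP => [->|_] /=; rewrite ?size_behead; lia.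
- by move=> *; lia.
- by move=> *; lia.
- by move=> *; lia.
- by move=> *; lia.
Qed.

Fixpoint regs c : nat :=
  match c with
  | Skip => 0
  | Push r _ | Pop r => r.+1
  | Seq c1 c2 => maxn (regs c1) (regs c2)
  | Case r c0 cf ct =>
      maxn r.+1 (maxn (regs c0) (maxn (regs cf) (regs ct)))
  | While r c => maxn r.+1 (regs c)
  end.

Inductive instr :=
| ILeft of nat | IWrite of nat & bool | IPop of nat
| ICase of nat & nat & nat & nat.

(** Jump targets are absolute addresses, hence the parameter [base]. An [ICase] with three equal
    targets is an unconditional jump. *)
Fixpoint code c base : seq instr :=
  match c with
  | Skip => [::]
  | Push r b => [:: ILeft r; IWrite r b]
  | Pop r => [:: IPop r]
  | Seq c1 c2 => let s1 := code c1 base in s1 ++ code c2 (base + size s1)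
  | Case r c0 cf ct =>
      let s0 := code c0 base.+1 in
      let bf := base.+1 + size s0 + 1 in
      let sf := code cf bf in
      let bt := bf + size sf + 1 in
      let st := code ct bt in
      let j := bt + size st + 1 in
      ICase r base.+1 bf bt ::
        s0 ++ ICase r j j j :: sf ++ ICase r j j j :: rcons st (ICase r j j j)
  | While r c =>
      let s := code c base.+1 in
      let j := base.+1 + size s + 1 in
      ICase r j base.+1 base.+1 :: rcons s (ICase r base base base)
  end.

Section Machine.
Variables (K : nat) (prog : seq instr).

Definition msym := option (bool + void).
Definition mstate := 'I_(size prog).+1.

Definition mact (h : {ffun 'I_K.+1 -> msym}) r (am : msym * move) :
    {ffun 'I_K.+1 -> msym * move} :=
  [ffun i => if val i == r then am else (h i, MoveS)].

Definition mdelta (q : mstate) (h : {ffun 'I_K.+1 -> msym}) :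
    mstate * {ffun 'I_K.+1 -> msym * move} :=
  match nth (ICase 0 0 0 0) prog q with
  | ILeft r => (inord q.+1, mact h r (h (inord r), MoveL))
  | IWrite r b => (inord q.+1, mact h r (Some (inl b), MoveS))
  | IPop r => (inord q.+1, mact h r (None, MoveR))
  | ICase r j0 jf jt =>
      (inord (match h (inord r) with
              | Some (inl false) => jf
              | Some (inl true) => jt
              | _ => j0 end),
       mact h r (h (inord r), MoveS))
  end.

Definition machine : tm :=
  @TM mstate void K (inord 0) (fun q => val q == size prog) mdelta.

(* The top of a stack is under the head and the rest to its right, so that the
   initial and final contents of tape 0 are the input and output strings. *)
Definition rep_tape (t : tape machine) (s : string) : Prop :=
  (forall j, nth None (tape_head t :: tape_right t) j =
             nth None [seq Some (inl b) | b <- s] j) /\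
  (forall j, nth None (tape_left t) j = None).

Definition rep (cf : config machine) (pc : nat) (st : store) : Prop :=
  val (cfg_state cf) = pc /\ forall i, rep_tape (cfg_tapes cf i) (st (val i)).

Definition msteps n (cf : config machine) := iter n (@tm_step machine) cf.

Lemma rep_step cf pc st pc' r am s :
  rep cf pc st -> pc < size prog -> pc' <= size prog -> r <= K ->
  (forall (q : mstate) (h : {ffun 'I_K.+1 -> msym}), val q = pc ->
    tape_head (cfg_tapes cf (inord r)) = h (inord r) ->
     mdelta q h = (inord pc', mact h r am)) ->
  rep_tape (write_move (cfg_tapes cf (inord r)) am) s ->
  rep (tm_step cf) pc' (upd st r s).
Proof.
move=> [Hpc Ht] lt_pc le_pc' le_rK Hd Hs.
rewrite /tm_step /= Hpc; case: eqP => [E|_]; first by rewrite E ltnn in lt_pc.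
rewrite (Hd _ _ Hpc) ?ffunE //; split=> [|i] /=; first by rewrite inordK.
rewrite ffunE /upd; case: eqP => [E|NE].
  by rewrite -[i]inord_val E.
rewrite ffunE; have := Ht i; case: (cfg_tapes cf i) => l h rr.
by rewrite /rep_tape /write_move.
Qed.

Lemma upd_id st r : upd st r (st r) = st.
Proof.
by apply: functional_extensionality => i; rewrite /upd; case: eqP => [->|].
Qed.

Lemma upd_upd st r s s' : upd (upd st r s) r s' = upd st r s'.
Proof.
by apply: functional_extensionality => i; rewrite /upd; case: eqP.
Qed.

Lemma rep_case cf pc st r j0 jf jt :
  nth (ICase 0 0 0 0) prog pc = ICase r j0 jf jt ->
  rep cf pc st -> pc < size prog -> r <= K ->
  (match st r with [::] => j0 | false :: _ => jf | true :: _ => jt end)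
    <= size prog ->
  rep (tm_step cf)
    (match st r with [::] => j0 | false :: _ => jf | true :: _ => jt end) st.
Proof.
move=> Hn Hr lt_pc le_rK le_j.
set t := cfg_tapes cf (inord r).
have Ht : rep_tape t (st r).
  by case: Hr => _ /(_ (inord r)); rewrite /= inordK.
rewrite -[X in rep _ _ X](upd_id st r).
apply: (@rep_step _ pc _ _ r (tape_head t, MoveS)) => //.
move=> q h Hq; rewrite -/t => Eh; rewrite /mdelta Hq Hn -Eh.
by case: Ht => /(_ 0) /= ->; case: (st r) => [|[] s].
Qed.

(** A machine writes before it moves, so a push takes two steps. In between, the head is on the
    blank cell beyond the top and the tape represents no stack, so [rep_step] does not apply and
    both steps are treated together. *)
Lemma rep_left cf pc st r b :
  nth (ICase 0 0 0 0) prog pc = ILeft r ->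
  nth (ICase 0 0 0 0) prog pc.+1 = IWrite r b ->
  rep cf pc st -> pc.+1 < size prog -> r <= K ->
  rep (msteps 2 cf) pc.+2 (upd st r (b :: st r)).
Proof.
move=> Hn1 Hn2 Hr lt_pc le_rK.
have [Hst Hts] := Hr.
have Ht : rep_tape (cfg_tapes cf (inord r)) (st r).
  by have := Hts (inord r); rewrite /= inordK.
rewrite /msteps /=.
have E1 : cfg_state (tm_step cf) = inord pc.+1 :> mstate.
  rewrite /tm_step /= Hst; case: eqP => [E|_]; first by lia.
  by rewrite /mdelta Hst Hn1.
have E2 i : cfg_tapes (tm_step cf) i =
    if val i == r then write_move (cfg_tapes cf i) (tape_head (cfg_tapes cf i), MoveL)
    else cfg_tapes cf i.
  rewrite /tm_step /= Hst; case: eqP => [E|_]; first by lia.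
  rewrite /mdelta Hst Hn1 /= !ffunE; case: eqP => [<-|_]; first by rewrite inord_val.
  by case: (cfg_tapes cf i).
set cf1 := tm_step cf in E1 E2 *.
have Hq : val (cfg_state cf1) = pc.+1 by rewrite E1 /= inordK // ltnS ltnW.
have Hs2 : tm_step cf1 = Config (inord pc.+2 : tm_state machine) (fun i =>
    if val i == r then write_move (cfg_tapes cf1 i) (Some (inl b) : tm_sym machine, MoveS)
    else write_move (cfg_tapes cf1 i) (tape_head (cfg_tapes cf1 i), MoveS)).
  rewrite /tm_step /= Hq; case: eqP => [E|_]; first by lia.
  rewrite /mdelta Hq Hn2 /=; congr Config.
  by apply: functional_extensionality => i; rewrite !ffunE; case: eqP.
rewrite Hs2; split=> [|i] /=; first by rewrite inordK.
rewrite E2 /upd; case: eqP => [E|_]; last first.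
  by have := Hts i; case: (cfg_tapes cf i).
have := Hts i; rewrite /= E; case: (cfg_tapes cf i) => l h rr.
rewrite /rep_tape /write_move /= => -[H1 H2]; split=> [[|j]|j] //=.
by rewrite nth_behead.
Qed.

Lemma rep_pop cf pc st r :
  nth (ICase 0 0 0 0) prog pc = IPop r ->
  rep cf pc st -> pc < size prog -> r <= K ->
  rep (tm_step cf) pc.+1 (upd st r (behead (st r))).
Proof.
move=> Hn Hr lt_pc le_rK.
have Ht : rep_tape (cfg_tapes cf (inord r)) (st r).
  by case: Hr => _ /(_ (inord r)); rewrite /= inordK.
apply: (@rep_step _ pc _ _ r (None, MoveR)) => //.
- by move=> q h Hq _; rewrite /mdelta Hq Hn.
- case: (cfg_tapes cf (inord r)) Ht => l h rr.
  rewrite /rep_tape /write_move /= => -[H1 H2]; split=> [j|[|j]] //=.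
  rewrite -behead_map nth_behead -H1 /=.
  by case: j => [|j] /=; rewrite ?nth0 ?nth_behead.
Qed.

Definition code_at s pc := exists s1 s2, prog = s1 ++ s ++ s2 /\ size s1 = pc.

Lemma code_at_nth i s pc :
  code_at (i :: s) pc -> nth (ICase 0 0 0 0) prog pc = i /\ pc < size prog.
Proof.
case=> s1 [s2 [-> <-]]; rewrite nth_cat ltnn subnn /= !size_cat /=.
by split=> //; lia.
Qed.

Lemma code_at_cat s s' pc :
  code_at (s ++ s') pc -> code_at s pc /\ code_at s' (pc + size s).
Proof.
case=> s1 [s2 [E <-]]; split.
  by exists s1, (s' ++ s2); rewrite E -!catA.
by exists (s1 ++ s), s2; rewrite E size_cat -!catA.
Qed.

Lemma code_at_cons i s pc : code_at (i :: s) pc -> code_at s pc.+1.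
Proof. by rewrite -cat1s => /code_at_cat [_]; rewrite addn1. Qed.

Lemma code_at_size s pc : code_at s pc -> pc + size s <= size prog.
Proof. by case=> s1 [s2 [-> <-]]; rewrite !size_cat; lia. Qed.

Lemma mstepsD m n cf : msteps (m + n) cf = msteps n (msteps m cf).
Proof. by rewrite /msteps addnC iterD. Qed.

Lemma compile_correct c st n st' : exec c st n st' ->
  forall pc cf, regs c <= K.+1 -> code_at (code c pc) pc -> rep cf pc st ->
  rep (msteps n cf) (pc + size (code c pc)) st'.
Proof.
elim=> {c st n st'}.
- by move=> st pc cf _ _; rewrite addn0.
- move=> r b st pc cf /= Hk Hc Hr.
  have [N1 _] := code_at_nth Hc; have [N2 L2] := code_at_nth (code_at_cons Hc).
  by rewrite addn2; apply: rep_left.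
- move=> r st pc cf /= Hk Hc Hr; have [N1 L1] := code_at_nth Hc.
  by rewrite addn1; apply: rep_pop.
- move=> c1 c2 st n1 st1 n2 st2 _ IH1 _ IH2 pc cf /=.
  rewrite geq_max => /andP[K1 K2] /code_at_cat [C1 C2] Hr.
  rewrite mstepsD size_cat addnA; apply: IH2 => //; exact: IH1.
- move=> r c0 cf ct st n st' _ IH pc cfg /=.
  rewrite !geq_max => /and4P[Kr K0 Kf Kt].
  set s0 := code c0 _; set bf := (_ + _ + 1).
  set sf := code cf _; set bt := (_ + _ + 1).
  set s1 := code ct _; set j := (_ + _ + 1).
  move=> Hc Hr; have [N0 L0] := code_at_nth Hc.
  have [C0 Hc1] := code_at_cat (code_at_cons Hc).
  have [N1 L1] := code_at_nth Hc1.
  have := code_at_cons Hc1; rewrite -[_.+1]addn1 -/bf => /code_at_cat [Cf Hc2].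
  have [N2 L2] := code_at_nth Hc2.
  have := code_at_cons Hc2; rewrite -[_.+1]addn1 -/bt -cats1 => /code_at_cat [Ct Hc3].
  have [N3 L3] := code_at_nth Hc3.
  have Sj := code_at_size Hc3; rewrite /= -/j in Sj.
  have -> : pc + (size (s0 ++ ICase r j j j :: sf ++ ICase r j j j
      :: s1 ++ [:: ICase r j j j])).+1 = j.
    by do 3 rewrite size_cat /=; rewrite /j /bt /bf; lia.
  have Hstep := rep_case N0 Hr L0 Kr.
  rewrite -[tm_step _]/(msteps (1 + n.+1) cfg) -[n.+1]addn1 !mstepsD.
  case: (st r) IH Hstep => [|[] s'] /= IH Hstep.
  + have := IH _ _ K0 C0 (Hstep (ltnW (leq_ltn_trans (leq_addr _ _) L1))) => Hr1.
    by have := rep_case N1 Hr1 L1 Kr; case: (st' r) => [|[] ?]; apply.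
  + have := IH _ _ Kt Ct (Hstep (ltnW (leq_ltn_trans (leq_addr _ _) L3))) => Hr1.
    by have := rep_case N3 Hr1 L3 Kr; case: (st' r) => [|[] ?]; apply.
  + have := IH _ _ Kf Cf (Hstep (ltnW (leq_ltn_trans (leq_addr _ _) L2))) => Hr1.
    by have := rep_case N2 Hr1 L2 Kr; case: (st' r) => [|[] ?]; apply.
- move=> r c st Hst pc cf /=; rewrite geq_max => /andP[Kr Kc].
  set s := code c _; set j := (_ + _ + 1) => Hc Hr.
  have [N0 L0] := code_at_nth Hc; have := rep_case N0 Hr L0 Kr.
  rewrite Hst /msteps /= size_rcons (_ : pc + _ = j) ?/j; last by lia.
  by apply; have := code_at_size Hc; rewrite /= size_rcons /j; lia.
- move=> r c st n1 st1 n2 st2 Hst _ IH1 _ IH2 pc cf Hk Hc Hr; rewrite !mstepsD.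
  apply: IH2 => //; move: Hk Hc => /=; rewrite geq_max => /andP[Kr Kc].
  set s := code c _; set j := (_ + _ + 1) => Hc.
  have [N0 L0] := code_at_nth Hc; have := rep_case N0 Hr L0 Kr.
  have := code_at_cons Hc; rewrite -cats1 => /code_at_cat [C1 C2].
  have [N1 L1] := code_at_nth C2.
  have -> : match st r with [::] => j | false :: _ => pc.+1 | true :: _ => pc.+1 end
    = pc.+1 by case: (st r) Hst => [|[]].
  move/(_ (ltnW (leq_ltn_trans (leq_addr _ _) L1))) => Hr1.
  have := rep_case N1 (IH1 _ _ Kc C1 Hr1) L1 Kr.
  by case: (st1 r) => [|[] ?]; apply; apply: ltnW.
Qed.

End Machine.

Definition ls (l : seq string) : store := fun i => nth [::] l i.

Lemma bit_prefixE (A : Type) (s : string) (t : seq (option (bool + A))) :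
  (forall j, nth None t j = nth None [seq Some (inl b) | b <- s] j) ->
  bit_prefix t = s.
Proof.
elim: s t => [|b s IHs] [|a t] H //=.
- by have := H 0 => /= ->.
- by have := H 0.
- by have := H 0 => /= ->; rewrite IHs // => j; have := H j.+1.
Qed.

Lemma exec_tm c : exists M, forall x y n,
  exec c (ls [:: x]) n (ls [:: y]) -> forall m, n <= m -> tm_computes_within M m x y.
Proof.
pose prog := code c 0; exists (machine (regs c) prog) => x y n Hex m le_nm.
have Hat : code_at prog (code c 0) 0 by exists [::], [::]; rewrite cats0.
have Hr0 : rep (tm_init (machine (regs c) prog) x) 0 (ls [:: x]).
  split=> [|i] /=; first by rewrite inordK.
  rewrite /rep_tape /tape_of /ls; case: eqP => [->|Ni] /=.
    split=> j; last by rewrite nth_nil.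
    by case: (x) j => [|b s] [|j] //=; rewrite nth_nil.
  case: i Ni => -[|k] //= p Np; first by case: Np; apply: val_inj.
  by rewrite nth_nil /=; split=> [[|j]|j] //=; rewrite nth_nil.
have Hr := compile_correct Hex (leqnSn _) Hat Hr0.
have Hh k : msteps (n + k) (tm_init (machine (regs c) prog) x) =
            msteps n (tm_init (machine (regs c) prog) x).
  elim: k => [|k IHk]; first by rewrite addn0.
  rewrite addnS /msteps iterS -/(msteps _ _) IHk /tm_step /=.
  by case: Hr => -> _; rewrite add0n eqxx.
rewrite /tm_computes_within -/(msteps m _) -(subnKC le_nm) Hh.
case: Hr => Hs Ht; split=> /=; first by rewrite Hs add0n.
by rewrite /tm_output; apply: bit_prefixE; case: (Ht ord0).
Qed.

(** * Simulation of Turing machines in the stack language *)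

Definition run c st B st' := exists2 n, n <= B & exec c st n st'.

Lemma run_le c st B B' st' : B <= B' -> run c st B st' -> run c st B' st'.
Proof. by move=> le_B [n le_n H]; exists n => //; apply: leq_trans le_B. Qed.

Lemma run_skip st : run Skip st 0 st.
Proof. by exists 0 => //; exact: exec_skip. Qed.

Lemma run_push r b st : run (Push r b) st 2 (upd st r (b :: st r)).
Proof. by exists 2 => //; exact: exec_push. Qed.

Lemma run_pop r st : run (Pop r) st 1 (upd st r (behead (st r))).
Proof. by exists 1 => //; exact: exec_pop. Qed.

Lemma run_seq c1 c2 st B1 st1 B2 st2 :
  run c1 st B1 st1 -> run c2 st1 B2 st2 -> run (Seq c1 c2) st (B1 + B2) st2.
Proof.
move=> [n1 le1 H1] [n2 le2 H2]; exists (n1 + n2); first exact: leq_add.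
exact: exec_seq H1 H2.
Qed.

Lemma run_case r c0 cf ct st B st' :
  run (branch (st r) c0 cf ct) st B st' -> run (Case r c0 cf ct) st B.+2 st'.
Proof. by move=> [n le_n H]; exists n.+2 => //; exact: exec_case. Qed.

Lemma run_while0 r c st : st r = [::] -> run (While r c) st 1 st.
Proof. by move=> H; exists 1 => //; exact: exec_while0. Qed.

Lemma run_whileS r c st B1 st1 B2 st2 : st r <> [::] ->
  run c st B1 st1 -> run (While r c) st1 B2 st2 ->
  run (While r c) st (2 + B1 + B2) st2.
Proof.
move=> Hr [n1 le1 H1] [n2 le2 H2]; exists (1 + n1 + 1 + n2); first by lia.
exact: exec_whileS H1 H2.
Qed.

Lemma run_size c st B st' r : run c st B st' -> size (st' r) <= size (st r) + B.
Proof. by move=> [n le_n /exec_size -/(_ r)]; lia. Qed.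

Lemma upd_ls l r v : upd (ls l) r v = ls (set_nth [::] l r v).
Proof.
by apply: functional_extensionality => i; rewrite /upd /ls nth_set_nth /=.
Qed.

Lemma ls_trail l k : ls (l ++ nseq k [::]) = ls l.
Proof.
apply: functional_extensionality => i; rewrite /ls nth_cat nth_nseq.
by case: ltnP => // le_i; rewrite if_same nth_default.
Qed.

Lemma updE st r s i : upd st r s i = if i == r then s else st i.
Proof. by []. Qed.

Lemma upd_comm st r s r' s' : r != r' ->
  upd (upd st r s) r' s' = upd (upd st r' s') r s.
Proof.
move=> Nr; apply: functional_extensionality => i; rewrite !updE.
by case: eqP => // ->; rewrite eq_sym (negbTE Nr).
Qed.

(** * Elementary programs *)

(** The moved word arrives reversed; two moves preserve the order. *)
Definition mv a b :=
  While a (Case a Skip (Seq (Pop a) (Push b false)) (Seq (Pop a) (Push b true))).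

Lemma run_mv a b st : a != b ->
  run (mv a b) st (7 * size (st a) + 1)
    (upd (upd st a [::]) b (catrev (st a) (st b))).
Proof.
move=> Nab; move E: (st a) => s; elim: s st E => [|x s IHs] st E.
  rewrite -{2}E /= upd_id upd_id; exact: run_while0.
apply: (@run_le _ _ (2 + 5 + (7 * size s + 1))) => /=; first by lia.
have Nba : (b == a) = false by rewrite eq_sym (negbTE Nab).
pose st1 := upd (upd st a s) b (x :: st b).
apply: (@run_whileS _ _ _ _ st1).
- by rewrite E.
- apply: (@run_case _ _ _ _ _ 3); rewrite E.
  have -> : branch (x :: s) Skip (Seq (Pop a) (Push b false))
     (Seq (Pop a) (Push b true)) = Seq (Pop a) (Push b x) by case: (x).
  apply: (@run_seq _ _ _ 1 _ 2); first exact: run_pop.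
  rewrite E /=; have := run_push b x (upd st a s).
  by rewrite [upd st a s b]updE Nba.
- have := IHs st1; rewrite /st1 !updE (negbTE Nab) !eqxx => /(_ erefl).
  by rewrite (upd_comm (upd st a s) _ _ (negbT Nba)) upd_upd upd_upd.
Qed.

Definition dup a b c :=
  While a (Case a Skip (Seq (Pop a) (Seq (Push b false) (Push c false)))
                       (Seq (Pop a) (Seq (Push b true) (Push c true)))).

Lemma run_dup a b c st : uniq [:: a; b; c] ->
  run (dup a b c) st (9 * size (st a) + 1)
    (upd (upd (upd st a [::]) b (catrev (st a) (st b))) c (catrev (st a) (st c))).
Proof.
rewrite /= !inE negb_or andbT => /andP[/andP[Nab Nac] Nbc].
have Nba : (b == a) = false by rewrite eq_sym (negbTE Nab).
have Nca : (c == a) = false by rewrite eq_sym (negbTE Nac).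
have Ncb : (c == b) = false by rewrite eq_sym (negbTE Nbc).
move E: (st a) => s; elim: s st E => [|x s IHs] st E.
  rewrite -{2}E /= upd_id upd_id upd_id; exact: run_while0.
apply: (@run_le _ _ (2 + 7 + (9 * size s + 1))) => /=; first by lia.
pose st1 := upd (upd (upd st a s) b (x :: st b)) c (x :: st c).
apply: (@run_whileS _ _ _ _ st1).
- by rewrite E.
- apply: (@run_case _ _ _ _ _ 5); rewrite E.
  have -> : branch (x :: s) Skip (Seq (Pop a) (Seq (Push b false) (Push c false)))
     (Seq (Pop a) (Seq (Push b true) (Push c true))) =
     Seq (Pop a) (Seq (Push b x) (Push c x)) by case: (x).
  apply: (@run_seq _ _ _ 1 _ 4); first exact: run_pop.
  rewrite E /=; apply: (@run_seq _ _ _ 2 _ 2); first exact: run_push.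
  have := run_push c x (upd (upd st a s) b (x :: st b)).
  by rewrite /st1 !updE Nba Nca Ncb.
- have := IHs st1; rewrite /st1 !updE (negbTE Nab) (negbTE Nac) (negbTE Nbc) !eqxx.
  move/(_ erefl).
  have -> : upd (upd (upd (upd (upd (upd st a s) b (x :: st b)) c (x :: st c)) a
      [::]) b (catrev s (x :: st b))) c (catrev s (x :: st c)) =
    upd (upd (upd st a [::]) b (catrev (x :: s) (st b))) c (catrev (x :: s) (st c)).
    apply: functional_extensionality => i; rewrite !updE /=.
    by case: (i == a); case: (i == b); case: (i == c).
  by [].
Qed.

Definition clr a := While a (Pop a).

Lemma run_clr a st : run (clr a) st (3 * size (st a) + 1) (upd st a [::]).
Proof.
move E: (st a) => s; elim: s st E => [|x s IHs] st E.
  rewrite -{2}E upd_id; exact: run_while0.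
apply: (@run_le _ _ (2 + 1 + (3 * size s + 1))) => /=; first by lia.
apply: (@run_whileS _ _ _ _ (upd st a s)); first by rewrite E.
- by have := run_pop a st; rewrite E.
- by have := IHs (upd st a s); rewrite updE eqxx upd_upd; apply.
Qed.

Fixpoint pushw r (w : string) : cmd :=
  if w is b :: w' then Seq (pushw r w') (Push r b) else Skip.

Lemma run_pushw r w st : run (pushw r w) st (2 * size w) (upd st r (w ++ st r)).
Proof.
elim: w => [|b w IHw] /=; first by rewrite upd_id; exact: run_skip.
rewrite mulnS addnC; apply: run_seq IHw _.
have := run_push r b (upd st r (w ++ st r)).
by rewrite updE eqxx upd_upd.
Qed.

(** The continuation is a function of the word read, so the program is a decision tree with [2 ^ n]
    leaves. This is harmless, as [n] depends only on the simulated machine. *)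
Fixpoint readn r n (acc : string) (k : string -> cmd) : cmd :=
  if n is n'.+1 then
    Case r Skip (Seq (Pop r) (readn r n' (rcons acc false) k))
                (Seq (Pop r) (readn r n' (rcons acc true) k))
  else k acc.

Lemma run_readn r n acc k st w s B st' : st r = w ++ s -> size w = n ->
  run (k (acc ++ w)) (upd st r s) B st' -> run (readn r n acc k) st (3 * n + B) st'.
Proof.
elim: n acc st w => [|n IHn] acc st [|b w] //= E; first by rewrite cats0 -E upd_id.
case=> Ew Hk; rewrite mulnS; apply: (@run_case _ _ _ _ _ (1 + (3 * n + B))).
rewrite E.
have -> : branch (b :: w ++ s) Skip (Seq (Pop r) (readn r n (rcons acc false) k))
   (Seq (Pop r) (readn r n (rcons acc true) k)) =
   Seq (Pop r) (readn r n (rcons acc b) k) by case: (b).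
apply: run_seq (run_pop _ _) _; rewrite E /=.
by apply: (IHn _ _ w); rewrite ?updE ?eqxx // upd_upd -cats1 -catA.
Qed.

(** One-hot code, of the same length for all elements. *)
Definition cod (T : finType) (a : T) : string := [seq a == b | b <- enum T].

Lemma size_cod (T : finType) (a : T) : size (cod a) = #|T|.
Proof. by rewrite size_map -cardE. Qed.

Lemma cod_inj (T : finType) : injective (@cod T).
Proof.
move=> a b Eab.
have : nth false (cod a) (index a (enum T)) = nth false (cod b) (index a (enum T)).
  by rewrite Eab.
have Ha : index a (enum T) < size (enum T) by rewrite index_mem mem_enum.
by rewrite /cod !(nth_map a false _ Ha) nth_index ?mem_enum // eqxx => /esym/eqP.
Qed.

Definition dec (T : finType) (d : T) (w : string) : T :=
  odflt d [pick a | cod a == w].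

Lemma codK (T : finType) (d : T) : cancel (@cod T) (dec d).
Proof.
by move=> a; rewrite /dec; case: pickP => [b /eqP/cod_inj //|/(_ a)]; rewrite eqxx.
Qed.

Section Simulation.
Variable M : tm.
Local Notation K1 := (tm_tapes M).+1.
Local Notation sym := (tm_sym M).
Definition nG := #|{: tm_sym M}|.
Definition nK := size (enum 'I_K1).
Definition nQ := #|tm_state M|.

Lemma nG_gt0 : 0 < nG.
Proof. by apply/card_gt0P; exists None. Qed.

Lemma size_codG (a : sym) : size (cod a) = nG.
Proof. exact: size_cod. Qed.

Lemma size_codQ (q : tm_state M) : size (cod q) = nQ.
Proof. exact: size_cod. Qed.

Definition blank : sym := None.
Definition fl (l : seq sym) : string := flatten [seq cod a | a <- l].

Definition rL (i : 'I_K1) := 3 + 2 * i.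
Definition rR (i : 'I_K1) := 4 + 2 * i.

(* The registers: [io], the coded state, the loop flag, and two stacks of coded
   symbols per tape, left of the head and from the head on. *)
Definition mk (io q f : string) (lf rf : 'I_K1 -> seq sym) : store := fun r =>
  if r == 0 then io else if r == 1 then q else if r == 2 then f else
  if [pick i | r == rL i] is Some i then fl (lf i) else
  if [pick i | r == rR i] is Some i then fl (rf i) else [::].

Lemma mk_L io q f lf rf i : mk io q f lf rf (rL i) = fl (lf i).
Proof.
rewrite /mk /=; case: pickP => [j /eqP E|/(_ i)]; last by rewrite eqxx.
by congr (fl (lf _)); apply: val_inj => /=; move: E; rewrite /rL; lia.
Qed.

Lemma mk_R io q f lf rf i : mk io q f lf rf (rR i) = fl (rf i).
Proof.
rewrite /mk /=; case: pickP => [j /eqP E|_]; first by move: E; rewrite /rL /rR; lia.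
case: pickP => [j /eqP E|/(_ i)]; last by rewrite eqxx.
by congr (fl (rf _)); apply: val_inj => /=; move: E; rewrite /rR; lia.
Qed.

Lemma upd_mk0 io q f lf rf v : upd (mk io q f lf rf) 0 v = mk v q f lf rf.
Proof. by apply: functional_extensionality => -[|r]. Qed.

Lemma upd_mk1 io q f lf rf v : upd (mk io q f lf rf) 1 v = mk io v f lf rf.
Proof. by apply: functional_extensionality => -[|[|r]]. Qed.

Lemma upd_mk2 io q f lf rf v : upd (mk io q f lf rf) 2 v = mk io q v lf rf.
Proof. by apply: functional_extensionality => -[|[|[|r]]]. Qed.

Definition fupd (g : 'I_K1 -> seq sym) i l j := if j == i then l else g j.

Lemma fupd_same g i l : fupd g i l i = l.
Proof. by rewrite /fupd eqxx. Qed.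

Lemma upd_mkL io q f lf rf i l :
  upd (mk io q f lf rf) (rL i) (fl l) = mk io q f (fupd lf i l) rf.
Proof.
apply: functional_extensionality => r; rewrite updE; case: eqP => [->|Nr].
  by rewrite mk_L /fupd eqxx.
rewrite /mk; do 3 case: eqP => // _; case: pickP => // j /eqP E.
by rewrite /fupd; case: eqP => // Ej; case: Nr; rewrite E Ej.
Qed.

Lemma upd_mkR io q f lf rf i l :
  upd (mk io q f lf rf) (rR i) (fl l) = mk io q f lf (fupd rf i l).
Proof.
apply: functional_extensionality => r; rewrite updE; case: eqP => [->|Nr].
  by rewrite mk_R /fupd eqxx.
rewrite /mk; do 3 case: eqP => // _; case: pickP => // _.
case: pickP => // j /eqP E.
by rewrite /fupd; case: eqP => // Ej; case: Nr; rewrite E Ej.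
Qed.

(** An exhausted stack stands for infinitely many blanks, so reading from it yields [blank]. *)
Definition readg r (k : sym -> cmd) : cmd :=
  let c := readn r nG [::] (fun w => k (dec blank w)) in Case r (k blank) c c.

Lemma run_readg r k st l B st' : st r = fl l ->
  run (k (head blank l)) (upd st r (fl (behead l))) B st' ->
  run (readg r k) st (3 * nG + 2 + B) st'.
Proof.
case: l => [|a l] E Hk.
  apply: (@run_le _ _ B.+2); first by lia.
  by apply: run_case; rewrite E /=; rewrite /= -E upd_id in Hk.
rewrite addnAC addn2; apply: run_case.
have -> : branch (st r) (k blank) (readn r nG [::] (fun w => k (dec blank w)))
    (readn r nG [::] (fun w => k (dec blank w))) =
    readn r nG [::] (fun w => k (dec blank w)).
  have : st r <> [::]; last by case: (st r) => [|[]].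
  rewrite E /fl /= => /(congr1 size)/eqP; rewrite size_cat size_codG addn_eq0.
  by rewrite -leqn0 leqNgt nG_gt0.
apply: (@run_readn _ _ _ _ _ (cod a) (fl l)); rewrite ?size_codG //.
by rewrite codK.
Qed.

Fixpoint readheads (s : seq 'I_K1) (h : 'I_K1 -> sym) (k : ('I_K1 -> sym) -> cmd) :=
  if s is i :: s' then
    readg (rR i) (fun a => readheads s' (fun j => if j == i then a else h j) k)
  else k h.

Lemma run_readheads s h k io q f lf rf B st' : uniq s ->
  run (k (fun i => if i \in s then head blank (rf i) else h i))
    (mk io q f lf (fun i => if i \in s then behead (rf i) else rf i)) B st' ->
  run (readheads s h k) (mk io q f lf rf) (size s * (3 * nG + 2) + B) st'.
Proof.
elim: s h rf => [|i s IHs] h rf //= /andP[Ni Us] Hk.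
rewrite mulSn -addnA; apply: (run_readg (mk_R _ _ _ _ _ i)).
rewrite upd_mkR; apply: IHs => //.
move: Hk; set k1 := k _; set st1 := mk _ _ _ _ _; set k2 := k _; set st2 := mk _ _ _ _ _.
have -> : k1 = k2.
  congr k; apply: functional_extensionality => j; rewrite inE /fupd.
  by case: eqP => //= ->; rewrite (negbTE Ni).
have -> // : st1 = st2.
congr mk; apply: functional_extensionality => j; rewrite inE /fupd.
by case: eqP => //= ->; rewrite (negbTE Ni).
Qed.

Definition wml (am : sym * move) (l : seq sym) :=
  match am.2 with MoveL => behead l | MoveS => l | MoveR => am.1 :: l end.
Definition wmr (am : sym * move) (l r : seq sym) :=
  match am.2 with
  | MoveL => [:: head blank l, am.1 & r] | MoveS => am.1 :: r | MoveR => r end.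

Definition wm i (am : sym * move) : cmd :=
  match am.2 with
  | MoveL => Seq (pushw (rR i) (cod am.1))
                 (readg (rL i) (fun b => pushw (rR i) (cod b)))
  | MoveS => pushw (rR i) (cod am.1)
  | MoveR => pushw (rL i) (cod am.1)
  end.

Lemma run_wm i am io q f lf rf :
  run (wm i am) (mk io q f lf rf) (7 * nG + 2)
    (mk io q f (fupd lf i (wml am (lf i))) (fupd rf i (wmr am (lf i) (rf i)))).
Proof.
have pR a lf' rf' : run (pushw (rR i) (cod a)) (mk io q f lf' rf') (2 * nG)
    (mk io q f lf' (fupd rf' i (a :: rf' i))).
  have := run_pushw (rR i) (cod a) (mk io q f lf' rf').
  by rewrite mk_R -[cod a ++ _]/(fl (a :: rf' i)) upd_mkR size_codG.
have fid g : fupd g i (g i) = g.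
  by apply: functional_extensionality => j; rewrite /fupd; case: eqP => [->|].
have ff g l l' : fupd (fupd g i l) i l' = fupd g i l'.
  by apply: functional_extensionality => j; rewrite /fupd; case: eqP.
case: am => a []; rewrite /wm /wml /wmr /=.
- apply: (@run_le _ _ (2 * nG + (3 * nG + 2 + 2 * nG))); first by lia.
  apply: run_seq (pR _ _ _) _; apply: (run_readg (mk_L _ _ _ _ _ i)).
  rewrite upd_mkL; have := pR (head blank (lf i)) (fupd lf i (behead (lf i)))
     (fupd rf i (a :: rf i)).
  by rewrite ff fupd_same.
- by apply: (@run_le _ _ (2 * nG)); [lia | rewrite fid; apply: pR].
- apply: (@run_le _ _ (2 * nG)); first by lia.
  have := run_pushw (rL i) (cod a) (mk io q f lf rf).
  by rewrite mk_L -[cod a ++ _]/(fl (a :: lf i)) upd_mkL size_codG fid.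
Qed.

Fixpoint wms (s : seq 'I_K1) (act : 'I_K1 -> sym * move) : cmd :=
  if s is i :: s' then Seq (wm i (act i)) (wms s' act) else Skip.

Lemma run_wms s act io q f lf rf : uniq s ->
  run (wms s act) (mk io q f lf rf) (size s * (7 * nG + 2))
    (mk io q f (fun i => if i \in s then wml (act i) (lf i) else lf i)
               (fun i => if i \in s then wmr (act i) (lf i) (rf i) else rf i)).
Proof.
elim: s lf rf => [|i s IHs] lf rf /=; first by move=> _; exact: run_skip.
case/andP=> Ni Us; rewrite mulSn; apply: run_seq (run_wm _ _ _ _ _ _ _) _.
have := IHs (fupd lf i (wml (act i) (lf i))) (fupd rf i (wmr (act i) (lf i) (rf i))) Us.
set st1 := mk _ _ _ _ _; set st2 := mk _ _ _ _ _; set st3 := mk _ _ _ _ _.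
have -> // : st2 = st3.
by congr mk; apply: functional_extensionality => j; rewrite inE /fupd;
  case: eqP => //= ->; rewrite (negbTE Ni).
Qed.

Definition tmrel (c : config M) (lf rf : 'I_K1 -> seq sym) : Prop :=
  forall i, [/\ lf i = tape_left (cfg_tapes c i),
    head blank (rf i) = tape_head (cfg_tapes c i) &
    behead (rf i) = tape_right (cfg_tapes c i)].

Definition flag (q : tm_state M) : string := if tm_halt q then [::] else [:: true].

(** The scanned symbols are popped while they are read. The written symbol is then pushed on the
    left stack for a move to the right and on the right stack otherwise; a move to the left also
    transfers the top of the left stack. *)
Definition body : cmd :=
  readn 1 nQ [::] (fun w =>
  readheads (enum 'I_K1) (fun=> blank) (fun h =>
  let qa := tm_delta (dec (tm_start M) w) [ffun i => h i] in
  Seq (pushw 1 (cod qa.1)) (Seq (wms (enum 'I_K1) qa.2)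
    (if tm_halt qa.1 then Pop 2 else Skip)))).

Definition cbody := 3 * nQ + (nK * (3 * nG + 2) +
  (2 * nQ + (nK * (7 * nG + 2) + 1))).

Lemma run_body c lf rf : tmrel c lf rf -> ~~ tm_halt (cfg_state c) ->
  exists lf' rf', tmrel (tm_step c) lf' rf' /\
    run body (mk [::] (cod (cfg_state c)) [:: true] lf rf) cbody
      (mk [::] (cod (cfg_state (tm_step c))) (flag (cfg_state (tm_step c))) lf' rf').
Proof.
move=> Hc Nh; pose am := (tm_delta (cfg_state c) [ffun i => tape_head (cfg_tapes c i)]).2.
exists (fun i => wml (am i) (lf i)), (fun i => wmr (am i) (lf i) (behead (rf i))).
rewrite /tm_step (negbTE Nh) /=; split.
  move=> i /=; have [-> _ ->] := Hc i; rewrite /wml /wmr /write_move.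
  by rewrite -/am; case: (am i) => a [] /=.
apply: (@run_readn _ _ _ _ _ (cod (cfg_state c)) [::]); rewrite ?cats0 ?size_codQ //.
rewrite upd_mk1 /= codK.
apply: run_readheads; first exact: enum_uniq.
set h := [ffun i => _].
have -> : h = [ffun i => tape_head (cfg_tapes c i)].
  by apply/ffunP=> i; rewrite !ffunE mem_enum; case: (Hc i).
set qa := tm_delta _ _.
apply: run_seq; first by have := run_pushw; rewrite -(size_codQ qa.1); apply.
rewrite upd_mk1 /= cats0; apply: run_seq.
  by apply: run_wms; exact: enum_uniq.
set st1 := mk _ _ _ _ _; set st2 := mk _ _ _ _ _.
have -> : st2 = upd st1 2 (flag qa.1).
  rewrite upd_mk2; congr mk; apply: functional_extensionality => i;
  by rewrite !mem_enum.
rewrite /flag; case: ifP => _; first exact: run_pop.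
by rewrite [upd _ _ _](_ : _ = st1) ?upd_mk2 //; apply: run_le (run_skip _).
Qed.

Lemma run_loop n c lf rf : tmrel c lf rf ->
  tm_halt (cfg_state (iter n (@tm_step M) c)) ->
  exists lf' rf', tmrel (iter n (@tm_step M) c) lf' rf' /\
    run (While 2 body) (mk [::] (cod (cfg_state c)) (flag (cfg_state c)) lf rf)
      (n * (2 + cbody) + 1)
      (mk [::] (cod (cfg_state (iter n (@tm_step M) c))) [::] lf' rf').
Proof.
elim: n c lf rf => [|n IHn] c lf rf Hc.
  move=> /= Hh; exists lf, rf; split=> //; rewrite /flag Hh; exact: run_while0.
have [Hh|Nh] := boolP (tm_halt (cfg_state c)).
  have E : tm_step c = c by rewrite /tm_step Hh.
  have -> : iter n.+1 (@tm_step M) c = c by elim: n.+1 => //= m ->.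
  move=> _; exists lf, rf; split=> //; rewrite /flag Hh.
  by apply: run_le (run_while0 _ _) => //; lia.
rewrite iterSr => Hh; have [lf1 [rf1 [H1 R1]]] := run_body Hc Nh.
have [lf2 [rf2 [H2 R2]]] := IHn _ _ _ H1 Hh; exists lf2, rf2; split=> //.
rewrite mulSn -addnA; apply: run_whileS R2; first by rewrite /flag (negbTE Nh).
by rewrite /flag (negbTE Nh).
Qed.

(** The input is first reversed into register 2, which is free until the loop flag is set; pushing
    the codes one by one restores the order. *)
Definition load : cmd :=
  Seq (mv 0 2) (While 2 (Case 2 Skip
    (Seq (Pop 2) (pushw (rR ord0) (cod (Some (inl false) : sym))))
    (Seq (Pop 2) (pushw (rR ord0) (cod (Some (inl true) : sym)))))).

Definition nolist (i : 'I_K1) : seq sym := [::].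

Lemma mk_ls x : mk x [::] [::] nolist nolist = ls [:: x].
Proof.
apply: functional_extensionality => -[|[|[|r]]] //.
by rewrite /mk /ls /=; case: pickP => // _; case: pickP.
Qed.

Lemma run_load x :
  run load (ls [:: x]) (7 * size x + 1 + (size x * (2 * nG + 5) + 1))
   (mk [::] [::] [::] nolist (fupd nolist ord0 [seq Some (inl b) | b <- x])).
Proof.
apply: run_seq; first exact: run_mv.
rewrite -mk_ls upd_mk0 upd_mk2 /= -/(rev x).
suff H y : run (While 2 (Case 2 Skip
    (Seq (Pop 2) (pushw (rR ord0) (cod (Some (inl false) : sym))))
    (Seq (Pop 2) (pushw (rR ord0) (cod (Some (inl true) : sym))))))
    (mk [::] [::] (rev x) nolist (fupd nolist ord0 [seq Some (inl b) | b <- y]))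
    (size x * (2 * nG + 5) + 1)
    (mk [::] [::] [::] nolist (fupd nolist ord0 [seq Some (inl b) | b <- x ++ y])).
  have := H [::]; rewrite cats0 (_ : fupd nolist ord0 [seq _ | b <- [::]] = nolist) //.
  by apply: functional_extensionality => j; rewrite /fupd if_same.
elim/last_ind: x y => [|x b IHx] y /=; first exact: run_while0.
rewrite rev_rcons size_rcons mulSn -addnA (_ : 2 * nG + 5 = 2 + (2 * nG + 1).+2); last by lia.
apply: run_whileS => //.
  apply: run_case; rewrite (_ : branch _ _ _ _ =
     Seq (Pop 2) (pushw (rR ord0) (cod (Some (inl b) : sym)))); last by case: (b).
  rewrite [2 * nG + 1]addnC; apply: run_seq; first exact: run_pop.
  rewrite upd_mk2 /=.
  by rewrite -(size_codG (Some (inl b) : sym)); apply: run_pushw.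
rewrite mk_R fupd_same -[cod _ ++ _]/(fl [seq Some (inl b) | b <- b :: y]) upd_mkR.
have := IHx (b :: y); rewrite -cats1 -catA /= (_ : (2 + (2 * nG + 1).+2) = 2 * nG + 5); last by lia.
set f1 := fupd _ _ _; set f2 := fupd _ _ _; set f3 := fupd _ _ _.
have -> // : f3 = f1.
by apply: functional_extensionality => j; rewrite /f3 /f1 /fupd; case: eqP.
Qed.

Definition unload : cmd :=
  Seq (clr 1) (Seq (Push 2 true) (Seq (While 2 (readg (rR ord0) (fun a =>
    if a is Some (inl b) then Push 1 b else Pop 2))) (mv 1 0))).

Lemma run_unload q lf rf : exists rf',
  run unload (mk [::] q [::] lf rf)
    (3 * size q + 1 + (2 + ((size (rf ord0)).+1 * (3 * nG + 6) + 1
       + (7 * size (rf ord0) + 1))))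
    (mk (bit_prefix (rf ord0)) [::] [::] lf rf').
Proof.
pose strip := fix strip (s : seq sym) :=
  if s is Some (inl b) :: s' then strip s' else behead s.
exists (fupd rf ord0 (strip (rf ord0))).
apply: run_seq; first exact: run_clr.
rewrite upd_mk1; apply: run_seq; first exact: run_push.
rewrite upd_mk2 /=.
have Hs : size (bit_prefix (rf ord0)) <= size (rf ord0).
  by elim: (rf ord0) => //= -[[b|]|] s.
apply: (@run_seq _ _ _ _ (mk [::] (rev (bit_prefix (rf ord0))) [::] lf
   (fupd rf ord0 (strip (rf ord0))))); last first.
  apply: (@run_le _ _ (7 * size (rev (bit_prefix (rf ord0))) + 1)).
    by rewrite size_rev leq_add2r leq_mul2l.
  have := @run_mv 1 0 (mk [::] (rev (bit_prefix (rf ord0))) [::] lf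
   (fupd rf ord0 (strip (rf ord0)))) isT.
  by rewrite upd_mk1 upd_mk0 /= -/(rev _) revK.
suff H s acc : run (While 2 (readg (rR ord0) (fun a =>
    if a is Some (inl b) then Push 1 b else Pop 2)))
    (mk [::] acc [:: true] lf (fupd rf ord0 s)) ((size s).+1 * (3 * nG + 6) + 1)
    (mk [::] (catrev (bit_prefix s) acc) [::] lf (fupd rf ord0 (strip s))).
  have := H (rf ord0) [::]; rewrite [fupd rf ord0 (rf ord0)](_ : _ = rf) //.
  by apply: functional_extensionality => j; rewrite /fupd; case: eqP => [->|].
have Ef l l' : fupd (fupd rf ord0 l) ord0 l' = fupd rf ord0 l'.
  by apply: functional_extensionality => j; rewrite /fupd; case: eqP.
elim: s acc => [|a s IHs] acc.
  rewrite mul1n (_ : _ + 6 = 2 + (3 * nG + 2 + 2)); last by lia.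
  apply: run_whileS; [done| |exact: run_while0].
  apply: (run_readg (mk_R _ _ _ _ _ _)); rewrite upd_mkR Ef !fupd_same.
  apply: run_le (_ : run _ _ 1 _) => //.
  by have := run_pop 2 (mk [::] acc [:: true] lf (fupd rf ord0 [::])); rewrite upd_mk2.
have EB : (size (a :: s)).+1 * (3 * nG + 6) + 1 =
    2 + (3 * nG + 2 + 2) + ((size s).+1 * (3 * nG + 6) + 1).
  by rewrite /= mulSn -addnA; congr addn; lia.
rewrite EB {EB}.
have Hother : (forall b, a <> Some (inl b)) ->
    run (While 2 (readg (rR ord0) (fun a0 =>
      if a0 is Some (inl b) then Push 1 b else Pop 2)))
    (mk [::] acc [:: true] lf (fupd rf ord0 (a :: s)))
    (2 + (3 * nG + 2 + 2) + 1) (mk [::] acc [::] lf (fupd rf ord0 s)).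
  move=> Ha; apply: run_whileS; [done| |exact: run_while0].
  apply: (run_readg (mk_R _ _ _ _ _ _)); rewrite upd_mkR Ef !fupd_same /=.
  have -> : (if a is Some (inl b) then Push 1 b else Pop 2) = Pop 2.
    by case: (a) Ha => // -[] // b /(_ b).
  apply: run_le (_ : run _ _ 1 _) => //.
  by have := run_pop 2 (mk [::] acc [:: true] lf (fupd rf ord0 s)); rewrite upd_mk2.
case: a Hother => [[b|e]|] Hother /=.
- apply: run_whileS (IHs (b :: acc)) => //.
  apply: (run_readg (mk_R _ _ _ _ _ _)); rewrite upd_mkR Ef !fupd_same /=.
  by have := run_push 1 b (mk [::] acc [:: true] lf (fupd rf ord0 s)); rewrite upd_mk1.
- by apply: run_le (Hother _) => //; lia.
- by apply: run_le (Hother _) => //; lia.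
Qed.

(** The final store has to contain the output and nothing else, since programs are composed through
    stores of the form [ls [:: y]]. *)
Fixpoint clrall (s : seq 'I_K1) : cmd :=
  if s is i :: s' then Seq (clr (rL i)) (Seq (clr (rR i)) (clrall s')) else Skip.

Lemma run_clrall s io q f lf rf B :
  (forall i, size (fl (lf i)) <= B) -> (forall i, size (fl (rf i)) <= B) ->
  run (clrall s) (mk io q f lf rf) (size s * (6 * B + 2))
   (mk io q f (fun i => if i \in s then [::] else lf i)
              (fun i => if i \in s then [::] else rf i)).
Proof.
elim: s lf rf => [|i s IHs] lf rf Hl Hr /=; first exact: run_skip.
rewrite mulSn; apply: (@run_le _ _ (3 * B + 1 + (3 * B + 1 + size s * (6 * B + 2)))).
  by lia.
apply: run_seq.
  by apply: run_le (run_clr _ _); rewrite mk_L; have := Hl i; lia.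
rewrite (upd_mkL _ _ _ _ _ _ [::]); apply: run_seq.
  by apply: run_le (run_clr _ _); rewrite mk_R; have := Hr i; lia.
rewrite (upd_mkR _ _ _ _ _ _ [::]).
have := IHs (fupd lf i [::]) (fupd rf i [::]).
set st1 := mk _ _ _ _ _; set st2 := mk _ _ _ _ _; set st3 := mk _ _ _ _ _.
have -> : st2 = st3.
  by congr mk; apply: functional_extensionality => j; rewrite inE /fupd;
    case: eqP => //= ->; rewrite if_same.
by apply=> j; rewrite /fupd; case: ifP.
Qed.

Definition simulate : cmd :=
  Seq (Seq (Seq load (Seq (Seq (pushw 1 (cod (tm_start M)))
    (pushw 2 (flag (tm_start M)))) (While 2 body))) unload) (clrall (enum 'I_K1)).

Lemma size_fl l : size (fl l) = nG * size l.
Proof. by elim: l => [|a l IHl]; rewrite ?muln0 //= size_cat size_codG IHl mulnS. Qed.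

(** A stack never outgrows the input length plus the elapsed time, hence the nested occurrences of
    [n + B2] and [n + B2 + B3]. *)
Definition csim n m :=
  let B1 := 7 * n + 1 + (n * (2 * nG + 5) + 1) in
  let B2 := B1 + (2 * nQ + 2) + (m * (2 + cbody) + 1) in
  let B3 := 3 * nQ + 1 + (2 + ((n + B2).+1 * (3 * nG + 6) + 1
       + (7 * (n + B2) + 1))) in
  B2 + B3 + nK * (6 * (n + B2 + B3) + 2).

Lemma run_simulate x y m : tm_computes_within M m x y ->
  run simulate (ls [:: x]) (csim (size x) m) (ls [:: y]).
Proof.
case=> Hh Ho; set c1 := iter _ _ _ in Hh Ho.
have R1 := run_load x.
set rf0 := fupd _ _ _ in R1.
have H0 : tmrel (tm_init M x) nolist rf0.
  by move=> i; rewrite /rf0 /fupd /=; case: eqP.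
have [lf1 [rf1 [H1 R2]]] := run_loop H0 Hh; rewrite -/c1 in H1 R2.
have R12 : run (Seq load (Seq (Seq (pushw 1 (cod (tm_start M)))
    (pushw 2 (flag (tm_start M)))) (While 2 body))) (ls [:: x])
  (7 * size x + 1 + (size x * (2 * nG + 5) + 1) + (2 * nQ + 2 +
    (m * (2 + cbody) + 1))) (mk [::] (cod (cfg_state c1)) [::] lf1 rf1).
  apply: run_seq R1 _; apply: run_seq R2; apply: run_seq.
    by rewrite -(size_codQ (tm_start M)); apply: run_pushw.
  rewrite upd_mk1 /= cats0; have := run_pushw 2 (flag (tm_start M)).
  move/(_ (mk [::] (cod (tm_start M)) [::] nolist rf0)).
  by rewrite upd_mk2 /= cats0; apply: run_le; rewrite /flag; case: ifP.
rewrite addnA in R12.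
set B1 := (X in run _ _ X _) in R12.
have [rf2 R3] := run_unload (cod (cfg_state c1)) lf1 rf1.
have Sr : size (rf1 ord0) <= size x + B1.
  have := run_size (rR ord0) R12; rewrite mk_R size_fl => H.
  have : size (rf1 ord0) <= nG * size (rf1 ord0).
    exact: leq_pmull nG_gt0.
  by move/leq_trans; apply; apply: leq_trans H _; rewrite leq_add2r.
rewrite size_codQ in R3.
have {R3} : run unload (mk [::] (cod (cfg_state c1)) [::] lf1 rf1)
   (3 * nQ + 1 + (2 + ((size x + B1).+1 * (3 * nG + 6) + 1
       + (7 * (size x + B1) + 1)))) (mk (bit_prefix (rf1 ord0)) [::] [::] lf1 rf2).
  apply: run_le R3; rewrite !leq_add2l; apply: leq_add; last by lia.
  by rewrite leq_add2r leq_mul2r; apply/orP; right; lia.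
set B2 := (X in run _ _ X _) => R3.
have E : bit_prefix (rf1 ord0) = y.
  have [_ E1 E2] := H1 ord0; rewrite -Ho /tm_output -E1 -E2.
  by case: (rf1 ord0).
rewrite E in R3.
have RA := run_seq R12 R3.
have SA r : size (mk y [::] [::] lf1 rf2 r) <= size x + (B1 + B2).
  apply: leq_trans (run_size r RA) _; rewrite leq_add2r /ls.
  by case: r => [|r] //=; rewrite nth_nil.
have R4 : run (clrall (enum 'I_K1)) (mk y [::] [::] lf1 rf2)
   (nK * (6 * (size x + (B1 + B2)) + 2)) (ls [:: y]).
  rewrite -mk_ls.
  have := @run_clrall (enum 'I_K1) y [::] [::] lf1 rf2 (size x + (B1 + B2)).
  set st1 := mk _ _ _ _ _; set st2 := mk _ _ _ _ _; set st3 := mk _ _ _ _ _.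
  have -> : st2 = st3.
    by congr mk; apply: functional_extensionality => j; rewrite mem_enum.
  by apply=> i; [have := SA (rL i) | have := SA (rR i)]; rewrite ?mk_L ?mk_R.
rewrite addnA in R4; exact: run_le (leqnn _) (run_seq RA R4).
Qed.

End Simulation.

Lemma pol_S f : pol f -> pol (fun n => (f n).+1).
Proof.
move=> Hf; rewrite (_ : (fun n => _) = fun n => f n + 1).
  exact: pol_add Hf (pol_cst 1).
by apply: functional_extensionality => n; rewrite addn1.
Qed.

Ltac solve_pol :=
  repeat first [ exact: pol_id | exact: pol_cst | assumption
               | apply: pol_add | apply: pol_mul | apply: pol_S
               | apply: pol_horner ].

Lemma pol_csim M f : pol f -> pol (fun n => csim M n (f n)).
Proof. by move=> Hf; rewrite /csim; solve_pol. Qed.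

(** Relations instead of functions on strings: a function on encoded data leaves the program
    unconstrained on strings that encode nothing. *)
Definition PTR (R : string -> string -> Prop) : Prop := exists c P,
  pol P /\ forall x y, R x y -> run c (ls [:: x]) (P (size x)) (ls [:: y]).

Definition graph_of A B (eA : A -> string) (eB : B -> string) (f : A -> B) x y :=
  exists2 a, x = eA a & y = eB (f a).

Definition PT A B (eA : A -> string) (eB : B -> string) (f : A -> B) : Prop :=
  PTR (graph_of eA eB f).

Lemma polytimeP A B (eA : A -> string) (eB : B -> string) (f : A -> B) :
  polytime eA eB f <-> PT eA eB f.
Proof.
split=> [[M [p HM]]|[c [P [HP Hc]]]].
  exists (simulate M), (fun n => csim M n (p.[n])%R); split.
    by apply: pol_csim; exact: pol_horner.
  by move=> _ _ [a -> ->]; exact: run_simulate (HM a).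
have [p Hp] := pol_poly HP; have [M HM] := exec_tm c; exists M, p => a.
have [n le_n Hn] : run c (ls [:: eA a]) (P (size (eA a))) (ls [:: eB (f a)]).
  by apply: Hc; exists a.
by apply: HM Hn _ _; rewrite -Hp.
Qed.

(** * Closure properties of polynomial-time relations and functions *)

Lemma PTR_sub (R R' : string -> string -> Prop) :
  (forall x y, R x y -> R' x y) -> PTR R' -> PTR R.
Proof.
by move=> H [c [P [HP Hc]]]; exists c, P; split=> // x y /H; exact: Hc.
Qed.

Lemma run_size0 c x B y : run c (ls [:: x]) B (ls [:: y]) -> size y <= size x + B.
Proof. exact: (@run_size _ _ _ _ 0). Qed.

Lemma PTR_comp (R1 R2 : string -> string -> Prop) : PTR R1 -> PTR R2 ->
  PTR (fun x z => exists2 y, R1 x y & R2 y z).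
Proof.
move=> [c1 [P1 [HP1 H1]]] [c2 [P2 [HP2 H2]]].
exists (Seq c1 c2), (fun n => P1 n + P2 (n + P1 n)); split.
  apply: pol_add => //; apply: (pol_comp HP2); solve_pol.
move=> x z [y /H1 r1 /H2 r2]; apply: (run_seq r1); apply: run_le r2.
by apply: (pol_mono HP2); exact: run_size0 r1.
Qed.

Fixpoint shift d c : cmd :=
  match c with
  | Skip => Skip
  | Push r b => Push (d + r) b
  | Pop r => Pop (d + r)
  | Seq c1 c2 => Seq (shift d c1) (shift d c2)
  | Case r c0 cf ct => Case (d + r) (shift d c0) (shift d cf) (shift d ct)
  | While r c => While (d + r) (shift d c)
  end.

Definition glue d (S st : store) : store := fun i => if i < d then S i else st (i - d).

Lemma glueD d S st r : glue d S st (d + r) = st r.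
Proof. by rewrite /glue ltnNge leq_addr addKn. Qed.

Lemma upd_glue d S st r v : upd (glue d S st) (d + r) v = glue d S (upd st r v).
Proof.
apply: functional_extensionality => i; rewrite /upd /glue.
case: (ltnP i d) => Hi; first by rewrite ifN //; apply/eqP; lia.
by rewrite (_ : (i == d + r) = (i - d == r)) //; apply/eqP/eqP; lia.
Qed.

(** Subroutine calls: the registers below [d] keep saved data while the program runs on the
    others. *)
Lemma exec_shift d S c st n st' : exec c st n st' ->
  exec (shift d c) (glue d S st) n (glue d S st').
Proof.
elim=> {c st n st'} /=.
- by move=> st; exact: exec_skip.
- by move=> r b st; rewrite -upd_glue -(glueD d S st r); exact: exec_push.
- by move=> r st; rewrite -upd_glue -(glueD d S st r); exact: exec_pop.
- by move=> c1 c2 st n1 st1 n2 st2 _ H1 _ H2; exact: exec_seq H1 H2.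
- move=> r c0 cf ct st n st' _ IH; apply: exec_case; rewrite glueD.
  by case: (st r) IH => [|[]].
- by move=> r c st E; apply: exec_while0; rewrite glueD.
- move=> r c st n1 st1 n2 st2 E _ H1 _ H2.
  by apply: exec_whileS H1 H2; rewrite glueD.
Qed.

Lemma run_call l c x B y : run c (ls [:: x]) B (ls [:: y]) ->
  run (shift (size l) c) (ls (l ++ [:: x])) B (ls (l ++ [:: y])).
Proof.
have E z : ls (l ++ [:: z]) = glue (size l) (ls l) (ls [:: z]).
  by apply: functional_extensionality => i; rewrite /glue /ls nth_cat.
by move=> [n le_n H]; rewrite !E; exists n => //; exact: exec_shift.
Qed.

Definition cdelim := While 0 (Case 0 Skip
  (Seq (Pop 0) (Seq (Push 3 false) (Push 3 true)))
  (Seq (Pop 0) (Seq (Push 3 true) (Push 3 true)))).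

Lemma run_cdelim s w : run cdelim (ls [:: rev s; [::]; [::]; w]) (9 * size s + 1)
  (ls [:: [::]; [::]; [::]; flatten [seq [:: true; b] | b <- s] ++ w]).
Proof.
elim/last_ind: s w => [|s b IHs] w; first exact: run_while0.
rewrite rev_rcons size_rcons map_rcons flatten_rcons -catA.
apply: (@run_le _ _ (2 + 7 + (9 * size s + 1))); first by lia.
apply: run_whileS (IHs _) => //.
apply: run_case; rewrite (_ : branch _ _ _ _ =
  Seq (Pop 0) (Seq (Push 3 b) (Push 3 true))); last by case: (b).
apply: (@run_seq _ _ _ 1 _ 4); first exact: run_pop.
rewrite upd_ls /=; apply: (@run_seq _ _ _ 2 _ 2); first exact: run_push.
by rewrite upd_ls /=; have := run_push 3 true (ls [:: rev s; [::]; [::]; b :: w]);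
  rewrite upd_ls.
Qed.

(** The input is duplicated before the first call. The first output waits reversed in register 0, so
    that [cdelim] can prepend its bits, the last one first, to the second output. *)
Definition cpair c1 c2 :=
  Seq (mv 0 1) (Seq (dup 1 2 3) (Seq (shift 3 c1) (Seq (mv 3 0) (Seq (mv 2 1)
  (Seq (mv 1 3) (Seq (shift 3 c2) (Seq (Push 3 false) (Seq cdelim
  (Seq (mv 3 1) (mv 1 0)))))))))).

Lemma run_mv_ls a b l : a != b ->
  run (mv a b) (ls l) (7 * size (nth [::] l a) + 1)
   (ls (set_nth [::] (set_nth [::] l a [::]) b
        (catrev (nth [::] l a) (nth [::] l b)))).
Proof. by move=> Nab; have := run_mv (ls l) Nab; rewrite !upd_ls. Qed.

Lemma run_dup_ls a b c l : uniq [:: a; b; c] ->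
  run (dup a b c) (ls l) (9 * size (nth [::] l a) + 1)
   (ls (set_nth [::] (set_nth [::] (set_nth [::] l a [::]) b
        (catrev (nth [::] l a) (nth [::] l b))) c
        (catrev (nth [::] l a) (nth [::] l c)))).
Proof. by move=> U; have := run_dup (ls l) U; rewrite !upd_ls. Qed.

Lemma size_delimit x : size (delimit x) = 2 * size x + 1.
Proof. by rewrite /delimit size_cat /=; elim: x => //= b x; lia. Qed.

Lemma size_spair x y : size (spair x y) = 2 * size x + 1 + size y.
Proof. by rewrite size_cat size_delimit. Qed.

Lemma PTR_pair (R1 R2 : string -> string -> Prop) : PTR R1 -> PTR R2 ->
  PTR (fun x z => exists y1 y2, [/\ R1 x y1, R2 x y2 & z = spair y1 y2]).
Proof.
move=> [c1 [P1 [HP1 H1]]] [c2 [P2 [HP2 H2]]].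
exists (cpair c1 c2), (fun n => (7 * n + 1) + ((9 * n + 1) + (P1 n +
  ((7 * (n + P1 n) + 1) + ((7 * n + 1) + ((7 * n + 1) + (P2 n + (2 +
  ((9 * (n + P1 n) + 1) + ((7 * (2 * (n + P1 n) + 1 + (n + P2 n)) + 1) +
   (7 * (2 * (n + P1 n) + 1 + (n + P2 n)) + 1))))))))))); split.
  by solve_pol.
move=> x z [y1 [y2 [/H1 r1 /H2 r2 ->]]].
have s1 := run_size0 r1; have s2 := run_size0 r2.
apply: run_seq; first exact: run_mv_ls.
rewrite /= -/(rev x); apply: run_seq.
  by apply: run_le (@run_dup_ls 1 2 3 _ _) => //=; rewrite size_rev.
rewrite /= -/(rev (rev x)) revK; apply: run_seq.
  exact: (run_call [:: [::]; [::]; x] r1).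
apply: run_seq.
  by apply: run_le (@run_mv_ls 3 0 _ _) => //=; lia.
rewrite /= -/(rev y1); apply: run_seq; first exact: (@run_mv_ls 2 1).
rewrite /= -/(rev x); apply: run_seq.
  by apply: run_le (@run_mv_ls 1 3 _ _) => //=; rewrite size_rev.
rewrite /= -/(rev (rev x)) revK; apply: run_seq.
  exact: (run_call [:: rev y1; [::]; [::]] r2).
apply: run_seq; first exact: run_push.
rewrite upd_ls /=; apply: run_seq.
  by apply: run_le (run_cdelim _ _); lia.
have Ez : flatten [seq [:: true; b] | b <- y1] ++ false :: y2 = spair y1 y2.
  by rewrite /spair /delimit -catA.
rewrite Ez; have sz := size_spair y1 y2; apply: run_seq.
  by apply: run_le (@run_mv_ls 3 1 _ _) => //=; lia.
rewrite /= -/(rev _); set w := spair y1 y2 in sz *.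
have := @run_mv_ls 1 0 [:: [::]; rev w; [::]; [::]] isT.
rewrite /= -/(rev (rev w)) revK (ls_trail [:: w] 3) size_rev.
by apply: run_le; lia.
Qed.

(* The inverse of [spair], with junk values on other strings. *)
Fixpoint und (x : string) : string * string :=
  match x with
  | true :: b :: x' => (b :: (und x').1, (und x').2)
  | false :: x' => ([::], x')
  | _ => ([::], [::])
  end.

Lemma und_spair u w : und (spair u w) = (u, w).
Proof.
rewrite /spair /delimit -catA; elim: u => //= b u.
by case: (und _) => u' w' [-> ->].
Qed.

Lemma size_und x : size (und x).1 + size (und x).2 <= size x.
Proof.
have [n le_n] := ubnP (size x); elim: n x le_n => // n IHn [|[] [|b x]] //= le_n.
by have := IHn x; lia.
Qed.

Definition csplit := Seq (Push 1 true) (While 1 (Case 0 (Pop 1) (Seq (Pop 0) (Pop 1))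
  (Seq (Pop 0) (Case 0 (Pop 1) (Seq (Pop 0) (Push 2 false))
                               (Seq (Pop 0) (Push 2 true)))))).

Lemma run_csplit x : run csplit (ls [:: x]) (12 * size x + 12)
  (ls [:: (und x).2; [::]; rev (und x).1]).
Proof.
apply: (@run_le _ _ (2 + (10 * size x + 10))); first by lia.
apply: run_seq; first exact: run_push.
rewrite upd_ls /=.
rewrite -(ls_trail [:: x; [:: true]] 1) /= /rev.
suff H acc : run (While 1 (Case 0 (Pop 1) (Seq (Pop 0) (Pop 1))
  (Seq (Pop 0) (Case 0 (Pop 1) (Seq (Pop 0) (Push 2 false))
                               (Seq (Pop 0) (Push 2 true))))))
  (ls [:: x; [:: true]; acc]) (10 * size x + 10)
  (ls [:: (und x).2; [::]; catrev (und x).1 acc]) by exact: H.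
have [n le_n] := ubnP (size x); elim: n x acc le_n => // n IHn.
have P1' l : run (Pop 1) (ls l) 1 (ls (set_nth [::] l 1 (behead (nth [::] l 1)))).
  by have := run_pop 1 (ls l); rewrite upd_ls.
have P0' l : run (Pop 0) (ls l) 1 (ls (set_nth [::] l 0 (behead (nth [::] l 0)))).
  by have := run_pop 0 (ls l); rewrite upd_ls.
move=> [|[] x] acc /= le_n.
- apply: (@run_le _ _ (2 + 3 + 1)); first by lia.
  apply: run_whileS; [done| |exact: run_while0].
  by apply: run_case => /=; have := P1' [:: [::]; [:: true]; acc].
- case: x le_n => [|b x] le_n /=.
    apply: (@run_le _ _ (2 + 6 + 1)); first by lia.
    apply: run_whileS; [done| |exact: run_while0].
    apply: run_case => /=; apply: (@run_seq _ _ _ 1 _ 3); first exact: P0'.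
    by apply: run_case => /=; have := P1' [:: [::]; [:: true]; acc].
  apply: (@run_le _ _ (2 + 8 + (10 * size x + 10))); first by lia.
  have lt_x : size x < n by move: le_n => /=; lia.
  apply: run_whileS (IHn x (b :: acc) lt_x) => //.
  apply: run_case => /=; apply: (@run_seq _ _ _ 1 _ 5); first exact: P0'.
  apply: run_case; rewrite (_ : branch _ _ _ _ = Seq (Pop 0) (Push 2 b));
    last by case: (b).
  apply: (@run_seq _ _ _ 1 _ 2); first exact: P0'.
  by have := run_push 2 b (ls [:: x; [:: true]; acc]); rewrite upd_ls.
- apply: (@run_le _ _ (2 + 4 + 1)); first by lia.
  apply: run_whileS; [done| |exact: run_while0].
  apply: run_case => /=; apply: (@run_seq _ _ _ 1 _ 1); first exact: P0'.
  by have := P1' [:: x; [:: true]; acc].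
Qed.

Lemma run_clr_ls a l : run (clr a) (ls l) (3 * size (nth [::] l a) + 1)
  (ls (set_nth [::] l a [::])).
Proof. by have := run_clr a (ls l); rewrite upd_ls. Qed.

Lemma PTR_fst : PTR (fun x y => y = (und x).1).
Proof.
exists (Seq csplit (Seq (clr 0) (mv 2 0))),
  (fun n => (12 * n + 12) + ((3 * n + 1) + (7 * n + 1))); split; first by solve_pol.
move=> x _ ->; have sx := size_und x; apply: run_seq (run_csplit x) _.
apply: run_seq.
  by apply: run_le (run_clr_ls 0 _) => /=; lia.
rewrite /= -(ls_trail [:: (und x).1] 2) -{2}(revK (und x).1).
by apply: run_le (@run_mv_ls 2 0 _ _) => //=; rewrite size_rev; lia.
Qed.

Lemma PTR_snd : PTR (fun x y => y = (und x).2).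
Proof.
exists (Seq csplit (clr 2)), (fun n => (12 * n + 12) + (3 * n + 1)); split.
  by solve_pol.
move=> x _ ->; have sx := size_und x; apply: run_seq (run_csplit x) _.
rewrite -(ls_trail [:: (und x).2] 2).
by apply: run_le (run_clr_ls 2 _) => /=; rewrite size_rev; lia.
Qed.

Lemma PTR_cat : PTR (fun x y => y = (und x).1 ++ (und x).2).
Proof.
exists (Seq csplit (mv 2 0)), (fun n => (12 * n + 12) + (7 * n + 1)); split.
  by solve_pol.
move=> x _ ->; have sx := size_und x; apply: run_seq (run_csplit x) _.
rewrite -(ls_trail [:: _ ++ _] 2) -{2}(revK (und x).1) /rev -catrev_catr /=.
by apply: run_le (@run_mv_ls 2 0 _ _) => //=; rewrite size_rev; lia.
Qed.

(** The bits [true, b, false] are [delimit [:: b]]: the relation branches on the first component of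
    a pair. *)
Lemma PTR_if (R1 R2 : string -> string -> Prop) : PTR R1 -> PTR R2 ->
  PTR (fun x y => exists b z, x = [:: true, b, false & z] /\ if b then R1 z y else R2 z y).
Proof.
move=> [c1 [P1 [HP1 H1]]] [c2 [P2 [HP2 H2]]].
exists (Seq (Pop 0) (Case 0 Skip (Seq (Pop 0) (Seq (Pop 0) c2))
                                 (Seq (Pop 0) (Seq (Pop 0) c1)))),
  (fun n => P1 n + P2 n + 5); split; first by solve_pol.
move=> _ y [b [z [-> H]]] /=.
have P0' l : run (Pop 0) (ls l) 1 (ls (set_nth [::] l 0 (behead (nth [::] l 0)))).
  by have := run_pop 0 (ls l); rewrite upd_ls.
have M1 := pol_mono HP1 (leq_addr 3 (size z)).
have M2 := pol_mono HP2 (leq_addr 3 (size z)); rewrite !addn3 in M1 M2.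
case: b H => H.
- apply: (@run_le _ _ (1 + (1 + (1 + P1 (size z))).+2)); first by lia.
  apply: run_seq; first exact: P0'.
  apply: run_case => /=; apply: run_seq; first exact: P0'.
  by apply: run_seq; [exact: P0' | exact: H1].
- apply: (@run_le _ _ (1 + (1 + (1 + P2 (size z))).+2)); first by lia.
  apply: run_seq; first exact: P0'.
  apply: run_case => /=; apply: run_seq; first exact: P0'.
  by apply: run_seq; [exact: P0' | exact: H2].
Qed.

Lemma PTR_id : PTR (fun x y => y = x).
Proof.
by exists Skip, (fun=> 0); split; [exact: pol_cst | move=> x _ ->; exact: run_skip].
Qed.

Lemma PTR_const w : PTR (fun _ y => y = w).
Proof.
exists (Seq (clr 0) (pushw 0 w)), (fun n => 3 * n + 1 + 2 * size w); split.
  by solve_pol.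
move=> x _ ->; apply: run_seq (run_clr_ls 0 _) _ => /=.
by have := run_pushw 0 w (ls [:: [::]]); rewrite upd_ls /= cats0.
Qed.

Lemma PTR_push b : PTR (fun x y => y = b :: x).
Proof.
exists (Push 0 b), (fun=> 2); split; first exact: pol_cst.
by move=> x _ ->; have := run_push 0 b (ls [:: x]); rewrite upd_ls.
Qed.

Lemma PTR_behead : PTR (fun x y => y = behead x).
Proof.
exists (Pop 0), (fun=> 1); split; first exact: pol_cst.
by move=> x _ ->; have := run_pop 0 (ls [:: x]); rewrite upd_ls.
Qed.

Lemma PTR_nilp : PTR (fun x y => y = [:: nilp x]).
Proof.
exists (Case 0 (Push 0 true) (Seq (clr 0) (Push 0 false)) (Seq (clr 0) (Push 0 false))),
  (fun n => (3 * n + 1 + 2).+2); split; first by solve_pol.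
move=> x _ ->; apply: run_case.
have P l b : run (Push 0 b) (ls l) 2 (ls (set_nth [::] l 0 (b :: nth [::] l 0))).
  by have := run_push 0 b (ls l); rewrite upd_ls.
case: x => [|b x]; first by apply: run_le (P [:: [::]] true).
rewrite (_ : branch _ _ _ _ = Seq (clr 0) (Push 0 false)); last by case: (b).
by apply: run_seq; [exact: (run_clr_ls 0 [:: b :: x]) | exact: P].
Qed.

Lemma PTR_head : PTR (fun x y => y = [:: head false x]).
Proof.
exists (Case 0 (Push 0 false) (Seq (clr 0) (Push 0 false)) (Seq (clr 0) (Push 0 true))),
  (fun n => (3 * n + 1 + 2).+2); split; first by solve_pol.
move=> x _ ->; apply: run_case.
have P l b : run (Push 0 b) (ls l) 2 (ls (set_nth [::] l 0 (b :: nth [::] l 0))).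
  by have := run_push 0 b (ls l); rewrite upd_ls.
case: x => [|b x]; first by apply: run_le (P [:: [::]] false).
rewrite (_ : branch _ _ _ _ = Seq (clr 0) (Push 0 b)); last by case: (b).
by apply: run_seq; [exact: (run_clr_ls 0 [:: b :: x]) | exact: P].
Qed.

Lemma PTR_size : PTR (fun x y => y = nseq (size x) true).
Proof.
exists (Seq (While 0 (Seq (Pop 0) (Push 1 true))) (mv 1 0)),
  (fun n => (5 * n + 1) + (7 * n + 1)); split; first by solve_pol.
move=> x _ ->; apply: (@run_seq _ _ _ _ (ls [:: [::]; nseq (size x) true])); last first.
  have := @run_mv_ls 1 0 [:: [::]; nseq (size x) true] isT.
  rewrite /= -/(rev _) size_nseq (_ : rev _ = nseq (size x) true); last first.
    by apply: (@eq_from_nth _ true) => [|i _];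
      rewrite ?size_rev // rev_nseq.
  by rewrite (ls_trail [:: _] 1).
rewrite -[X in run _ X](ls_trail [:: x] 1) /=.
suff H acc : run (While 0 (Seq (Pop 0) (Push 1 true))) (ls [:: x; acc])
  (5 * size x + 1) (ls [:: [::]; nseq (size x) true ++ acc]).
  by have := H [::]; rewrite cats0.
elim: x acc => [|b x IHx] acc; first exact: run_while0.
apply: (@run_le _ _ (2 + 3 + (5 * size x + 1))) => /=; first by lia.
have := IHx (true :: acc).
have -> : nseq (size x) true ++ true :: acc = true :: nseq (size x) true ++ acc.
  by elim: (size x) => //= n ->.
apply: run_whileS => //; apply: (@run_seq _ _ _ 1 _ 2); first exact: run_pop.
by rewrite upd_ls /=; have := run_push 1 true (ls [:: x; acc]); rewrite upd_ls.
Qed.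

Definition citer c := Seq csplit (Seq (mv 0 1) (Seq (mv 1 3)
  (Seq (While 2 (Seq (Pop 2) (shift 3 c))) (Seq (mv 3 1) (mv 1 0))))).

Definition enc_raw (s : string) : string := s.
Definition enc_bool (b : bool) : string := [:: b].
(** Working data keep numbers in unary, which turns arithmetic on polynomially bounded numbers into
    list processing. Binary numerals appear only in the finished instance. *)
Definition enc_nat (n : nat) : string := nseq n true.
Definition enc_fin (T : finType) (t : T) : string := enc_nat (enum_rank t).
Definition enc_prod A B (eA : A -> string) (eB : B -> string) (ab : A * B) :=
  spair (eA ab.1) (eB ab.2).
Definition enc_seq A (eA : A -> string) (l : seq A) : string :=
  flatten [seq delimit (eA a) | a <- l].

Notation "eA ** eB" := (enc_prod eA eB) (at level 40, left associativity).

Lemma pt_iter A (eA : A -> string) (f : A -> A) B : PT eA eA f -> pol B ->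
  (forall n a i, i <= n -> size (eA (iter i f a)) <= B (n + size (eA a))) ->
  PT (enc_nat ** eA) eA (fun na => iter na.1 f na.2).
Proof.
move=> [c [P [HP Hc]]] HB bnd.
exists (citer c), (fun n => (12 * n + 12) + ((7 * n + 1) + ((7 * n + 1) +
  ((n * (3 + P (B n)) + 1) + ((7 * B n + 1) + (7 * B n + 1)))))); split.
  have HPB := pol_comp HP HB; solve_pol.
move=> _ _ [[n a] -> ->] /=; set x := enc_prod _ _ _.
have Ex : und x = (enc_nat n, eA a) by exact: und_spair.
have Sx : size x = 2 * n + 1 + size (eA a) by rewrite /x /enc_prod size_spair size_nseq.
apply: run_seq (run_csplit x) _; rewrite Ex /=.
have -> : rev (enc_nat n) = nseq n true by rewrite rev_nseq.
apply: run_seq.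
  by apply: run_le (@run_mv_ls 0 1 _ _) => //=; lia.
rewrite /= -/(rev _); apply: run_seq.
  by apply: run_le (@run_mv_ls 1 3 _ _) => //=; rewrite size_rev; lia.
rewrite /= -/(rev (rev _)) revK.
have MB i : i <= n -> size (eA (iter i f a)) <= B (size x).
  by move=> le_i; apply: leq_trans (bnd n a i le_i) (pol_mono HB _); lia.
apply: (@run_seq _ _ _ _ (ls [:: [::]; [::]; [::]; eA (iter n f a)])).
  apply: (@run_le _ _ (n * (3 + P (B (size x))) + 1)).
    by rewrite leq_add2r leq_mul2r; apply/orP; right; lia.
  have {MB} : forall i, i <= n -> size (eA (iter i f a)) <= B (size x) by [].
  move: (B _) => m {bnd Ex Sx}; elim: n a {x} => [|n IHn] a MB.
    exact: run_while0.
  rewrite mulSn -addnA (_ : 3 + P m = 2 + (1 + P m)); last by lia.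
  apply: run_whileS => //.
    apply: run_seq; first exact: run_pop.
    rewrite upd_ls /=; apply: (run_call [:: [::]; [::]; nseq n true]).
    apply: run_le (Hc _ (eA (f a)) _); last by exists a.
    by apply: (pol_mono HP); exact: (MB 0).
  rewrite (_ : 2 + (1 + P m) = 3 + P m); last by lia.
  rewrite iterSr.
  by apply: IHn => i le_i; rewrite -iterSr; exact: MB.
apply: run_seq.
  by apply: run_le (@run_mv_ls 3 1 _ _) => //=; have := MB n (leqnn _); lia.
rewrite /= -/(rev _); set y := eA _.
have := @run_mv_ls 1 0 [:: [::]; rev y; [::]; [::]] isT.
rewrite /= -/(rev (rev y)) revK (ls_trail [:: y] 3) size_rev.
by apply: run_le; have := MB n (leqnn _); rewrite -/y; lia.
Qed.

(** * Polynomial-time functions on encoded data *)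

Section Closure.
Variables (E A B C : Type).
Variables (eE : E -> string) (eA : A -> string) (eB : B -> string) (eC : C -> string).

Lemma pt_ext (f g : A -> B) : (forall a, f a = g a) -> PT eA eB f -> PT eA eB g.
Proof. by move=> H; apply: PTR_sub => x y [a -> ->]; exists a; rewrite ?H. Qed.

Lemma pt_comp (f : A -> B) (g : B -> C) :
  PT eB eC g -> PT eA eB f -> PT eA eC (fun a => g (f a)).
Proof.
move=> Hg Hf; apply: PTR_sub (PTR_comp Hf Hg) => x y [a -> ->].
by exists (eB (f a)); [exists a | exists (f a)].
Qed.

Lemma pt_id : PT eA eA (fun a => a).
Proof. by apply: PTR_sub PTR_id => x y [a -> ->]. Qed.

Lemma pt_const (b : B) : PT eA eB (fun=> b).
Proof. by apply: PTR_sub (PTR_const (eB b)) => x y [a _ ->]. Qed.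

Lemma pt_pair (f : E -> A) (g : E -> B) :
  PT eE eA f -> PT eE eB g -> PT eE (eA ** eB) (fun e => (f e, g e)).
Proof.
move=> Hf Hg; apply: PTR_sub (PTR_pair Hf Hg) => x y [e -> ->].
by exists (eA (f e)), (eB (g e)); split=> //; exists e.
Qed.

Lemma pt_fst (f : E -> A * B) : PT eE (eA ** eB) f -> PT eE eA (fun e => (f e).1).
Proof.
move=> Hf; apply: PTR_sub (PTR_comp Hf PTR_fst) => x y [e -> ->].
by exists ((eA ** eB) (f e)); [exists e | rewrite /enc_prod und_spair].
Qed.

Lemma pt_snd (f : E -> A * B) : PT eE (eA ** eB) f -> PT eE eB (fun e => (f e).2).
Proof.
move=> Hf; apply: PTR_sub (PTR_comp Hf PTR_snd) => x y [e -> ->].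
by exists ((eA ** eB) (f e)); [exists e | rewrite /enc_prod und_spair].
Qed.

(** The two sides are convertible; this lets an encoding be assembled with operations on strings. *)
Lemma pt_rawE (f : E -> A) : PT eE enc_raw (fun e => eA (f e)) -> PT eE eA f.
Proof. by []. Qed.

Lemma pt_if (c : E -> bool) (f g : E -> B) :
  PT eE enc_bool c -> PT eE eB f -> PT eE eB g ->
  PT eE eB (fun e => if c e then f e else g e).
Proof.
move=> Hc Hf Hg; apply: PTR_sub (PTR_comp (PTR_pair Hc PTR_id) (PTR_if Hf Hg)).
move=> x y [e -> ->]; exists (spair [:: c e] (eE e)).
  by exists [:: c e], (eE e); split=> //; exists e.
exists (c e), (eE e); split=> //; case: (c e); by exists e.
Qed.

Lemma pt_bound (f : A -> B) : PT eA eB f ->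
  exists2 P, pol P & forall a, size (eB (f a)) <= P (size (eA a)).
Proof.
move=> [c [P [HP Hc]]]; exists (fun n => n + P n); first by solve_pol.
by move=> a; apply: (@run_size0 c); apply: Hc; exists a.
Qed.

(** A nonempty list is encoded as the pair of its head and its tail, so the code of [(e, l e)] is
    already the argument of the second branch. *)
Lemma pt_match (l : E -> seq A) (n : E -> B) (c : E -> A -> seq A -> B) :
  PT eE (enc_seq eA) l -> PT eE eB n ->
  PT (eE ** (eA ** enc_seq eA)) eB (fun t => c t.1 t.2.1 t.2.2) ->
  PT eE eB (fun e => match l e with [::] => n e | a :: s => c e a s end).
Proof.
move=> Hl Hn Hc.
have Hnil := PTR_comp Hl PTR_nilp.
apply: PTR_sub (PTR_comp (PTR_pair Hnil (PTR_pair PTR_id Hl))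
  (PTR_if (PTR_comp PTR_fst Hn) Hc)) => x y [e -> ->].
exists (spair [:: nilp (enc_seq eA (l e))] (spair (eE e) (enc_seq eA (l e)))).
  exists [:: nilp (enc_seq eA (l e))], (spair (eE e) (enc_seq eA (l e))); split=> //.
    by exists (enc_seq eA (l e)) => //; exists e.
  by exists (eE e), (enc_seq eA (l e)); split=> //; exists e.
exists (nilp (enc_seq eA (l e))), (spair (eE e) (enc_seq eA (l e))); split=> //.
case: (l e) => [|a s].
  by exists (eE e); [rewrite und_spair | exists e].
have -> : nilp (enc_seq eA (a :: s)) = false.
  by rewrite /nilp /enc_seq /= size_cat size_delimit addn1.
by exists (e, (a, s)).
Qed.

Lemma pt_cons (f : E -> A) (s : E -> seq A) :
  PT eE eA f -> PT eE (enc_seq eA) s -> PT eE (enc_seq eA) (fun e => f e :: s e).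
Proof.
move=> Hf Hs; apply: PTR_sub (PTR_pair Hf Hs) => x y [e -> ->].
by exists (eA (f e)), (enc_seq eA (s e)); split=> //; exists e.
Qed.

Lemma pt_rcat (f g : E -> string) : PT eE enc_raw f -> PT eE enc_raw g ->
  PT eE enc_raw (fun e => f e ++ g e).
Proof.
move=> Hf Hg; apply: PTR_sub (PTR_comp (PTR_pair Hf Hg) PTR_cat) => x y [e -> ->].
exists (spair (f e) (g e)); last by rewrite und_spair.
by exists (f e), (g e); split=> //; exists e.
Qed.

Lemma pt_delimit (f : E -> string) : PT eE enc_raw f ->
  PT eE enc_raw (fun e => delimit (f e)).
Proof.
move=> Hf; apply: PTR_sub (PTR_pair Hf (PTR_const [::])) => x y [e -> ->].
by exists (f e), [::]; split; [exists e | | rewrite /spair cats0].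
Qed.

Lemma pt_rpush b (f : E -> string) : PT eE enc_raw f -> PT eE enc_raw (fun e => b :: f e).
Proof.
move=> Hf; apply: PTR_sub (PTR_comp Hf (PTR_push b)) => x y [e -> ->].
by exists (f e) => //; exists e.
Qed.

Lemma pt_behead (f : E -> string) : PT eE enc_raw f -> PT eE enc_raw (fun e => behead (f e)).
Proof.
move=> Hf; apply: PTR_sub (PTR_comp Hf PTR_behead) => x y [e -> ->].
by exists (f e) => //; exists e.
Qed.

Lemma pt_rhead (f : E -> string) : PT eE enc_raw f -> PT eE enc_bool (fun e => head false (f e)).
Proof.
move=> Hf; apply: PTR_sub (PTR_comp Hf PTR_head) => x y [e -> ->].
by exists (f e) => //; exists e.
Qed.

Lemma pt_rnilp (f : E -> string) : PT eE enc_raw f -> PT eE enc_bool (fun e => nilp (f e)).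
Proof.
move=> Hf; apply: PTR_sub (PTR_comp Hf PTR_nilp) => x y [e -> ->].
by exists (f e) => //; exists e.
Qed.

Lemma pt_rsize (f : E -> string) : PT eE enc_raw f -> PT eE enc_nat (fun e => size (f e)).
Proof.
move=> Hf; apply: PTR_sub (PTR_comp Hf PTR_size) => x y [e -> ->].
by exists (f e) => //; exists e.
Qed.

Lemma pt_und1 (f : E -> string) : PT eE enc_raw f -> PT eE enc_raw (fun e => (und (f e)).1).
Proof.
move=> Hf; apply: PTR_sub (PTR_comp Hf PTR_fst) => x y [e -> ->].
by exists (f e) => //; exists e.
Qed.

Lemma pt_und2 (f : E -> string) : PT eE enc_raw f -> PT eE enc_raw (fun e => (und (f e)).2).
Proof.
move=> Hf; apply: PTR_sub (PTR_comp Hf PTR_snd) => x y [e -> ->].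
by exists (f e) => //; exists e.
Qed.

End Closure.

Lemma enc_seq_cat A (eA : A -> string) s1 s2 :
  enc_seq eA (s1 ++ s2) = enc_seq eA s1 ++ enc_seq eA s2.
Proof. by rewrite /enc_seq map_cat flatten_cat. Qed.

Lemma size_enc_seq A (eA : A -> string) s : size s <= size (enc_seq eA s).
Proof. by rewrite /enc_seq; elim: s => //= a s; rewrite size_cat size_delimit; lia. Qed.

Lemma nilp_enc_seq A (eA : A -> string) s : nilp (enc_seq eA s) = nilp s.
Proof. by case: s => // a s; rewrite /nilp /enc_seq /= size_cat size_delimit addn1. Qed.

Section Flat.
Variables (E A B : Type).
Variables (eE : E -> string) (eA : A -> string) (eB : B -> string).

Lemma size_enc_mem (a : A) s1 s2 :
  size (eA a) <= size (enc_seq eA (s1 ++ a :: s2)).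
Proof. by rewrite enc_seq_cat size_cat [X in _ + size X]/enc_seq /= size_cat size_delimit; lia. Qed.

(** The loop behind most list operations: the state holds the parameter, the remaining list and the
    output so far. The number of rounds is the length of the encoded list, which is at least the
    number of elements; [step] fixes a state with an exhausted list, so surplus rounds are idle. *)
Lemma pt_flat (l : E -> seq A) (g : E -> A -> string) :
  PT eE (enc_seq eA) l -> PT (eE ** eA) enc_raw (fun t => g t.1 t.2) ->
  PT eE enc_raw (fun e => flatten [seq g e a | a <- l e]).
Proof.
move=> Hl Hg.
pose eS := (eE ** enc_seq eA) ** enc_raw.
pose step (s : (E * seq A) * string) :=
  match s.1.2 with
  | [::] => s
  | a :: xs => ((s.1.1, xs), s.2 ++ g s.1.1 a)
  end.
have Hstep : PT eS eS step.
  apply: pt_match.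
  - exact: pt_snd (pt_fst (pt_id _)).
  - exact: pt_id.
  - apply: pt_pair; first apply: pt_pair.
    + exact: pt_fst (pt_fst (pt_fst (pt_id _))).
    + exact: pt_snd (pt_snd (pt_id _)).
    + apply: pt_rcat; first exact: pt_snd (pt_fst (pt_id _)).
      apply: (pt_comp (f := fun t : E * seq A * string * (A * seq A) =>
         (t.1.1.1, t.2.1)) Hg).
      apply: pt_pair; first exact: pt_fst (pt_fst (pt_fst (pt_id _))).
      exact: pt_fst (pt_snd (pt_id _)).
have [Q HQ bndQ] := pt_bound Hg.
have stepE e xs out i : iter i step ((e, xs), out) =
    ((e, drop i xs), out ++ flatten [seq g e a | a <- take i xs]).
  elim: i => [|i IHi]; first by rewrite drop0 take0 cats0.
  rewrite iterS IHi /step /=.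
  have [le_i|lt_i] := leqP (size xs) i.
    by rewrite !drop_oversize ?take_oversize // ltnW.
  case: xs lt_i IHi => // x0 xs lt_i _.
  rewrite (drop_nth x0 lt_i) (take_nth x0 lt_i) map_rcons flatten_rcons catA.
  by [].
(* At most [n] pieces are appended, and each is the value of [g] at a pair whose encoding has length
   at most [2 * n + 1 + n]. *)
pose Bd n := n + n * Q (2 * n + 1 + n).
have HBd : pol Bd.
  by apply: pol_add; first exact: pol_id; apply: pol_mul; first exact: pol_id;
    apply: (pol_comp HQ); solve_pol.
have bnd n s i : i <= n -> size (eS (iter i step s)) <= Bd (n + size (eS s)).
  move=> le_i; case: s => [[e xs] out]; rewrite stepE.
  apply: leq_trans (pol_mono HBd (leq_addl n _)).
  rewrite /eS /enc_prod /= !size_spair /enc_raw size_cat.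
  set E1 := size (eE e); set X := size (enc_seq eA xs).
  have Xd : size (enc_seq eA (drop i xs)) <= X.
    by rewrite /X -{2}(cat_take_drop i xs) enc_seq_cat size_cat leq_addl.
  set m := 2 * (2 * E1 + 1 + X) + 1 + size out.
  suff : size (flatten [seq g e a | a <- take i xs]) <= m * Q (2 * m + 1 + m).
    by rewrite /Bd -/m; lia.
  apply: (@leq_trans (size (take i xs) * Q (2 * m + 1 + m))); last first.
    rewrite leq_mul2r; apply/orP; right; apply: leq_trans (_ : X <= m); last by lia.
    apply: leq_trans (size_enc_seq eA xs).
    by rewrite size_take_min geq_minr.
  have : forall s1 s2, take i xs = s1 ++ s2 ->
    size (flatten [seq g e a | a <- s1]) <= size s1 * Q (2 * m + 1 + m).
    elim/last_ind => [|s1 a IHs] s2 // Es.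
    rewrite map_rcons flatten_rcons size_cat size_rcons mulSn addnC leq_add //.
      apply: leq_trans (bndQ (e, a)) (pol_mono HQ _).
      rewrite /enc_prod size_spair /= -/E1.
      have : size (eA a) <= X.
        rewrite /X -(cat_take_drop i xs) Es -cats1 -!catA /=; exact: size_enc_mem.
      by lia.
    by apply: (IHs (a :: s2)); rewrite Es -cats1 -catA.
  by move/(_ (take i xs) [::]); apply; rewrite cats0.
have Hit := pt_iter Hstep HBd bnd.
have Hin : PT eE (enc_nat ** eS)
    (fun e => (size (enc_seq eA (l e)), ((e, l e), [::]))).
  apply: pt_pair; first by apply: pt_rsize; exact: Hl.
  apply: pt_pair; last exact: pt_const.
  by apply: pt_pair => //; exact: pt_id.
apply: pt_ext (pt_snd (pt_comp Hit Hin)) => e /=.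
by rewrite stepE /= take_oversize // size_enc_seq.
Qed.

Lemma pt_map (l : E -> seq A) (g : E -> A -> B) :
  PT eE (enc_seq eA) l -> PT (eE ** eA) eB (fun t => g t.1 t.2) ->
  PT eE (enc_seq eB) (fun e => [seq g e a | a <- l e]).
Proof.
move=> Hl Hg; apply: pt_rawE.
apply: pt_ext (@pt_flat l (fun e a => delimit (eB (g e a))) Hl _).
  by move=> e; rewrite /enc_seq -map_comp.
by apply: pt_delimit; exact: Hg.
Qed.

Lemma pt_flatmap (l : E -> seq A) (g : E -> A -> seq B) :
  PT eE (enc_seq eA) l -> PT (eE ** eA) (enc_seq eB) (fun t => g t.1 t.2) ->
  PT eE (enc_seq eB) (fun e => flatten [seq g e a | a <- l e]).
Proof.
move=> Hl Hg; apply: pt_rawE.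
apply: pt_ext (@pt_flat l (fun e a => enc_seq eB (g e a)) Hl Hg).
move=> e; elim: (l e) => //= a s ->.
by rewrite enc_seq_cat.
Qed.

Lemma pt_scat (s1 s2 : E -> seq A) : PT eE (enc_seq eA) s1 -> PT eE (enc_seq eA) s2 ->
  PT eE (enc_seq eA) (fun e => s1 e ++ s2 e).
Proof.
move=> H1 H2; apply: pt_rawE; apply: pt_ext (pt_rcat (_ : PT _ enc_raw _) (_ : PT _ enc_raw _)).
- by move=> e; rewrite enc_seq_cat.
- exact: H1.
- exact: H2.
Qed.

Lemma pt_filter (l : E -> seq A) (p : E -> A -> bool) :
  PT eE (enc_seq eA) l -> PT (eE ** eA) enc_bool (fun t => p t.1 t.2) ->
  PT eE (enc_seq eA) (fun e => [seq a <- l e | p e a]).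
Proof.
move=> Hl Hp; apply: pt_rawE.
apply: pt_ext (@pt_flat l (fun e a => if p e a then delimit (eA a) else [::]) Hl _).
  move=> e; elim: (l e) => //= a s ->; by case: ifP.
apply: pt_if => //; last exact: pt_const.
by apply: pt_delimit; exact: (pt_snd (pt_id _)).
Qed.

Lemma pt_snilp (s : E -> seq A) : PT eE (enc_seq eA) s -> PT eE enc_bool (fun e => nilp (s e)).
Proof.
move=> Hs; apply: pt_ext (pt_rnilp (Hs : PT eE enc_raw (fun e => enc_seq eA (s e)))).
by move=> e; rewrite nilp_enc_seq.
Qed.

Lemma pt_ssize (s : E -> seq A) : PT eE (enc_seq eA) s -> PT eE enc_nat (fun e => size (s e)).
Proof.
move=> Hs; apply: pt_rawE; apply: pt_ext (@pt_flat s (fun _ _ => [:: true]) Hs _).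
  by move=> e; elim: (s e) => //= a t ->.
exact: pt_const.
Qed.

Lemma pt_negb (p : E -> bool) : PT eE enc_bool p -> PT eE enc_bool (fun e => ~~ p e).
Proof.
move=> Hp; apply: pt_ext (pt_if Hp (pt_const eE enc_bool false) (pt_const eE enc_bool true)).
by move=> e; case: (p e).
Qed.

Lemma pt_andb (p q : E -> bool) : PT eE enc_bool p -> PT eE enc_bool q ->
  PT eE enc_bool (fun e => p e && q e).
Proof.
move=> Hp Hq; apply: pt_ext (pt_if Hp Hq (pt_const eE enc_bool false)).
by move=> e; case: (p e).
Qed.

Lemma pt_orb (p q : E -> bool) : PT eE enc_bool p -> PT eE enc_bool q ->
  PT eE enc_bool (fun e => p e || q e).
Proof.
move=> Hp Hq; apply: pt_ext (pt_if Hp (pt_const eE enc_bool true) Hq).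
by move=> e; case: (p e).
Qed.

Lemma pt_implyb (p q : E -> bool) : PT eE enc_bool p -> PT eE enc_bool q ->
  PT eE enc_bool (fun e => p e ==> q e).
Proof.
move=> Hp Hq; apply: pt_ext (pt_if Hp Hq (pt_const eE enc_bool true)).
by move=> e; case: (p e).
Qed.

Lemma pt_eqb (p q : E -> bool) : PT eE enc_bool p -> PT eE enc_bool q ->
  PT eE enc_bool (fun e => p e == q e).
Proof.
move=> Hp Hq; apply: pt_ext (pt_if Hp Hq (pt_negb Hq)).
by move=> e; case: (p e); case: (q e).
Qed.

End Flat.

(** * Quantifiers over lists, unary arithmetic, decoding and finite case distinctions *)

Section Lists.
Variables (E A : Type) (eE : E -> string) (eA : A -> string).

Lemma pt_all (l : E -> seq A) (p : E -> A -> bool) :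
  PT eE (enc_seq eA) l -> PT (eE ** eA) enc_bool (fun t => p t.1 t.2) ->
  PT eE enc_bool (fun e => all (p e) (l e)).
Proof.
move=> Hl Hp; apply: pt_ext (pt_snilp
  (pt_filter (p := fun e a => ~~ p e a) Hl (pt_negb Hp))) => e.
by elim: (l e) => //= a s <-; case: (p e a).
Qed.

Lemma pt_has (l : E -> seq A) (p : E -> A -> bool) :
  PT eE (enc_seq eA) l -> PT (eE ** eA) enc_bool (fun t => p t.1 t.2) ->
  PT eE enc_bool (fun e => has (p e) (l e)).
Proof.
move=> Hl Hp; apply: pt_ext (pt_negb (pt_snilp (pt_filter (p := p) Hl Hp))) => e.
by elim: (l e) => //= a s <-; case: (p e a).
Qed.

Lemma pt_succ (f : E -> nat) : PT eE enc_nat f -> PT eE enc_nat (fun e => (f e).+1).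
Proof. by move=> Hf; exact: (pt_rpush true (Hf : PT eE enc_raw (fun e => enc_nat (f e)))). Qed.

Lemma pt_pred (f : E -> nat) : PT eE enc_nat f -> PT eE enc_nat (fun e => (f e).-1).
Proof.
move=> Hf; apply: pt_rawE.
apply: pt_ext (pt_behead (Hf : PT eE enc_raw (fun e => enc_nat (f e)))).
by move=> e; case: (f e).
Qed.

Lemma pt_addn (f g : E -> nat) : PT eE enc_nat f -> PT eE enc_nat g ->
  PT eE enc_nat (fun e => f e + g e).
Proof.
move=> Hf Hg; apply: pt_rawE; apply: pt_ext (pt_rcat
  (Hf : PT eE enc_raw (fun e => enc_nat (f e))) (Hg : PT eE enc_raw (fun e => enc_nat (g e)))).
by move=> e; rewrite /enc_nat nseqD.
Qed.

Lemma pt_iterN (n : E -> nat) (h : A -> A) (x : E -> A) :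
  PT eE enc_nat n -> PT eA eA h -> (forall a, size (eA (h a)) <= size (eA a)) ->
  PT eE eA x -> PT eE eA (fun e => iter (n e) h (x e)).
Proof.
move=> Hn Hh size_h Hx.
have bnd m a i : i <= m -> size (eA (iter i h a)) <= m + size (eA a).
  move=> _; apply: leq_trans (leq_addl _ _).
  by elim: i => //= i IHi; apply: leq_trans (size_h _) IHi.
exact: pt_comp (pt_iter Hh pol_id bnd) (pt_pair Hn Hx).
Qed.

End Lists.

Section Numbers.
Variables (E : Type) (eE : E -> string).

Lemma pt_subn (f g : E -> nat) : PT eE enc_nat f -> PT eE enc_nat g ->
  PT eE enc_nat (fun e => f e - g e).
Proof.
move=> Hf Hg; have := @pt_iterN E nat eE enc_nat g predn f Hg.
move=> /(_ (pt_pred (pt_id _))) H; apply: pt_ext (H _ Hf) => [e|n].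
  by elim: (g e) => [|n IHn]; rewrite ?subn0 // subnS -IHn.
by rewrite !size_nseq leq_pred.
Qed.
End Numbers.

Lemma pt_leq E (eE : E -> string) (f g : E -> nat) :
  PT eE enc_nat f -> PT eE enc_nat g -> PT eE enc_bool (fun e => f e <= g e).
Proof.
move=> Hf Hg; have H := pt_subn Hf Hg.
apply: pt_ext (pt_rnilp (H : PT eE enc_raw (fun e => enc_nat (f e - g e)))) => e.
by rewrite /nilp size_nseq.
Qed.

Lemma pt_eqn E (eE : E -> string) (f g : E -> nat) :
  PT eE enc_nat f -> PT eE enc_nat g -> PT eE enc_bool (fun e => f e == g e).
Proof.
move=> Hf Hg; apply: pt_ext (pt_andb (pt_leq Hf Hg) (pt_leq Hg Hf)) => e.
by rewrite eqn_leq.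
Qed.

Lemma enc_seq_cons A (eA : A -> string) a s :
  enc_seq eA (a :: s) = spair (eA a) (enc_seq eA s).
Proof. by []. Qed.

Lemma pt_iota E (eE : E -> string) (n : E -> nat) :
  PT eE enc_nat n -> PT eE (enc_seq enc_nat) (fun e => iota 0 (n e)).
Proof.
pose eS := enc_nat ** enc_seq enc_nat.
pose step (s : nat * seq nat) := (s.1.-1, s.1.-1 :: s.2).
have Hstep : PT eS eS step.
  apply: pt_pair; first exact: pt_pred (pt_fst (pt_id _)).
  by apply: pt_cons; [exact: pt_pred (pt_fst (pt_id _)) | exact: pt_snd (pt_id _)].
move=> Hn.
have bnd m s i : i <= m -> size (eS (iter i step s)) <=
    (fun k => k + k * (2 * k + 1)) (m + size (eS s)).
  move=> le_im.
  have: size (eS (iter i step s)) <= size (eS s) + i * (2 * size (eS s) + 1) /\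
    (iter i step s).1 <= size (eS s).
    elim: i {le_im} => [|i [IHi1 IHi2]] /=.
      by rewrite mul0n addn0 /eS /enc_prod size_spair size_nseq; split=> //; lia.
    move: IHi1 IHi2; case: (iter i step s) => k l.
    rewrite /step /eS /enc_prod /fst /snd enc_seq_cons !size_spair !size_nseq mulSn.
    set X := (i * _); move=> H1 H2; split; lia.
  case=> H _; apply: leq_trans H _; apply: leq_add; first exact: leq_addl.
  by apply: leq_mul; lia.
have HB : pol (fun k => k + k * (2 * k + 1)) by solve_pol.
have Hin : PT eE (enc_nat ** eS) (fun e => (n e, (n e, [::]))).
  by apply: pt_pair => //; apply: pt_pair => //; exact: pt_const.
apply: pt_ext (pt_snd (pt_comp (pt_iter Hstep HB bnd) Hin)) => e /=.
have H m k s : iter m step (m + k, s) = (k, iota k m ++ s).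
  elim: m s => [|m IHm] s; first by [].
  rewrite iterSr /step /= IHm; congr pair.
  by rewrite -[RHS]/(iota k m.+1 ++ s) -[m.+1]addn1 iotaD /= -catA addnC.
by have := H (n e) 0 [::]; rewrite addn0 cats0 => ->.
Qed.

Lemma pt_muln E (eE : E -> string) (f g : E -> nat) :
  PT eE enc_nat f -> PT eE enc_nat g -> PT eE enc_nat (fun e => f e * g e).
Proof.
move=> Hf Hg; apply: pt_rawE.
apply: pt_ext (@pt_flat _ _ _ enc_nat _ (fun e _ => enc_nat (g e)) (pt_iota Hf) _).
  move=> e; rewrite -[f e in RHS](size_iota 0).
  by elim: (iota _ _) => //= a s ->; rewrite mulSn /enc_nat nseqD.
exact: (pt_comp Hg (pt_fst (pt_id _))).
Qed.

Lemma pt_pol E (eE : E -> string) P (f : E -> nat) : pol P ->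
  PT eE enc_nat f -> PT eE enc_nat (fun e => P (f e)).
Proof.
move=> HP Hf; apply: (pt_comp (g := P) _ Hf); elim: HP.
- exact: pt_id.
- by move=> c; exact: pt_const.
- by move=> p q _ Hp _ Hq; exact: pt_addn.
- by move=> p q _ Hp _ Hq; exact: pt_muln.
Qed.

Lemma pt_drop E (eE : E -> string) (n : E -> nat) (s : E -> string) :
  PT eE enc_nat n -> PT eE enc_raw s -> PT eE enc_raw (fun e => drop (n e) (s e)).
Proof.
move=> Hn Hs; have := pt_iterN Hn (pt_behead (pt_id enc_raw)) _ Hs.
move=> H; apply: pt_ext (H _) => [e|x]; last by rewrite size_behead leq_pred.
elim: (n e) => [|m IHm]; first by rewrite drop0.
by rewrite iterS IHm -[m.+1]addn1 addnC -drop_drop drop1.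
Qed.

Lemma pt_nth E (eE : E -> string) (n : E -> nat) (s : E -> string) :
  PT eE enc_nat n -> PT eE enc_raw s -> PT eE enc_bool (fun e => nth false (s e) (n e)).
Proof.
by move=> Hn Hs; apply: pt_ext (pt_rhead (pt_drop Hn Hs)) => e;
  rewrite -nth0 nth_drop addn0.
Qed.

Lemma pt_eqstr E (eE : E -> string) (s t : E -> string) :
  PT eE enc_raw s -> PT eE enc_raw t -> PT eE enc_bool (fun e => s e == t e).
Proof.
move=> Hs Ht.
have H1 := pt_eqn (pt_rsize Hs) (pt_rsize Ht).
have H2 : PT eE enc_bool (fun e => all (fun i => nth false (s e) i == nth false (t e) i)
    (iota 0 (size (s e)))).
  apply: (@pt_all _ _ _ enc_nat _ (fun e i => nth false (s e) i == nth false (t e) i)).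
    exact: pt_iota (pt_rsize Hs).
  apply: pt_eqb; apply: pt_nth; try exact: pt_snd (pt_id _).
    exact: pt_comp Hs (pt_fst (pt_id _)).
  exact: pt_comp Ht (pt_fst (pt_id _)).
apply: pt_ext (pt_andb H1 H2) => e; apply/andP/eqP => [[/eqP Esz /allP H]|->].
  apply: (@eq_from_nth _ false) => // i lt_i; apply/eqP/H.
  by rewrite mem_iota.
by rewrite eqxx; split=> //; apply/allP.
Qed.

Lemma pt_eq E (eE : E -> string) (A : eqType) (eA : A -> string) (s t : E -> A) :
  injective eA -> PT eE eA s -> PT eE eA t -> PT eE enc_bool (fun e => s e == t e).
Proof.
move=> inj_e Hs Ht; apply: pt_ext (pt_eqstr (Hs : PT eE enc_raw (fun e => eA (s e)))
  (Ht : PT eE enc_raw (fun e => eA (t e)))) => e.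
exact: inj_eq.
Qed.

Lemma enc_nat_inj : injective enc_nat.
Proof. by move=> m n /(congr1 size); rewrite !size_nseq. Qed.

Lemma enc_fin_inj (T : finType) : injective (@enc_fin T).
Proof. by move=> x y /enc_nat_inj/ord_inj/enum_rank_inj. Qed.

Lemma spair_inj u w u' w' : spair u w = spair u' w' -> u = u' /\ w = w'.
Proof. by move=> /(congr1 und); rewrite !und_spair => -[-> ->]. Qed.

Lemma enc_prod_inj A B (eA : A -> string) (eB : B -> string) :
  injective eA -> injective eB -> injective (eA ** eB).
Proof. by move=> iA iB [a b] [a' b'] /spair_inj [/iA /= -> /iB /= ->]. Qed.

Lemma pt_half E (eE : E -> string) (f : E -> nat) :
  PT eE enc_nat f -> PT eE enc_nat (fun e => (f e)./2).
Proof.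
move=> Hf.
(* Exactly the numbers below [(f e)./2] pass the test, so counting them computes the half. *)
have H : PT eE (enc_seq enc_nat) (fun e => [seq i <- iota 0 (f e) | i + i + 2 <= f e]).
  apply: (@pt_filter _ _ _ enc_nat _ (fun e i => i + i + 2 <= f e)); first exact: pt_iota.
  apply: pt_leq; last exact: pt_comp Hf (pt_fst (pt_id _)).
  apply: pt_addn; last exact: pt_const.
  by apply: pt_addn; exact: pt_snd (pt_id _).
apply: pt_ext (pt_ssize H) => e.
rewrite (@eq_filter _ _ (fun i => i < 0 + (f e)./2)); last by move=> i /=; lia.
by rewrite filter_iota_ltn ?size_iota; lia.
Qed.

Lemma pt_odd E (eE : E -> string) (f : E -> nat) :
  PT eE enc_nat f -> PT eE enc_bool (fun e => odd (f e)).
Proof.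
move=> Hf; have H := pt_half Hf.
apply: pt_ext (pt_negb (pt_eqn Hf (pt_addn H H))) => e.
by rewrite addnn; have := odd_double_half (f e); case: (odd _); lia.
Qed.

(** The digit positions are those [i] for which the [i]-fold half of [n] is nonzero; this avoids
    computing the logarithm in [bits]. *)
Lemma bitsE n :
  bits n = [seq odd (iter i half n) | i <- iota 0 n & 0 < iter i half n].
Proof.
have itE i : iter i half n = n %/ 2 ^ i.
  elim: i => [|i IHi]; first by rewrite expn0 divn1.
  by rewrite iterS IHi -divn2 -divnMA expnSr.
rewrite (@eq_filter _ _ (fun i => i < 0 + up_log 2 n.+1)); last first.
  move=> i /=; rewrite itE add0n divn_gt0 ?expn_gt0 // -ltnS.
  apply/idP/idP => H; rewrite ltnNge; apply/negP => H'.
    have := leq_trans (up_logP n.+1 (isT : 1 < 2)) (leq_pexp2l (isT : 0 < 2) H').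
    by rewrite leqNgt H.
  by have := up_log_min (isT : 1 < 2) H'; rewrite leqNgt H.
rewrite filter_iota_ltn; last by rewrite up_log_min // ltn_expl.
by rewrite /bits /mkseq; apply: eq_map => i; rewrite itE.
Qed.

Lemma pt_bits E (eE : E -> string) (f : E -> nat) :
  PT eE enc_nat f -> PT eE enc_raw (fun e => bits (f e)).
Proof.
move=> Hf.
have Hit : PT (eE ** enc_nat) enc_nat (fun t => iter t.2 half (f t.1)).
  apply: pt_iterN; [exact: pt_snd (pt_id _)|exact: pt_half (pt_id _)| |].
    by move=> a; rewrite !size_nseq; lia.
  exact: pt_comp Hf (pt_fst (pt_id _)).
have H : PT eE (enc_seq enc_nat) (fun e => [seq i <- iota 0 (f e) | 0 < iter i half (f e)]).
  apply: (@pt_filter _ _ _ enc_nat _ (fun e i => 0 < iter i half (f e))).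
    exact: pt_iota.
  by apply: pt_leq; [exact: pt_const | exact: Hit].
apply: pt_ext (@pt_flat _ _ _ enc_nat _ (fun e i => [:: odd (iter i half (f e))]) H _).
  by move=> e; rewrite bitsE; elim: (filter _ _) => //= a s ->.
exact: (pt_odd Hit).
Qed.

(** A total decoder, as it will be applied to guessed strings that need not encode a list. *)
Definition dec_seq (w : string) : seq string :=
  let w_ i := iter i (fun w => (und w).2) w in
  [seq (und (w_ i)).1 | i <- iota 0 (size w) & ~~ nilp (w_ i)].

Lemma dec_seqK : cancel (enc_seq enc_raw) dec_seq.
Proof.
move=> l; rewrite /dec_seq; set w := enc_seq _ _.
have itE i : iter i (fun w => (und w).2) w = enc_seq enc_raw (drop i l).
  elim: i => [|i IHi]; first by rewrite drop0.
  rewrite iterS IHi; have [le_i|lt_i] := leqP (size l) i.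
    by rewrite !drop_oversize // ltnW.
  by rewrite (drop_nth [::] lt_i) enc_seq_cons und_spair.
rewrite (@eq_filter _ _ (fun i => i < 0 + size l)); last first.
  by move=> i /=; rewrite itE nilp_enc_seq /nilp size_drop -lt0n subn_gt0.
rewrite filter_iota_ltn; last exact: size_enc_seq.
apply: (@eq_from_nth _ [::]); rewrite size_map size_iota // => i lt_i.
rewrite (nth_map 0) ?size_iota // nth_iota // add0n itE (drop_nth [::] lt_i).
by rewrite enc_seq_cons und_spair.
Qed.

Lemma pt_dec_seq E (eE : E -> string) (f : E -> string) :
  PT eE enc_raw f -> PT eE (enc_seq enc_raw) (fun e => dec_seq (f e)).
Proof.
move=> Hf.
have Hit : PT (eE ** enc_nat) enc_raw (fun t => iter t.2 (fun w => (und w).2) (f t.1)).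
  apply: pt_iterN; [exact: pt_snd (pt_id _)|exact: pt_und2 (pt_id _)| |].
    by move=> a; apply: leq_trans (size_und a); exact: leq_addl.
  exact: pt_comp Hf (pt_fst (pt_id _)).
apply: (@pt_map _ _ _ _ enc_nat _ _
  (fun e i => (und (iter i (fun w => (und w).2) (f e))).1)); last exact: pt_und1.
apply: (@pt_filter _ _ _ enc_nat _
  (fun e i => ~~ nilp (iter i (fun w => (und w).2) (f e)))).
  exact: pt_iota (pt_rsize Hf).
exact: pt_negb (pt_rnilp Hit).
Qed.

Lemma pt_mem E (eE : E -> string) (x : E -> string) (l : E -> seq string) :
  PT eE enc_raw x -> PT eE (enc_seq enc_raw) l -> PT eE enc_bool (fun e => x e \in l e).
Proof.
move=> Hx Hl; apply: pt_ext (@pt_has _ _ _ enc_raw l (fun e y => y == x e) Hl _).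
  by move=> e; apply/hasP/idP => [[y Hy /eqP <-]|] // H; exists (x e).
by apply: pt_eqstr; [exact: pt_snd (pt_id _) | exact: pt_comp Hx (pt_fst (pt_id _))].
Qed.

Lemma pt_natcase A B (eA : A -> string) (eB : B -> string) k (F : nat -> A -> B) :
  (forall i, PT eA eB (F i)) -> PT (enc_nat ** eA) eB (fun t => F (minn t.1 k) t.2).
Proof.
elim: k F => [|k IHk] F HF.
  apply: pt_ext (pt_comp (HF 0) (pt_snd (pt_id _))) => t.
  by rewrite minn0.
have H := IHk (fun i => F i.+1) (fun i => HF i.+1).
have Hc : PT (enc_nat ** eA) enc_bool (fun t => t.1 == 0).
  by apply: pt_eqn; [exact: pt_fst (pt_id _) | exact: pt_const].
have Hp : PT (enc_nat ** eA) (enc_nat ** eA) (fun t => (t.1.-1, t.2)).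
  by apply: pt_pair; [exact: pt_pred (pt_fst (pt_id _)) | exact: pt_snd (pt_id _)].
apply: pt_ext (pt_if Hc (pt_comp (HF 0) (pt_snd (pt_id _))) (pt_comp H Hp)).
by move=> [[|n] a] //=; rewrite minnSS.
Qed.

(** A finite case distinction: it suffices that [f u] is polynomial-time for each [u] separately.
    The transition table of a machine enters the construction in this way. *)
Lemma pt_fin E A B (eE : E -> string) (eA : A -> string) (eB : B -> string)
    (T : finType) (t : E -> T) (x : E -> A) (f : T -> A -> B) :
  PT eE (@enc_fin T) t -> PT eE eA x -> (forall u, PT eA eB (f u)) ->
  PT eE eB (fun e => f (t e) (x e)).
Proof.
move=> Ht Hx Hf; case ET: (enum T) => [|t0 s].
  apply: PTR_sub PTR_id => y z [e _ _].
  by have := mem_enum T (t e); rewrite ET.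
rewrite {s ET}.
have H := @pt_natcase _ _ eA eB #|T| (fun i => f (nth t0 (enum T) i)) (fun i => Hf _).
apply: pt_ext (pt_comp H (pt_pair (Ht : PT eE enc_nat (fun e => enum_rank (t e))) Hx)).
move=> e /=; rewrite (minn_idPl _) ?nth_enum_rank //; exact: ltnW (ltn_ord _).
Qed.

(** * Computations as cliques *)

Section Transcript.
Variable M : tm.
Local Notation K1 := (tm_tapes M).+1.
Local Notation sym := (tm_sym M).

Definition loc : finType := (tm_state M * {ffun 'I_K1 -> tm_sym M})%type.

(** Halted configurations stutter, so every computation extends to exactly [T] steps. *)
Definition stp (a : loc) : tm_state M * {ffun 'I_K1 -> tm_sym M * move} :=
  if tm_halt a.1 then (a.1, [ffun i => (a.2 i, MoveS)]) else tm_delta a.1 a.2.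

Definition otag : finType := ('I_K1 * loc + option bool)%type.

(* [(inl (k, a), (t, (p, l)))]: at time [t] the state and the scanned symbols
   are [a] and the head of tape [k] is at position [p], which it last visited
   at time [l.-1] ([l = 0]: never before).  [(inr b, (0, (p, 0)))]: the initial
   content of cell [p] of tape 0 is [b].  The heads start at position [T]. *)
Definition opt := (otag * (nat * (nat * nat)))%type.

Definition mvok m p p' :=
  match m with MoveL => p'.+1 == p | MoveS => p' == p | MoveR => p' == p.+1 end.

Definition emb (b : option bool) : sym := omap inl b.

(** At time [T] the machine has halted with a one-bit output, so acceptance is visible in the symbol
    scanned on tape 0. *)
Definition valid_tag (u : otag) (T : nat) (n : nat * (nat * nat)) : bool :=
  match u with
  | inl (k, a) =>
      [&& (n.1 == 0) ==> (a.1 == tm_start M) && (n.2.1 == T), n.2.2 <= n.1,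
          (n.2.2 == 0) && (k != ord0) ==> (a.2 k == None) &
          (n.1 == T) ==> (a.2 ord0 == Some (inl true))]
  | inr _ => (n.1 == 0) && (n.2.2 == 0)
  end.

(** The third and fourth clauses for two time steps make the claimed last visit correct: the symbol
    read is the one written then, and all later steps on this tape are at other positions. The
    clause for two cells makes blanks spread to the right, so the cells from [T] on spell a
    string. *)
Definition cmp_tag (u u' : otag) (T : nat) (n n' : nat * (nat * nat)) : bool :=
  match u, u' with
  | inl (k, a), inl (k', a') =>
      [&& (n.1 == n'.1) ==> (a == a'),
          (n'.1 == n.1.+1) ==> (a'.1 == (stp a).1) &&
             ((k == k') ==> mvok ((stp a).2 k).2 n.2.1 n'.2.1),
          (n.1 < n'.1) && (k == k') && (n'.2.2 == n.1.+1) ==>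
             (n.2.1 == n'.2.1) && (((stp a).2 k).1 == a'.2 k) &
          (n.1 < n'.1) && (k == k') && (n'.2.2 <= n.1) ==> (n.2.1 != n'.2.1)]
  | inl (k, a), inr b =>
      [&& k == ord0, n.2.2 == 0 & n.2.1 == n'.2.1] ==> (a.2 ord0 == emb b)
  | inr b, inr b' =>
      [&& n'.2.1 == n.2.1.+1, T <= n.2.1 & b == None] ==> (b' == None)
  | inr _, inl _ => true
  end.

Definition diff_tag (u u' : otag) (n n' : nat * (nat * nat)) : bool :=
  match u, u' with
  | inl (k, a), inl (k', a') => (n.1 != n'.1) || (k != k')
  | inr b, inr b' => n.2.1 != n'.2.1
  | _, _ => true
  end.

Definition compat (T : nat) (o o' : opt) : bool :=
  [&& diff_tag o.1 o'.1 o.2 o'.2, valid_tag o.1 T o.2, valid_tag o'.1 T o'.2,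
      cmp_tag o.1 o'.1 T o.2 o'.2 & cmp_tag o'.1 o.1 T o'.2 o.2].

Lemma diff_tag_sym u u' n n' : diff_tag u u' n n' = diff_tag u' u n' n.
Proof.
case: u u' => [[k a]|b] [[k' a']|b'] //=; last by rewrite eq_sym.
by rewrite [n.1 == _]eq_sym [k == _]eq_sym.
Qed.

Lemma compat_sym T o o' : compat T o o' = compat T o' o.
Proof.
rewrite /compat diff_tag_sym; congr (_ && _); rewrite andbCA; congr (_ && (_ && _)).
by rewrite andbC.
Qed.

Lemma compat_irr T o : compat T o o = false.
Proof.
by case: o => [[[k a]|b] n]; rewrite /compat /= ?eqxx.
Qed.

Section Run.
Variables (w : string) (T : nat).

Definition cfg t := iter t (@tm_step M) (tm_init M w).
Definition hd t k : sym := tape_head (cfg_tapes (cfg t) k).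
Definition la t : loc := (cfg_state (cfg t), [ffun k => hd t k]).
Definition wr k t := ((stp (la t)).2 k).1.

Definition mvp m p := match m with MoveL => p.-1 | MoveS => p | MoveR => p.+1 end.

Fixpoint pos k t : nat :=
  if t is t'.+1 then mvp ((stp (la t')).2 k).2 (pos k t') else T.

Fixpoint lastv (ps : nat -> nat) t x : nat :=
  if t is t'.+1 then if ps t' == x then t else lastv ps t' x else 0.

Definition input (p : nat) : option bool :=
  if p < T then None else nth None [seq Some b | b <- w] (p - T).

Definition f0 (k : 'I_K1) p : sym := if k == ord0 then emb (input p) else None.

Definition cont k t x : sym :=
  if lastv (pos k) t x is s.+1 then wr k s else f0 k x.

Lemma lastv_le ps t x : lastv ps t x <= t.
Proof. by elim: t => //= t IHt; case: ifP => // _; apply: leqW. Qed.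

Lemma lastv_eq ps t x s : lastv ps t x = s.+1 -> s < t /\ ps s = x.
Proof.
elim: t => //= t IHt; case: eqP => [E [<-] //|_ /IHt [lt_s ->]].
by split=> //; apply: leqW.
Qed.

Lemma lastv_ne ps t x s : lastv ps t x <= s -> s < t -> ps s <> x.
Proof.
elim: t => //= t IHt; case: eqP => [_|Ne]; first by lia.
by move=> H; rewrite ltnS leq_eqVlt => /orP[/eqP -> //|]; apply: IHt.
Qed.

(* The constraints of [cmp_tag] on [l] determine it. *)
Lemma lastv_unique ps t x l : l <= t ->
  (forall s, s < t -> l = s.+1 -> ps s = x) ->
  (forall s, s < t -> l <= s -> ps s <> x) -> l = lastv ps t x.
Proof.
elim: t => [|t IHt] /= le_l H1 H2; first by lia.
case: eqP => [E|Ne].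
  by case: (ltngtP l t.+1) le_l => // lt_l _; case: (H2 t (ltnSn t)).
apply: IHt => [|s lt_s|s lt_s].
- rewrite leq_eqVlt ltnS in le_l; case/orP: le_l => // /eqP El.
  by case: Ne; apply: H1.
- by apply: H1; apply: leqW.
- by apply: H2; apply: leqW.
Qed.

(** Because of the starting position [T], the predecessor in [mvp] is never truncated during [T]
    steps, and the cells up to [2 * T] suffice. *)
Lemma pos_bounds k t : T <= pos k t + t /\ pos k t <= T + t.
Proof.
by elim: t => /= [|t [IH1 IH2]]; [lia | case: (_.2) => /=; lia].
Qed.

(** Nothing is claimed about the cells to the left of position 0, which no head reaches in time. *)
Definition tape_repr (t : tape M) p (f : nat -> sym) :=
  [/\ tape_head t = f p, forall i, nth None (tape_right t) i = f (p + 1 + i) &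
      forall i, i < p -> nth None (tape_left t) i = f (p - 1 - i)].

Lemma write_move_repr t p f am : 0 < p -> tape_repr t p f ->
  tape_repr (write_move t am) (mvp am.2 p) (fun x => if x == p then am.1 else f x).
Proof.
case: t => l h r; case: am => a m p_gt0 [/= H1 H2 H3]; case: m; split=> //=.
- by rewrite -nth0 H3 // ifN; [congr f; lia | apply/eqP; lia].
- move=> [|i] /=; first by rewrite ifT //; apply/eqP; lia.
  by rewrite ifN ?H2; [congr f; lia | apply/eqP; lia].
- move=> i lt_i; rewrite nth_behead H3 ?ifN; [congr f; lia | apply/eqP; lia | lia].
- by rewrite eqxx.
- by move=> i; rewrite ifN ?H2 //; apply/eqP; lia.
- by move=> i lt_i; rewrite ifN ?H3 //; apply/eqP; lia.
- by rewrite ifN; [rewrite -nth0 H2; congr f; lia | apply/eqP; lia].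
- by move=> i; rewrite nth_behead H2 ifN; [congr f; lia | apply/eqP; lia].
- move=> [|i] lt_i /=; first by rewrite ifT //; apply/eqP; lia.
  by rewrite ifN ?H3; [congr f; lia | lia | apply/eqP; lia].
Qed.

Lemma step_la t : cfg t.+1 = Config (stp (la t)).1
   (fun k => write_move (cfg_tapes (cfg t) k) ((stp (la t)).2 k)).
Proof.
rewrite /cfg iterS -/(cfg t) /tm_step /stp /=; case: ifP => // Hh.
case E: (cfg t) => [q tp] /=; congr Config; apply: functional_extensionality => k.
by rewrite !ffunE /hd E /=; case: (tp k).
Qed.

Lemma cont_repr k t : t <= T -> tape_repr (cfg_tapes (cfg t) k) (pos k t) (cont k t).
Proof.
elim: t => [|t IHt] le_t.
  rewrite /cont /=; rewrite /f0 /input.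
  have E i : nth None [seq Some (inl b) | b <- w] i =
      emb (nth None [seq Some b | b <- w] i) :> sym.
    have [lt_i|le_i] := ltnP i (size w); first by rewrite !(nth_map false).
    by rewrite !nth_default ?size_map.
  case: eqP => _ /=; split=> //=.
  - by rewrite ltnn subnn -E; case: (w).
  - move=> i; rewrite ifN; last by lia.
    by rewrite -E nth_behead; congr (nth None _ _); lia.
  - by move=> i lt_i; rewrite nth_nil ifT //; lia.
  - by move=> i; rewrite nth_nil.
  - by move=> i; rewrite nth_nil.
have p_gt0 : 0 < pos k t by have [] := pos_bounds k t; lia.
have := write_move_repr ((stp (la t)).2 k) p_gt0 (IHt (ltnW le_t)).
have -> : (fun x => if x == pos k t then ((stp (la t)).2 k).1 else cont k t x) =
    cont k t.+1.
  by apply: functional_extensionality => x; rewrite /cont /= eq_sym; case: eqP.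
by rewrite step_la.
Qed.

Lemma hd_cont t k : t <= T -> hd t k = cont k t (pos k t).
Proof. by move=> le_t; case: (cont_repr k le_t). Qed.

Lemma run_output t b n : n <= t ->
  tm_computes_within M n w [:: b] -> hd t ord0 = Some (inl b).
Proof.
move=> le_n [Hh Ho].
have E : cfg t = cfg n.
  rewrite /cfg -(subnK le_n) iterD -/(cfg n); elim: (t - n) => //= m ->.
  by rewrite /tm_step Hh.
move: Ho; rewrite /tm_output /hd E -/(cfg n).
by case: (tape_head _) => [[c [->]|]|] //=.
Qed.

End Run.
End Transcript.

(** * Accepting computations and families of pairwise compatible options *)

Section CookLevin.
Variables (M : tm) (B T : nat) (z : string).
Local Notation K1 := (tm_tapes M).+1.

(** The part of the input that is known from [z]: since [delimit z] is a prefix of [spair z y], only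
    the [B] cells behind it are free, for the witness. *)
Definition cellok p (b : option bool) : bool :=
  if p < T then b == None
  else if p - T < size (delimit z) then b == Some (nth false (delimit z) (p - T))
  else (p - T < size (delimit z) + B) || (b == None).

Definition optS (S : nat -> 'I_K1 -> loc M * (nat * nat)) t k : opt M :=
  (inl (k, (S t k).1), (t, (S t k).2)).

Definition optC (c : nat -> option bool) p : opt M := (inr (c p), (0, (p, 0))).

Definition good_family S c :=
  [/\ forall t t' k k', t <= T -> t' <= T -> (t, k) <> (t', k') ->
        compat T (optS S t k) (optS S t' k'),
      forall t k p, t <= T -> p <= 2 * T -> compat T (optS S t k) (optC c p),
      forall p p', p <= 2 * T -> p' <= 2 * T -> p <> p' ->
        compat T (optC c p) (optC c p') &
      forall p, p <= 2 * T -> cellok p (c p)].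

Variable chi : string -> bool.
Hypothesis T_large : size (delimit z) + B <= T.
Hypothesis M_chi : forall y, size y <= B ->
  exists2 n, n <= T & tm_computes_within M n (spair z y) [:: chi (spair z y)].

Lemma witness_family y : size y <= B -> chi (spair z y) ->
  exists S c, good_family S c /\ forall t k, t <= T ->
    (S t k).2.1 <= 2 * T /\ (S t k).2.2 <= T.
Proof.
move=> le_y Hchi; set w := spair z y in Hchi.
pose S t (k : 'I_K1) : loc M * (nat * nat) :=
  (la M w t, (pos w T k t, lastv (pos w T k) t (pos w T k t))).
have [n le_n Hn] := M_chi le_y; rewrite -/w Hchi in Hn.
have hdE t (k : 'I_K1) : t <= T -> hd w t k = cont w T k t (pos w T k t) by exact: hd_cont.
have vS t k : t <= T -> valid_tag (inl (k, la M w t)) T (t, (S t k).2).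
  move=> le_t; apply/and4P; split=> /=.
  - by apply/implyP => /eqP ->; rewrite /= !eqxx.
  - exact: lastv_le.
  - apply/implyP => /andP[/eqP E Nk]; rewrite ffunE hdE // /cont E /f0.
    by rewrite (negbTE Nk).
  - apply/implyP => /eqP ->; rewrite ffunE.
    by apply/eqP; exact: (run_output le_n Hn).
have cS t t' k k' : t <= T -> t' <= T ->
    cmp_tag (inl (k, la M w t)) (inl (k', la M w t')) T (t, (S t k).2) (t', (S t' k').2).
  move=> le_t le_t'; apply/and4P; split=> /=; apply/implyP.
  - by move/eqP=> ->.
  - move/eqP=> Et'; rewrite Et' in le_t' *.
    rewrite {1}/la step_la /= eqxx /=; apply/implyP => /eqP <-.
    have [] := pos_bounds w T k t; rewrite /mvok /mvp.
    by case: (_.2) => //; rewrite ?eqxx //; move=> *; apply/eqP; lia.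
  - move=> /andP[/andP[lt_t /eqP <-] /eqP El].
    have [_ Ep] := lastv_eq El; rewrite Ep eqxx /= ffunE hdE // /cont El.
    by rewrite /wr.
  - move=> /andP[/andP[lt_t /eqP <-] El]; apply/eqP.
    exact: lastv_ne El lt_t.
have vC p : valid_tag (inr (input w T p) : otag M) T (0, (p, 0)) by [].
exists S, (input w T); split; last first.
  move=> t k le_t; have [_] := pos_bounds w T k t.
  have := lastv_le (pos w T k) t (pos w T k t).
  by rewrite /=; lia.
split.
- move=> t t' k k' le_t le_t' Ne; rewrite /compat vS // vS // cS // cS // !andbT.
  by apply/orP; have [Et|] := eqVneq t t'; [right; apply/eqP=> Ek; apply: Ne; rewrite Et Ek | left].
- move=> t k p le_t le_p; rewrite /compat vS // vC /= andbT.
  apply/implyP => /and3P[/eqP -> /eqP El /eqP <-].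
  by rewrite ffunE hdE // /cont El /f0 eqxx.
- move=> p p' le_p le_p' Ne; rewrite /compat !vC /=.
  have cC q q' : [&& q' == q.+1, T <= q & input w T q == None] ==> (input w T q' == None).
    apply/implyP => /and3P[/eqP -> le_q]; rewrite /input !ifN; try lia.
    have [lt_i|le_i] := ltnP (q - T) (size w); first by rewrite (nth_map false).
    by rewrite !nth_default // size_map; lia.
  by apply/and3P; split; [apply/eqP | exact: cC | exact: cC].
- move=> p le_p; rewrite /cellok /input; case: (ltnP p T) => // le_T.
  rewrite /w /spair map_cat nth_cat size_map; case: ifP => lt_p.
    by rewrite lt_p (nth_map false) ?eqxx.
  rewrite lt_p; have [lt_i|le_i] := ltnP (p - T - size (delimit z)) (size y); last first.
    by rewrite nth_default ?size_map // orbT.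
  by rewrite (_ : _ < _ + _) //; lia.
Qed.

(** The witness is read off the cells behind [delimit z] up to the first blank, at most [B] of them;
    after it all cells are blank. *)
Lemma cells_input c : (forall p, p <= 2 * T -> cellok p (c p)) ->
  (forall p, T <= p -> p < 2 * T -> c p = None -> c p.+1 = None) ->
  exists2 y, size y <= B & forall p, p <= 2 * T -> c p = input (spair z y) T p.
Proof.
move=> Hok Hchain; set L := size (delimit z); have TL : L + B <= T by [].
pose k := find (fun j => c (T + L + j) == None) (iota 0 B).
have le_k : k <= B by rewrite -[X in _ <= X](size_iota 0 B) find_size.
pose y := [seq odflt false (c (T + L + j)) | j <- iota 0 k].
have sy : size y = k by rewrite size_map size_iota.
have someC j : j < k -> c (T + L + j) = Some (nth false y j).
  move=> lt_j; rewrite (nth_map 0) ?size_iota // nth_iota // add0n.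
  have := before_find 0 lt_j; rewrite nth_iota ?add0n; last by lia.
  by case: (c _).
have noneC j : k <= j -> T + L + j <= 2 * T -> c (T + L + j) = None.
  elim: j => [|j IHj] le_kj le_j.
    have [le_B|lt_k] := leqP B k.
      have := Hok _ le_j; rewrite /cellok -/L ifN; last by lia.
      by rewrite ifN ?ifN; [case: ltnP => //=; [lia | move=> _ /eqP] | lia].
    have : has (fun j => c (T + L + j) == None) (iota 0 B).
      by rewrite has_find size_iota.
    by move/(nth_find 0)/eqP; rewrite -/k nth_iota // add0n (_ : k = 0) //; lia.
  have [Ek|Nk] := eqVneq k j.+1; last first.
    by rewrite addnS; apply: Hchain; [lia | lia | apply: IHj; lia].
  have [le_B|lt_k] := leqP B k.
    have := Hok _ le_j; rewrite /cellok -/L ifN; last by lia.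
    by rewrite ifN; [case: ltnP => //=; [lia | move=> _ /eqP] | lia].
  have : has (fun j => c (T + L + j) == None) (iota 0 B).
    by rewrite has_find size_iota.
  by move/(nth_find 0)/eqP; rewrite -/k nth_iota // add0n Ek.
exists y; first by rewrite sy.
move=> p le_p; have := Hok p le_p; rewrite /cellok /input.
case: ltnP => [_ /eqP //|le_Tp].
rewrite /spair map_cat nth_cat size_map -/L; case: ltnP => [lt_p /eqP ->|le_L _].
  by rewrite (nth_map false).
have Ep : p = T + L + (p - T - L) by lia.
rewrite {1}Ep; have [lt_k|le_kp] := ltnP (p - T - L) k.
  by rewrite someC // (nth_map false) // sy.
rewrite noneC //; last by rewrite -Ep.
by rewrite nth_default // size_map sy.
Qed.

(** By strong induction on the time, the options describe the real run: the previous step gives the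
    position, the position and the earlier steps give the last visit through [lastv_unique], and the
    last visit gives the scanned symbol. The validity condition at time [T] then says that the run
    accepts. *)
Lemma family_witness S c : good_family S c ->
  exists2 y, size y <= B & chi (spair z y).
Proof.
case=> HSS HSC HCC Hcell.
have [y le_y HC] : exists2 y, size y <= B &
    forall p, p <= 2 * T -> c p = input (spair z y) T p.
  apply: cells_input => // p le_p lt_p Ec.
  have /and5P[_ _ _ /implyP H _] := HCC p p.+1 (ltnW lt_p) lt_p (@n_Sn p).
  by apply/eqP/H; rewrite /= eqxx le_p Ec.
exists y => //; set w := spair z y in HC *.
have [n le_n Hn] := M_chi le_y; rewrite -/w in Hn.
have vS t k : t <= T -> valid_tag (inl (k, (S t k).1)) T (t, (S t k).2).
  by move=> le_t; have /and5P[] := HSC t k 0 le_t (leq0n _).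
have eqS t k k' : t <= T -> (S t k).1 = (S t k').1.
  move=> le_t; have [-> //|Nk] := eqVneq k k'.
  have Ne : (t, k) <> (t, k') by case=> /eqP; rewrite (negbTE Nk).
  have /and5P[_ _ _ /and4P[/implyP H _ _ _] _] := HSS t t k k' le_t le_t Ne.
  by apply/eqP/H => /=.
have main t : t <= T -> (forall k, (S t k).1 = la M w t /\ (S t k).2.1 = pos w T k t).
  elim/ltn_ind: t => t IH le_t.
  have Hpos k : (S t k).2.1 = pos w T k t.
    case: t IH le_t => [|t] IH le_t.
      by have /and4P[/implyP/(_ isT)/andP[_ /eqP ->]] := vS 0 k le_t.
    have Ne : (t, k) <> (t.+1, k) by case=> /n_Sn.
    have /and5P[_ _ _ /and4P[_ /implyP H _ _] _] := HSS t t.+1 k k (ltnW le_t) le_t Ne.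
    have /= := H (eqxx _); have [-> ->] := IH t (ltnSn t) (ltnW le_t) k.
    rewrite eqxx => /andP[_] /=.
    by rewrite /mvok /mvp; case: (_.2) => /eqP //; lia.
  have Hlast k : (S t k).2.2 = lastv (pos w T k) t (pos w T k t).
    apply: lastv_unique.
    - by have /and4P[] := vS t k le_t.
    - move=> s lt_s El; have le_s := leq_trans (ltnW lt_s) le_t.
      have Ne : (s, k) <> (t, k) by case=> E; rewrite E ltnn in lt_s.
      have /and5P[_ _ _ /and4P[_ _ /implyP H _] _] := HSS s t k k le_s le_t Ne.
      have [_ <-] := IH s lt_s le_s k; rewrite -Hpos.
      by have /= := H; rewrite lt_s El !eqxx => /(_ isT)/andP[/eqP].
    - move=> s lt_s El; have le_s := leq_trans (ltnW lt_s) le_t.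
      have Ne : (s, k) <> (t, k) by case=> E; rewrite E ltnn in lt_s.
      have /and5P[_ _ _ /and4P[_ _ _ /implyP H] _] := HSS s t k k le_s le_t Ne.
      have [_ <-] := IH s lt_s le_s k; rewrite -Hpos.
      by have /= := H; rewrite lt_s El !eqxx => /(_ isT)/eqP.
  have Hhd k : (S t k).1.2 k = hd w t k.
    rewrite (@hd_cont M w T) // /cont -Hlast.
    case El: ((S t k).2.2) => [|s].
      rewrite /f0; case: eqP => [Ek|Nk]; last first.
        have /and4P[_ _ /implyP H _] := vS t k le_t.
        by apply/eqP/H; rewrite /= El eqxx; apply/eqP.
      have le_p : pos w T k t <= 2 * T by have [_] := pos_bounds w T k t; lia.
      have /and5P[_ _ _ /implyP H _] := HSC t k _ le_t le_p.
      have /= := H; rewrite El Hpos Ek !eqxx => /(_ isT)/eqP ->.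
      by rewrite -Ek HC.
    have [lt_s Eps] : s < t /\ pos w T k s = pos w T k t.
      by apply: lastv_eq; rewrite -Hlast.
    have le_s := leq_trans (ltnW lt_s) le_t.
    have Ne : (s, k) <> (t, k) by case=> E; rewrite E ltnn in lt_s.
    have /and5P[_ _ _ /and4P[_ _ /implyP H _] _] := HSS s t k k le_s le_t Ne.
    have /= := H; rewrite lt_s El !eqxx => /(_ isT)/andP[_ /eqP <-].
    by rewrite /wr; have [-> _] := IH s lt_s le_s k.
  move=> k; split=> //; rewrite [(S t k).1]surjective_pairing /la; congr pair.
    case: t IH le_t {Hpos Hlast Hhd} => [|t] IH le_t.
      by have /and4P[/implyP/(_ isT)/andP[/eqP ->]] := vS 0 k le_t.
    have Ne : (t, k) <> (t.+1, k) by case=> /n_Sn.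
    have /and5P[_ _ _ /and4P[_ /implyP H _ _] _] := HSS t t.+1 k k (ltnW le_t) le_t Ne.
    have /= := H (eqxx _); have [-> _] := IH t (ltnSn t) (ltnW le_t) k.
    have Ec : cfg_state (cfg M w t.+1) = (stp (la M w t)).1 by rewrite step_la.
    by move=> /andP[/eqP -> _]; exact: esym Ec.
  by apply/ffunP => k'; rewrite ffunE -Hhd (eqS t k k').
have /and4P[_ _ _ /implyP H] := vS T ord0 (leqnn T).
have := H (eqxx _); have [-> _] := main T (leqnn T) ord0.
rewrite /= ffunE (run_output le_n Hn) => /eqP[].
by case: (chi w).
Qed.

End CookLevin.

(** * Optimal coalitions around a hub *)

Section Coalitions.
Variables (V : finType) (E : {set {set V}}) (U : {set V}) (r : V) (c : nat).
Hypothesis E2 : forall e, e \in E -> #|e| = 2.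
Hypothesis EU : forall e, e \in E -> exists2 u, u \in U & u \in e.
Hypothesis rU : r \notin U.

Definition rweight (e : {set V}) : nat := if r \in e then c else 1.

Definition block_value (C : {set V}) := \sum_(e in E | e \subset C) rweight e.

Lemma partition_valueE (w : {e : {set V} | e \in E} -> nat) P :
  (forall e, w e = rweight (val e)) -> partition_value w P = \sum_(C in P) block_value C.
Proof.
move=> Hw; apply: eq_bigr => C _; rewrite /block_value big_sub_cond.
by apply: eq_bigr => e _.
Qed.

Lemma edge_other (e : {set V}) u : e \in E -> u \in e -> exists2 x, x != u & e = [set u; x].
Proof.
move=> /E2/eqP/cards2P [x [y [Nxy ->]]]; rewrite !inE => /orP[/eqP ->|/eqP ->].
  by exists y; rewrite // eq_sym.
by exists x; rewrite // setUC.
Qed.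

(** Every edge inside [C] has weight 1 and is charged to an endpoint in [U], which has at most [c]
    neighbours in [C]. *)
Lemma rfree_block (C : {set V}) : r \notin C -> #|C| <= c.+1 -> block_value C <= #|C :&: U| * c.
Proof.
move=> NrC leC.
apply: (@leq_trans (\sum_(e in E | e \subset C) \sum_(u in C :&: U) (u \in e))).
  apply: leq_sum => e /andP[eE sC]; rewrite /rweight ifN; last first.
    by apply: contra NrC; apply/subsetP.
  have [u uU ue] := EU eE; rewrite (bigD1 u) /= ?ue ?leq_addr //.
  by rewrite inE uU (subsetP sC).
rewrite exchange_big /= -sum_nat_const; apply: leq_sum => u; rewrite inE => /andP[uC _].
rewrite -big_mkcondr /= sum1dep_card.
apply: (@leq_trans #|[set [set u; x] | x in C :\ u]|).
  apply/subset_leq_card/subsetP => e; rewrite inE => /andP[/andP[eE sC] ue].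
  have [x Nx Ee] := edge_other eE ue; apply/imsetP; exists x => //.
  by rewrite !inE Nx (subsetP sC) // Ee !inE eqxx orbT.
apply: leq_trans (leq_imset_card _ _) _.
by have := cardsD1 u C; rewrite uC; lia.
Qed.

Definition inner (R : {set V}) := [set e in E | e \subset R].

(** As [r] is outside [U], every edge at [r] leads to a vertex of [U]; the other edges have weight 1
    and avoid [r]. *)
Lemma root_block (C : {set V}) : r \in C -> block_value C <= #|C :&: U| * c + #|inner (C :\ r)|.
Proof.
move=> rC; rewrite /block_value (bigID (fun e : {set V} => r \in e)) /=; apply: leq_add.
  rewrite (eq_bigr (fun=> c)) => [|e /andP[_ re]]; last by rewrite /rweight re.
  rewrite sum_nat_cond_const leq_mul2r; apply/orP; right.
  apply: (@leq_trans #|[set [set r; x] | x in C :&: U]|); last exact: leq_imset_card.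
  apply/subset_leq_card/subsetP => e; rewrite inE => /andP[/andP[eE sC] re].
  have [x Nx Ee] := edge_other eE re; apply/imsetP; exists x => //.
  have [u uU] := EU eE; rewrite Ee !inE => /orP[/eqP Eu|/eqP Eu].
    by rewrite Eu (negbTE rU) in uU.
  by rewrite -Eu uU andbT (subsetP sC) // Ee Eu !inE eqxx orbT.
rewrite (eq_bigr (fun=> 1)) => [|e /andP[_ re]]; last by rewrite /rweight (negbTE re).
rewrite sum1dep_card; apply/subset_leq_card/subsetP => e.
rewrite !inE => /andP[/andP[eE sC] re]; rewrite eE subsetD1 sC.
by [].
Qed.

Lemma inner_bin R : #|inner R| <= 'C(#|R|, 2).
Proof.
rewrite -cards_draws; apply/subset_leq_card/subsetP => e.
by rewrite !inE => /andP[/E2 -> ->].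
Qed.

(** The terms [#|C :&: U| * c] add up to [#|U| * c] for every partition. The surplus ['C(c, 2)] must
    therefore come from edges among the at most [c] companions of [r], which forces all pairs to be
    edges. *)
Lemma value_clique P : 2 <= c -> cap_partition c.+1 P ->
  #|U| * c + 'C(c, 2) <= \sum_(C in P) block_value C ->
  exists R : {set V}, [/\ r \notin R, #|R| = c &
    forall x y, x \in R -> y \in R -> x != y -> [set x; y] \in E].
Proof.
move=> c_ge2 [PP capP] Hval.
have rcov : r \in cover P by rewrite (cover_partition PP).
pose C0 := pblock P r; have C0P : C0 \in P by rewrite pblock_mem.
have rC0 : r \in C0 by rewrite mem_pblock.
have tI := partition_trivIset PP.
have NrC C : C \in P -> C != C0 -> r \notin C.
  move=> CP NC; apply: contra NC => rC; apply/eqP.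
  exact: esym (def_pblock tI CP rC).
exists (C0 :\ r); set R := C0 :\ r.
have cardR : #|R| <= c.
  by have := cardsD1 r C0; rewrite rC0 -/R; have := capP _ C0P; lia.
have ub : \sum_(C in P) block_value C <= #|U| * c + #|inner R|.
  rewrite (bigD1 C0) //=.
  have EUc : #|U| * c = #|C0 :&: U| * c + \sum_(C in P | C != C0) #|C :&: U| * c.
    rewrite -[LHS](_ : \sum_(C in P) #|C :&: U| * c = _); last first.
      rewrite -big_distrl /=; congr (_ * c).
      have := @set_partition_big_cond _ _ _ addn P setT (mem U) (fun=> 1) PP.
      rewrite sum1_card => H; rewrite -[RHS](_ : #|[predI setT & U]| = _); last first.
        by apply: eq_card => x; rewrite !inE.
      rewrite H; apply: eq_bigr => C _; rewrite -sum1_card.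
      by apply: eq_bigl => x; rewrite !inE.
    by rewrite (bigD1 C0).
  rewrite EUc addnAC; apply: leq_add; first exact: root_block.
  by apply: leq_sum => C /andP[CP NC]; apply: rfree_block; [exact: NrC | exact: capP].
have inR : 'C(c, 2) <= #|inner R| by lia.
have inR2 := inner_bin R.
have EcR : #|R| = c.
  (* Here [c >= 2] matters: it makes ['C(c.-1, 2)] smaller than ['C(c, 2)], so fewer than [c]
     companions have too few pairs. *)
  have [//|lt_R] : #|R| = c \/ #|R| < c by lia.
  have : 'C(#|R|, 2) < 'C(c, 2).
    have H1 : 'C(c.-1, 2) + c.-1 = 'C(c, 2).
      by case: (c) c_ge2 => // m _; rewrite binS bin1.
    have : 'C(#|R|, 2) <= 'C(c.-1, 2) by apply: leq_bin2l; lia.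
    by lia.
  by lia.
split=> //; first by rewrite !inE eqxx.
move=> x y xR yR Nxy.
have sub : inner R \subset [set A : {set V} | A \subset R & #|A| == 2].
  by apply/subsetP => e; rewrite !inE => /andP[/E2 -> ->].
have /eqP Ein : inner R == [set A : {set V} | A \subset R & #|A| == 2].
  by rewrite eqEcard sub cards_draws EcR.
have : [set x; y] \in inner R.
  by rewrite Ein inE cards2 Nxy eqxx andbT; apply/subsetP => v; rewrite in_set2 => /orP[] /eqP ->.
by rewrite inE => /andP[].
Qed.

Variables (key : eqType) (kf : V -> key) (R : {set V}) (F : V -> {set V}).
Hypothesis rR : r \notin R.
Hypothesis cardR : #|R| = c.
Hypothesis cliqueR : forall x y, x \in R -> y \in R -> x != y -> [set x; y] \in E.
Hypothesis rE : forall u, u \in U -> [set r; u] \in E.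
Hypothesis FE : forall u f, u \in U -> f \in F u -> [set u; f] \in E.
Hypothesis cardF : forall u, u \in U -> #|F u| = c.
Hypothesis FU : forall u f, u \in U -> f \in F u -> f \notin U /\ f != r.
Hypothesis kcap : forall x, #|[set y | kf y == kf x]| <= c.+1.
Hypothesis kR : forall x, x \in R -> kf x = kf r.
Hypothesis kF : forall u f, u \in U :\: R -> f \in F u -> kf f = kf u.

Let P := preim_partition kf [set: V].

Lemma key_partition : cap_partition c.+1 P.
Proof.
split; first exact: preim_partitionP.
move=> C /imsetP [x _ ->]; apply: leq_trans (kcap x); apply/subset_leq_card/subsetP => y.
by rewrite !inE eq_sym.
Qed.

Lemma leq_sum_sub (T : finType) (A B : {set T}) (f : T -> nat) : A \subset B ->
  \sum_(e in A) f e <= \sum_(e in B) f e.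
Proof.
move=> sAB; rewrite [leqRHS](big_setID A) /= (setIidPr sAB); exact: leq_addr.
Qed.

(** The blocks are the fibres of [kf]. Three disjoint families of edges inside blocks reach the
    bound exactly: those from [r] to [R :&: U], of weight [c]; the pairs in [R]; and those from each
    [u] in [U :\: R] to its [c] fillers. *)
Lemma key_value : #|U| * c + 'C(c, 2) <= \sum_(C in P) block_value C.
Proof.
pose mono := [set e in E | [exists C in P, e \subset C]].
apply: (@leq_trans (\sum_(e in mono) rweight e)); last first.
  rewrite /block_value (exchange_big_dep (mem E)) /=; last by move=> C e _ /andP[].
  rewrite [leqRHS](_ : _ = \sum_(e in E) \sum_(C in P | e \subset C) rweight e); last first.
    by apply: eq_bigr => e eE; apply: eq_bigl => C; rewrite eE.
  rewrite (_ : \sum_(e in mono) _ = \sum_(e in E | [exists C in P, e \subset C]) rweight e);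
    last by apply: eq_bigl => e; rewrite inE.
  rewrite big_mkcondr /=; apply: leq_sum => e eE; case: ifP => // /exists_inP [C CP sC].
  by rewrite (bigD1 C) /= ?CP ?leq_addr.
have monoP x y : kf x = kf y -> [set x; y] \in E -> [set x; y] \in mono.
  move=> Ek eE; rewrite inE eE; apply/exists_inP.
  exists [set v in [set: V] | kf x == kf v].
    by apply/imsetP; exists x => //; apply/setP => v; rewrite !inE.
  by apply/subsetP => v; rewrite !inE => /orP[] /eqP ->; rewrite ?Ek ?eqxx.
pose A1 := [set [set r; u] | u in R :&: U].
pose A2 := [set A : {set V} | A \subset R & #|A| == 2].
pose G u := if u \in U :\: R then [set [set u; f] | f in F u] else set0.
pose A3 := \bigcup_u G u.
have inj2 (x y y' : V) : [set x; y] = [set x; y'] -> y != x -> y' != x -> y = y'.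
  move=> Ee Ny Ny'; have : y \in [set x; y'] by rewrite -Ee !inE eqxx orbT.
  by rewrite !inE (negbTE Ny) => /eqP.
have cA1 : \sum_(e in A1) rweight e = #|R :&: U| * c.
  rewrite (eq_bigr (fun=> c)) => [|e /imsetP [u _ ->]]; last by rewrite /rweight !inE eqxx.
  rewrite sum_nat_const card_in_imset // => u u'; rewrite !inE => /andP[_ uU] /andP[_ uU'] Eu.
  by apply: (inj2 _ _ _ Eu); apply: contra rU => /eqP <-.
have cA2 : \sum_(e in A2) rweight e = 'C(c, 2).
  rewrite (eq_bigr (fun=> 1)); first by rewrite sum1_card cards_draws cardR.
  move=> e; rewrite inE => /andP[sR _]; rewrite /rweight ifN //.
  by apply: contra rR; apply/subsetP.
have cA3 : \sum_(e in A3) rweight e = #|U :\: R| * c.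
  rewrite partition_disjoint_bigcup /=; last first.
    move=> u u' Nu; rewrite -setI_eq0 /G.
    case: ifP => uD; last by rewrite set0I.
    case: ifP => uD'; last by rewrite setI0.
    apply/eqP/setP => e; rewrite in_setI in_set0.
    apply/negbTE/negP => /andP[/imsetP [f fF Ee] /imsetP [f' fF' Ee']].
    have : u \in [set u'; f'] by rewrite -Ee' Ee !inE eqxx.
    move: uD uD'; rewrite !inE => /andP[_ uU] /andP[_ uU'].
    rewrite (negbTE Nu) /= => /eqP Eu; rewrite Eu in uU.
    by have [] := FU uU' fF'; rewrite uU.
  rewrite (bigID (mem (U :\: R))) /= [X in _ + X]big1 ?addn0; last first.
    by move=> u /negbTE uD; rewrite /G uD big_set0.
  rewrite (eq_bigr (fun u => \sum_(e in [set [set u; f] | f in F u]) rweight e)); last first.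
    by move=> u uD; rewrite /G uD.
  rewrite -sum_nat_const; apply: eq_bigr => u; rewrite inE => /andP[_ uU].
  rewrite (eq_bigr (fun=> 1)); last first.
    move=> e /imsetP [f /(FU uU) [_ Nf] ->]; rewrite /rweight !inE ifN //.
    by rewrite negb_or ![r == _]eq_sym Nf andbT; apply: contraNneq rU => <-.
  rewrite sum1_card card_in_imset ?cardF // => f f' fF fF' Ef.
  have [Nf _] := FU uU fF; have [Nf' _] := FU uU fF'.
  apply: (inj2 _ _ _ Ef); apply/eqP => Eu; first by rewrite Eu uU in Nf.
  by rewrite Eu uU in Nf'.
have d12 : [disjoint A1 & A2].
  rewrite -setI_eq0; apply/eqP/setP => e; rewrite !inE; apply/negbTE/negP.
  move=> /andP[/imsetP [u _ ->] /andP[/subsetP/(_ r)]]; rewrite !inE eqxx => /(_ isT).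
  by rewrite (negbTE rR).
have d123 : [disjoint A1 :|: A2 & A3].
  rewrite -setI_eq0; apply/eqP/setP => e; rewrite in_setI in_set0; apply/negbTE/negP.
  move=> /andP[eA /bigcupP [u _]]; rewrite /G; case: ifP; last by rewrite in_set0.
  rewrite inE => /andP[NuR uU] /imsetP [f fF Ee].
  have [_ Nf] := FU uU fF; move: eA; rewrite in_setU => /orP[/imsetP [u' _ Ee']|].
    have : r \in [set u; f] by rewrite -Ee Ee' !inE eqxx.
    rewrite !inE ![r == _]eq_sym (negbTE Nf) orbF => /eqP Eu.
    by have := rU; rewrite -Eu uU.
  rewrite inE Ee => /andP[/subsetP/(_ u)]; rewrite !inE eqxx => /(_ isT).
  by rewrite (negbTE NuR).
have sub : A1 :|: A2 :|: A3 \subset mono.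
  apply/subsetP => e; rewrite !in_setU => /orP[/orP[/imsetP [u]|]|/bigcupP [u _]].
  - rewrite inE => /andP[uR uU] ->; apply: monoP; [exact/esym/kR | exact: rE].
  - rewrite inE => /andP[sR /cards2P [x [y [Nxy Ee]]]].
    have [xR yR] : x \in R /\ y \in R.
      by split; apply: (subsetP sR); rewrite Ee !inE eqxx ?orbT.
    by rewrite Ee; apply: monoP; [rewrite !kR | exact: cliqueR].
  - rewrite /G; case: ifP => [uD /imsetP [f fF ->]|]; last by rewrite in_set0.
    apply: monoP; first exact/esym/(kF uD).
    by move: uD; rewrite inE => /andP[_ uU]; exact: FE.
apply: leq_trans (leq_sum_sub _ sub).
rewrite (eq_bigl [predU (A1 :|: A2) & A3]); last by move=> e; rewrite !inE.
rewrite bigU //= (eq_bigl [predU A1 & A2]); last by move=> e; rewrite !inE.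
rewrite bigU //= cA1 cA2 cA3; have := cardsID R U; rewrite setIC => <-.
by rewrite mulnDl; lia.
Qed.

End Coalitions.

(** * The composed instance *)

Lemma card_nth_count (L : Type) (x0 : L) (s : seq L) (p : pred L) :
  #|[set i : 'I_(size s) | p (nth x0 s i)]| = count p s.
Proof. by rewrite -sum1_count (big_nth x0) big_mkord sum1dep_card. Qed.

Lemma count_none (A : eqType) (p : pred A) (s : seq A) :
  (forall x, x \in s -> ~~ p x) -> count p s = 0.
Proof. by move=> H; apply/eqP; rewrite -leqn0 leqNgt -has_count; apply/hasPn. Qed.

Lemma mem_pairs (A B : eqType) (s : seq A) (t : seq B) a b :
  ((a, b) \in [seq (x, y) | x <- s, y <- t]) = (a \in s) && (b \in t).
Proof.
apply/allpairsP/andP => [[[x y] /= [Hx Hy [-> ->]]] //|[Ha Hb]].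
by exists (a, b).
Qed.

Section Instance.
Variables (M : tm) (P3 : nat -> nat).
Local Notation K1 := (tm_tapes M).+1.

Definition compatx (T : nat) (o : opt M) (z : string) : bool :=
  if o.1 is inr b then cellok (P3 (size z)) T z o.2.2.1 b else true.

Definition lab := ((bool * bool) * (opt M * string))%type.
(* The hub, the options, their fillers and the composed strings. *)
Local Notation roleR := (false, false).
Local Notation roleU := (true, false).
Local Notation roleF := (false, true).
Local Notation roleV := (true, true).

(** Every edge has an end of role U: this gives the vertex cover, and it limits a clique to at most
    one composed string. *)
Definition adj (T : nat) (a b : lab) : bool :=
  match a.1, b.1 with
  | roleR, roleU | roleU, roleR => true
  | roleU, roleU => compat T a.2.1 b.2.1
  | roleU, roleF | roleF, roleU => a.2.1 == b.2.1
  | roleU, roleV => compatx T a.2.1 b.2.2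
  | roleV, roleU => compatx T b.2.1 a.2.2
  | _, _ => false
  end.

Lemma adj_sym T a b : adj T a b = adj T b a.
Proof.
by case: a b => [[[] []] [o z]] [[[] []] [o' z']]; rewrite /adj //= 1?compat_sym 1?eq_sym.
Qed.

Lemma adj_irr T a : adj T a a = false.
Proof. by case: a => [[[] []] [o z]]; rewrite /adj //= compat_irr. Qed.

Definition options T : seq (opt M) :=
  [seq (f, x) | f <- enum (otag M),
    x <- [seq (t, y) | t <- iota 0 T.+1,
      y <- [seq (p, l) | p <- iota 0 (2 * T).+1, l <- iota 0 T.+1]]].

(** The clique sought has one option for each time and tape and one for each cell; the successor in
    [cq] accounts for the string. *)
Definition ngroups T := T.+1 * K1 + (2 * T).+1.
Definition cq T := (ngroups T).+1.

Definition opt0 : opt M := (inr None, (0, (0, 0))).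
Definition labR : lab := (roleR, (opt0, [::])).
Definition labU o : lab := (roleU, (o, [::])).
Definition labF o : lab := (roleF, (o, [::])).
Definition labV z : lab := (roleV, (opt0, z)).

(** The fillers of an option share one label. A vertex is a position in the list of labels, so
    repetitions are different vertices. *)
Definition others T (xs : seq string) : seq lab :=
  [seq labU o | o <- options T] ++
  [seq labF o | o <- options T, _ <- iota 0 (cq T)] ++ [seq labV z | z <- xs].
Definition labels T xs := labR :: others T xs.

Lemma options_uniq T : uniq (options T).
Proof.
apply: allpairs_uniq; [exact: enum_uniq | | by move=> [? ?] [? ?] _ _ [-> ->]].
apply: allpairs_uniq; [exact: iota_uniq | | by move=> [? ?] [? ?] _ _ [-> ->]].
apply: allpairs_uniq; [exact: iota_uniq | exact: iota_uniq |].
by move=> [? ?] [? ?] _ _ [-> ->].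
Qed.

Lemma mem_options T (o : opt M) :
  (o \in options T) = [&& o.2.1 <= T, o.2.2.1 <= 2 * T & o.2.2.2 <= T].
Proof.
case: o => f [t [p l]]; rewrite /options !mem_pairs mem_enum !mem_iota.
by rewrite !add0n !ltnS.
Qed.

Lemma size_options T : size (options T) = #|otag M| * (T.+1 * ((2 * T).+1 * T.+1)).
Proof. by rewrite !size_allpairs !size_iota -cardE. Qed.

Section Fixed.
Variables (T : nat) (xs : seq string).
Local Notation n := (size (others T xs)).+1.

Definition lb (i : 'I_n) : lab := nth labR (labels T xs) i.

Definition edges : {set {set 'I_n}} :=
  [set e | [exists i, exists j, (e == [set i; j]) && adj T (lb i) (lb j)]].

Lemma edgesP e : reflect (exists i j, e = [set i; j] /\ adj T (lb i) (lb j)) (e \in edges).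
Proof.
rewrite inE; apply: (iffP existsP) => [[i /existsP [j /andP[/eqP -> H]]]|[i [j [-> H]]]].
  by exists i, j.
by exists i; apply/existsP; exists j; rewrite eqxx H.
Qed.

Lemma adj_neq i j : adj T (lb i) (lb j) -> i != j.
Proof. by apply: contraTneq => ->; rewrite adj_irr. Qed.

Lemma edges2 e : e \in edges -> #|e| = 2.
Proof. by move=> /edgesP [i [j [-> /adj_neq Nij]]]; rewrite cards2 Nij. Qed.

Lemma mem_edges i j : ([set i; j] \in edges) = adj T (lb i) (lb j).
Proof.
apply/edgesP/idP => [[i' [j' [Ee H]]]|H]; last by exists i, j.
have Nij := adj_neq H.
have : i \in [set i'; j'] by rewrite -Ee !inE eqxx.
have : j \in [set i'; j'] by rewrite -Ee !inE eqxx orbT.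
have : i' \in [set i; j] by rewrite Ee !inE eqxx.
have : j' \in [set i; j] by rewrite Ee !inE eqxx orbT.
rewrite !inE => /orP[] /eqP E1 /orP[] /eqP E2; rewrite -?E1 -?E2.
- by rewrite E1 E2 eqxx in Nij.
- by move=> _ _; rewrite adj_sym.
- by [].
- by rewrite E1 E2 eqxx in Nij.
Qed.

Definition target := size (options T) * cq T + 'C(cq T, 2).

Definition instance : wccf :=
  @WCCF n edges edges2 (fun e => rweight ord0 (cq T) (val e)) (cq T).+1 target.

Lemma lb0 : lb ord0 = labR.
Proof. by []. Qed.

Lemma lb_mem i : i != ord0 -> lb i \in others T xs.
Proof.
case: i => -[|i] lt_i //= _; rewrite /lb /=; apply: mem_nth.
by rewrite ltnS in lt_i.
Qed.

Lemma mem_others a : a \in others T xs ->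
  [\/ exists2 o, o \in options T & a = labU o,
      exists2 o, o \in options T & a = labF o |
      exists2 z, z \in xs & a = labV z].
Proof.
rewrite !mem_cat => /or3P[/mapP [o Ho ->]|/allpairsP [[o i] /= [Ho _ ->]]|/mapP [z Hz ->]].
- by constructor 1; exists o.
- by constructor 2; exists o.
- by constructor 3; exists z.
Qed.

Definition Uset : {set 'I_n} := [set i | (lb i).1 == roleU].

Lemma card_Uset : #|Uset| = size (options T).
Proof.
rewrite (card_nth_count labR (labels T xs) (fun a => a.1 == roleU)) /= add0n !count_cat.
rewrite count_map (eq_count (a2 := predT)) // count_predT.
rewrite (eq_in_count (a2 := pred0)); last by move=> a /allpairsP [p [_ _ ->]].
by rewrite count_pred0 count_map (eq_count (a2 := pred0)) // count_pred0 !addn0.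
Qed.

Lemma edge_Uset e : e \in edges -> exists2 u, u \in Uset & u \in e.
Proof.
move=> /edgesP [i [j [-> H]]].
have : (i \in Uset) || (j \in Uset).
  move: H; rewrite !inE /adj; case: (lb i) => [[[] []] ?]; case: (lb j) => [[[] []] ?] //.
by case/orP=> HU; [exists i | exists j]; rewrite // !inE eqxx ?orbT.
Qed.

Lemma ord0_Uset : ord0 \notin Uset.
Proof. by rewrite inE. Qed.

Lemma vc_edges : vc_number edges <= size (options T).
Proof.
have cov : vertex_cover edges Uset.
  apply/forall_inP => e /edge_Uset [u uU ue]; apply/set0Pn; exists u.
  by rewrite inE uU.
rewrite -card_Uset /vc_number; case: arg_minnP => [|S _ minS]; last exact: minS.
apply/forall_inP => e /edge_Uset [u _ ue]; apply/set0Pn; exists u.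
by rewrite !inE.
Qed.

Definition group : finType := option ('I_T.+1 * 'I_K1 + 'I_(2 * T).+1).

Lemma card_group : #|group| = cq T.
Proof. by rewrite card_option card_sum card_prod !card_ord. Qed.

Definition grp (a : lab) : group :=
  if a.1 == roleU then
    match a.2.1.1 with
    | inl (k, _) => Some (inl (inord a.2.1.2.1, k))
    | inr _ => Some (inr (inord a.2.1.2.2.1))
    end
  else None.

(** A clique with more than two vertices contains no filler: all neighbours of a filler carry its
    own option, and an option is incompatible with itself. *)
Lemma yes_clique : wccf_yes instance ->
  exists R : {set 'I_n}, [/\ #|R| = cq T,
    forall x, x \in R -> (exists2 o, o \in options T & lb x = labU o) \/
                         (exists2 z, z \in xs & lb x = labV z) &
    forall x y, x \in R -> y \in R -> x != y -> adj T (lb x) (lb y)].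
Proof.
have Et : wccf_target instance = #|Uset| * cq T + 'C(cq T, 2) by rewrite card_Uset.
case=> P [capP]; rewrite Et (@partition_valueE _ _ ord0 (cq T)) // => Hv.
have c_ge2 : 2 < cq T by rewrite /cq /ngroups; lia.
have [R [rR cR clR]] :=
  value_clique edges2 edge_Uset ord0_Uset (ltnW c_ge2) capP Hv.
exists R; split=> //; last by move=> x y xR yR Nxy; rewrite -mem_edges; exact: clR.
move=> x xR; have Nx : x != ord0 by apply: contraNneq rR => <-.
have [H|[o Ho Ex]|H] := mem_others (lb_mem Nx); [by left | exfalso | by right].
have : 1 < #|R :\ x| by have := cardsD1 x R; rewrite xR cR; lia.
move=> /card_gt1P [y [y' []]]; rewrite !inE => /andP[Ny yR] /andP[Ny' yR'] Nyy.
have adjx v : v \in R -> v != x -> adj T (lb x) (lb v).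
  by move=> vR Nv; rewrite -mem_edges; apply: clR => //; rewrite eq_sym.
have roleo v : adj T (lb x) (lb v) -> (lb v).1 = roleU /\ (lb v).2.1 = o.
  by rewrite Ex /adj /=; case: (lb v) => [[[] []] [o' z]] //= /eqP ->.
have [E1 E1'] := roleo _ (adjx y yR Ny).
have [E2 E2'] := roleo _ (adjx y' yR' Ny').
have := clR y y' yR yR' Nyy; rewrite mem_edges /adj E1 E2 E1' E2'.
by rewrite compat_irr.
Qed.

Variable chi : string -> bool.
Hypothesis T_large : forall z, z \in xs -> size (delimit z) + P3 (size z) <= T.
Hypothesis M_chi : forall z, z \in xs -> forall y, size y <= P3 (size z) ->
  exists2 m, m <= T & tm_computes_within M m (spair z y) [:: chi (spair z y)].

(** The defaults here and in [ext_cell] are never met, because the group of an option determines its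
    kind. *)
Definition ext_loc (o : opt M) : loc M * (nat * nat) :=
  (if o.1 is inl (_, a) then a else (tm_start M, [ffun=> None]), o.2.2).
Definition ext_cell (o : opt M) : option bool := if o.1 is inr b then b else None.

(** Two vertices of the clique cannot lie in the same group, and there are as many groups as
    vertices in it; so the clique selects exactly one vertex per group. The group [None] selects the
    string, the others a good family for it. *)
Lemma instance_sound : wccf_yes instance ->
  exists2 z, z \in xs & exists2 y, size y <= P3 (size z) & chi (spair z y).
Proof.
move=> /yes_clique [R [cR roleR_ clR]].
have ginj : {in R &, injective (fun x => grp (lb x))}.
  move=> x y xR yR /= Eg; apply/eqP/negPn/negP => Nxy.
  have := clR x y xR yR Nxy; move: Eg.
  have [[o Ho ->]|[z _ ->]] := roleR_ x xR; have [[o' Ho' ->]|[z' _ ->]] := roleR_ y yR => //=.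
    rewrite /adj /grp /compat /=; move: Ho Ho'; rewrite !mem_options.
    case: o o' => [f [t [p l]]] [f' [t' [p' l']]] /= /and3P[lt1 lp1 _] /and3P[lt2 lp2 _].
    case: f f' => [[k a]|b] [[k' a']|b'] //= [].
      by move=> /(congr1 val) /=; rewrite !inordK // => -> ->; rewrite !eqxx.
    by move=> /(congr1 val) /=; rewrite !inordK // => ->; rewrite eqxx.
  - by rewrite /grp /=; case: o.1 => [[? ?]|?].
  - by rewrite /grp /=; case: o'.1 => [[? ?]|?].
have gsur g : exists2 x, x \in R & grp (lb x) = g.
  have : g \in [set grp (lb x) | x in R].
    rewrite (_ : [set grp (lb x) | x in R] = setT) ?inE //.
    apply/eqP; rewrite eqEcard subsetT cardsT card_in_imset; last exact: ginj.
    by rewrite cR card_group leqnn.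
  by case/imsetP=> x xR ->; exists x.
pose sel g : 'I_n := odflt ord0 [pick x in R | grp (lb x) == g].
have selP g : sel g \in R /\ grp (lb (sel g)) = g.
  rewrite /sel; case: pickP => [x /andP[xR /eqP Eg]|H] //=.
  by have [x xR /eqP Eg] := gsur g; have := H x; rewrite xR Eg.
have selN g g' : g != g' -> adj T (lb (sel g)) (lb (sel g')).
  move=> Ng; have [gR Eg] := selP g; have [gR' Eg'] := selP g'.
  by apply: clR => //; apply: contraNneq Ng => E; rewrite -Eg E Eg'.
have [z zxs Ez] : exists2 z, z \in xs & lb (sel None) = labV z.
  have [gR Eg] := selP None; have [[o _ Eo]|//] := roleR_ _ gR.
  by move: Eg; rewrite Eo /grp /=; case: o.1 => [[? ?]|?].
pose ou g := (lb (sel g)).2.1.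
have selU g : g != None -> lb (sel g) = labU (ou g) /\ ou g \in options T.
  move=> Ng; have [gR Eg] := selP g; rewrite /ou.
  have [[o Ho Eo]|[z' _ Eo]] := roleR_ _ gR; first by rewrite Eo.
  by rewrite -Eg Eo in Ng.
have ouN g g' : g != None -> g' != None -> g != g' -> compat T (ou g) (ou g').
  move=> Ng Ng' Ngg; have := selN _ _ Ngg.
  by have [-> _] := selU _ Ng; have [-> _] := selU _ Ng'.
pose gS (t : nat) (k : 'I_K1) : group := Some (inl (inord t, k)).
pose gC (p : nat) : group := Some (inr (inord p)).
pose S t k := ext_loc (ou (gS t k)).
pose c p := ext_cell (ou (gC p)).
have eS t k : t <= T -> optS S t k = ou (gS t k).
  move=> le_t; have [_ Eg] := selP (gS t k); have [El] := selU (gS t k) isT.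
  rewrite mem_options => /andP[le_o _]; move: Eg; rewrite El /grp /= /optS /S /ext_loc.
  case: (ou (gS t k)) le_o => [[[k' a]|b] [t' [p l]]] //= le_o [].
  by move=> /(congr1 val) /=; rewrite !inordK // => -> ->.
have eC p : p <= 2 * T -> optC M c p = ou (gC p).
  move=> le_p; have [_ Eg] := selP (gC p); have [El] := selU (gC p) isT.
  rewrite mem_options => /and3P[_ le_o _]; move: Eg; rewrite El /grp /= /optC /c /ext_cell.
  (* Compatibility with any other option includes validity, and for a cell this fixes both time
     components to 0. *)
  have : compat T (ou (gC p)) (ou (gS 0 ord0)) by apply: ouN.
  case: (ou (gC p)) le_o => [[[k' a]|b] [t' [p' l]]] //= le_o /and3P[_ /= /andP[/eqP -> /eqP ->] _] [].
  by move=> /(congr1 val) /=; rewrite !inordK // => ->.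
have inordN m i j : i <= m -> j <= m -> i <> j -> (inord i : 'I_m.+1) != inord j.
  by move=> le_i le_j Nij; apply/eqP => /(congr1 val) /=; rewrite !inordK.
exists z => //; apply: (@family_witness M (P3 (size z)) T z chi _ _ S c).
- exact: T_large.
- exact: M_chi.
split.
- move=> t t' k k' le_t le_t' Ne; rewrite !eS //; apply: ouN => //.
  apply/eqP => -[]; have [E|N] := eqVneq t t'.
    by move=> _ Ek; apply: Ne; rewrite E Ek.
  by move/eqP; rewrite (negbTE (inordN _ _ _ le_t le_t' (elimN eqP N))).
- by move=> t k p le_t le_p; rewrite eS // eC //; apply: ouN.
- move=> p p' le_p le_p' Ne; rewrite !eC //; apply: ouN => //.
  apply/eqP => -[] /eqP; rewrite (negbTE (inordN _ _ _ le_p le_p' Ne)).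
  by [].
- move=> p le_p; have := selN (gC p) None isT; have [-> _] := selU (gC p) isT.
  by rewrite Ez /adj /= -eC.
Qed.
Lemma count_labF o (s : seq (opt M)) m :
  count (pred1 (labF o)) [seq labF o' | o' <- s, _ <- iota 0 m] = m * count_mem o s.
Proof.
elim: s => [|a s IHs]; first by rewrite muln0.
have -> : [seq labF o' | o' <- a :: s, _ <- iota 0 m] =
  [seq labF a | _ <- iota 0 m] ++ [seq labF o' | o' <- s, _ <- iota 0 m] by [].
rewrite count_cat IHs [count_mem o (_ :: _)]/= mulnDr count_map; congr addn.
have [->|Na] := eqVneq a o.
  by rewrite (eq_count (a2 := predT)) ?count_predT ?size_iota ?muln1 // => i; rewrite /= eqxx.
rewrite (eq_count (a2 := pred0)) ?count_pred0 ?muln0 // => i /=.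
by apply/negbTE; apply: contra Na => /eqP[->].
Qed.

Lemma card_labF o : #|[set i | lb i == labF o]| = cq T * count_mem o (options T).
Proof.
rewrite (card_nth_count labR (labels T xs) (pred1 (labF o))) /= add0n !count_cat count_labF.
rewrite [X in X + _]count_none; last by move=> a /mapP [? _ ->].
rewrite [X in _ + (_ + X)]count_none; last by move=> a /mapP [? _ ->].
by rewrite addn0.
Qed.

Lemma card_labU o : #|[set i | lb i == labU o]| <= 1.
Proof.
rewrite (card_nth_count labR (labels T xs) (pred1 (labU o))) /= add0n !count_cat.
rewrite [X in _ + (X + _)]count_none; last by move=> a /allpairsP [p [_ _ ->]].
rewrite [X in _ + (_ + X)]count_none; last by move=> a /mapP [? _ ->].
rewrite !addn0 count_map (eq_count (a2 := pred1 o)).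
  by rewrite (count_uniq_mem _ (options_uniq T)) leq_b1.
by move=> a /=; apply/eqP/eqP => [[->]|->].
Qed.

Lemma instance_complete z y : z \in xs -> size y <= P3 (size z) -> chi (spair z y) ->
  wccf_yes instance.
Proof.
move=> zxs le_y Hchi.
have [S [c0 [[HSS HSC HCC Hcell] rng]]] :=
  witness_family (T_large zxs) (M_chi zxs) le_y Hchi.
pose label (g : group) : lab := match g with
  | None => labV z
  | Some (inl (t, k)) => labU (optS S t k)
  | Some (inr p) => labU (optC M c0 p) end.
have label_mem g : label g \in labels T xs.
  rewrite inE /others !mem_cat; apply/orP; right.
  case: g => [[[t k]|p]|] /=; last by apply/or3P; constructor 3; apply: map_f.
    apply/or3P; constructor 1; apply: map_f; rewrite mem_options /=.
    have le_t : t <= T by rewrite -ltnS.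
    by have [-> ->] := rng t k le_t; rewrite le_t.
  by apply/or3P; constructor 1; apply: map_f; rewrite mem_options /= -ltnS ltn_ord.
pose h g : 'I_n := inord (index (label g) (labels T xs)).
have lbh g : lb (h g) = label g.
  by rewrite /lb /h inordK ?nth_index // index_mem.
have labN g g' : g != g' -> adj T (label g) (label g').
  have leT (t : 'I_T.+1) : t <= T by rewrite -ltnS.
  have leP (p : 'I_(2 * T).+1) : p <= 2 * T by rewrite -ltnS.
  case: g g' => [[[t k]|p]|] [[[t' k']|p']|] //= Ng; rewrite /adj /=.
  - apply: HSS => // -[Et Ek]; case/eqP: Ng; rewrite Ek.
    by have -> : t = t' by apply: val_inj.
  - exact: HSC.
  - by rewrite compat_sym; exact: HSC.
  - by apply: HCC => // Ep; case/eqP: Ng; have -> : p = p' by apply: val_inj.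
  - exact: Hcell (leP _).
  - exact: Hcell (leP _).
have hinj : injective h.
  move=> g g' Eh; apply/eqP/negPn/negP => /labN.
  by rewrite -!lbh Eh adj_irr.
pose R := [set h g | g : group].
have cR : #|R| = cq T by rewrite card_imset // card_group.
have rR : ord0 \notin R.
  apply/negP => /imsetP [g _ E]; have := lbh g; rewrite -E lb0.
  by case: g {E} => [[[t k]|p]|].
(* The blocks: the hub with the clique; every other option with its fillers; the fillers alone of an
   option in the clique; every other string on its own. *)
pose kf i : option (opt M + 'I_n) :=
  if (i == ord0) || (i \in R) then None
  else if ((lb i).1 == roleU) || ((lb i).1 == roleF) then Some (inl (lb i).2.1)
  else Some (inr i).
pose F (u : 'I_n) := [set i | lb i == labF (lb u).2.1].
have Ulab u : u \in Uset -> exists2 o, o \in options T & lb u = labU o.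
  move=> uU; have Nu : u != ord0 by apply: contraTneq uU => ->; exact: ord0_Uset.
  have := mem_others (lb_mem Nu); move: uU; rewrite inE => /eqP Er [] // [w _ Ew];
  by rewrite Ew in Er.
have FU u f : u \in Uset -> f \in F u -> f \notin Uset /\ f != ord0.
  move=> _; rewrite !inE => /eqP Ef; rewrite Ef; split=> //.
  by apply: contra_eqN Ef => /eqP ->.
have kcap x : #|[set y | kf y == kf x]| <= (cq T).+1.
  case Ek: (kf x) => [[o|i]|].
  - apply: (@leq_trans #|[set i | lb i == labU o] :|: [set i | lb i == labF o]|).
      apply/subset_leq_card/subsetP => v; rewrite !inE /kf.
      case: ifP => //= /norP [Nv _]; case: ifP => [Hr /eqP[Eo]|//].
      have [[o' _ Ev]|[o' _ Ev]|[z' _ Ev]] := mem_others (lb_mem Nv); move: Hr Eo;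
        by rewrite Ev //= => _ ->; rewrite eqxx ?orbT.
    apply: leq_trans (leq_card_setU _ _) _; rewrite -[leqRHS]add1n.
    apply: leq_add; first exact: card_labU.
    rewrite card_labF (count_uniq_mem _ (options_uniq T)).
    by case: (_ \in _); rewrite ?muln1 ?muln0.
  - apply: (@leq_trans #|[set i]|); last by rewrite cards1.
    apply/subset_leq_card/subsetP => v; rewrite !inE /kf.
    by case: ifP => //; case: ifP => // _ _ /eqP[->].
  - apply: (@leq_trans #|ord0 |: R|); last by rewrite cardsU1 rR cR.
    apply/subset_leq_card/subsetP => v; rewrite in_setU1 inE /kf.
    by case: ifP => //; case: ifP.
exists (preim_partition kf [set: 'I_n]); split.
  exact: key_partition.
have -> : wccf_target instance = #|Uset| * cq T + 'C(cq T, 2) by rewrite card_Uset.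
rewrite (@partition_valueE _ _ ord0 (cq T)) //.
apply: (@key_value _ _ _ _ _ ord0_Uset _ kf R F) => //.
- move=> _ _ /imsetP [g _ ->] /imsetP [g' _ ->] Ng; rewrite mem_edges !lbh.
  by apply: labN; apply: contraNneq Ng => ->.
- move=> u uU; have [o _ Eo] := Ulab u uU; rewrite mem_edges lb0 Eo.
  by [].
- move=> u f uU; rewrite inE => /eqP Ef; have [o _ Eo] := Ulab u uU.
  by rewrite mem_edges Ef Eo /adj /= eqxx.
- move=> u uU; have [o Ho Eo] := Ulab u uU; rewrite card_labF Eo /=.
  by rewrite (count_uniq_mem _ (options_uniq T)) Ho muln1.
- by move=> x xR; rewrite /kf xR orbT eqxx.
- move=> u f; rewrite inE => /andP[NuR uU] fF; have [NfU Nf0] := FU u f uU fF.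
  have [o _ Eo] := Ulab u uU; move: fF; rewrite inE => /eqP Ef.
  have Nu0 : u != ord0 by apply: contraTneq uU => ->; exact: ord0_Uset.
  have NfR : f \notin R.
    apply/negP => /imsetP [g _ E]; have := lbh g; rewrite -E Ef.
    by case: g {E} => [[[t k]|p]|].
  by rewrite /kf (negbTE NuR) (negbTE Nu0) (negbTE NfR) (negbTE Nf0) Ef Eo.
Qed.

End Fixed.
End Instance.

(** * Polynomial-time construction of the instance *)

Ltac pt1 := cbv beta; first [ eassumption | lazymatch goal with
 | |- PT _ _ (fun e => e) => apply: pt_id
 | |- PT _ _ (fun _ => ?c) => apply: pt_const
 | |- PT _ _ (fun e => @?f e && @?g e) => apply: (@pt_andb _ _ f g)
 | |- PT _ _ (fun e => @?f e || @?g e) => apply: (@pt_orb _ _ f g)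
 | |- PT _ _ (fun e => @?f e ==> @?g e) => apply: (@pt_implyb _ _ f g)
 | |- PT _ _ (fun e => ~~ @?f e) => apply: (@pt_negb _ _ f)
 | |- PT _ _ (fun e => @?f e == @?g e) =>
     first [ apply: (@pt_eqn _ _ f g) | apply: (@pt_eqb _ _ f g)
           | apply: (@pt_eqstr _ _ f g) ]
 | |- PT _ _ (fun e => @?f e <= @?g e) => apply: (@pt_leq _ _ f g)
 | |- PT _ _ (fun e => (@?f e).+1) => apply: (@pt_succ _ _ f)
 | |- PT _ _ (fun e => (@?f e).-1) => apply: (@pt_pred _ _ f)
 | |- PT _ _ (fun e => (@?f e)./2) => apply: (@pt_half _ _ f)
 | |- PT _ _ (fun e => @?f e + @?g e) => apply: (@pt_addn _ _ f g)
 | |- PT _ _ (fun e => @?f e - @?g e) => apply: (@pt_subn _ _ f g)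
 | |- PT _ _ (fun e => @?f e * @?g e) => apply: (@pt_muln _ _ f g)
 | |- PT _ _ (fun e => nth false (@?f e) (@?g e)) => apply: (@pt_nth _ _ g f)
 | |- PT _ _ (fun e => delimit (@?f e)) => apply: (@pt_delimit _ _ f)
 | |- PT _ _ (fun e => bits (@?f e)) => apply: (@pt_bits _ _ f)
 | |- PT _ _ (fun e => (und (@?f e)).1) => apply: (@pt_und1 _ _ f)
 | |- PT _ _ (fun e => (und (@?f e)).2) => apply: (@pt_und2 _ _ f)
 | |- PT _ _ (fun e => (@?f e).1) => apply: (@pt_fst _ _ _ _ _ _ f)
 | |- PT _ _ (fun e => (@?f e).2) => apply: (@pt_snd _ _ _ _ _ _ f)
 | |- PT _ _ (@fst _ _) => apply: (pt_fst (pt_id _))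
 | |- PT _ _ (@snd _ _) => apply: (pt_snd (pt_id _))
 | |- PT _ _ (fun e => (@?f e, @?g e)) => apply: (@pt_pair _ _ _ _ _ _ f g)
 | |- PT _ enc_nat (fun e => size (@?f e)) => apply: (@pt_rsize _ _ f)
 end ].
Ltac pt := repeat pt1.

Lemma flatten_flatten (A : Type) (s : seq (seq (seq A))) :
  flatten (flatten s) = flatten [seq flatten x | x <- s].
Proof. by elim: s => //= x s IHs; rewrite flatten_cat IHs. Qed.

Lemma pt_pairs E A B (eE : E -> string) (eA : A -> string) (eB : B -> string)
    (s : E -> seq A) (t : E -> seq B) : PT eE (enc_seq eA) s -> PT eE (enc_seq eB) t ->
  PT eE (enc_seq (eA ** eB)) (fun e => [seq (x, y) | x <- s e, y <- t e]).
Proof.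
move=> Hs Ht; apply: (pt_flatmap (g := fun e x => [seq (x, y) | y <- t e]) Hs).
apply: (pt_map (g := fun (e : E * A) y => (e.2, y)) (l := fun e => t e.1)); last by pt.
exact: pt_comp Ht (pt_fst (pt_id _)).
Qed.

Section Encoding.
Variables (M : tm) (P3 : nat -> nat).

Definition ent T (a b : lab M) : string :=
  if adj P3 T a b then
    true :: delimit (bits (if (a.1 == (false, false)) || (b.1 == (false, false))
                           then cq M T else 1))
  else [:: false].

(** The hub is the only vertex of its role, so edge weights can be read off the labels and the
    matrix is a double loop over the list of labels. *)
Lemma enc_entryE T xs (i j : 'I_(size (others M T xs)).+1) :
  @enc_entry (instance M P3 T xs) i j = ent T (lb i) (lb j).
Proof.
have role0 v : ((lb v).1 == (false, false)) = (v == ord0 :> 'I_(size (others M T xs)).+1).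
  have [->|Nv] := eqVneq v ord0; first by [].
  by have [[? _ ->]|[? _ ->]|[? _ ->]] := mem_others (lb_mem Nv).
rewrite /enc_entry /ent /=; case: insubP => [e eE Ee|].
  rewrite mem_edges in eE; rewrite eE; congr (true :: delimit (bits _)).
  rewrite /rweight /= in Ee *; rewrite Ee !inE !role0 ![ord0 == _]eq_sym.
  by [].
by rewrite mem_edges => /negbTE ->.
Qed.

Lemma wccf_enc_instance T xs : wccf_enc (instance M P3 T xs) =
  delimit (bits (size (labels M T xs))) ++ delimit (bits (cq M T).+1) ++
  delimit (bits (target M T)) ++
  flatten [seq flatten [seq ent T a b | b <- labels M T xs] | a <- labels M T xs].
Proof.
rewrite /wccf_enc; congr (_ ++ (_ ++ (_ ++ _))).
have Elb : [seq lb i | i <- enum 'I_(size (others M T xs)).+1] = labels M T xs.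
  rewrite -[RHS](mkseq_nth (labR M)) /mkseq.
  by rewrite -[iota 0 _]/(iota 0 (size (others M T xs)).+1) -val_enum_ord -map_comp.
rewrite flatten_flatten -map_comp; congr flatten.
rewrite -[in RHS]Elb -map_comp; apply: eq_map => i /=; congr flatten.
by rewrite -map_comp; apply: eq_map => j; exact: enc_entryE.
Qed.

Local Notation enc_opt := (@enc_fin (otag M) ** (enc_nat ** (enc_nat ** enc_nat))).
Local Notation enc_lab := (@enc_fin (bool * bool)%type ** (enc_opt ** enc_raw)).
Local Notation oz := (enc_opt ** enc_raw).
Local Notation n3 := (enc_nat ** (enc_nat ** enc_nat)).

Lemma pt_valid u : PT (enc_nat ** n3) enc_bool (fun e => @valid_tag M u e.1 e.2).
Proof. by case: u => [[k a]|b] /=; pt. Qed.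

Lemma pt_mvok E (eE : E -> string) m (f g : E -> nat) : PT eE enc_nat f -> PT eE enc_nat g ->
  PT eE enc_bool (fun e => mvok m (f e) (g e)).
Proof. by case: m => Hf Hg; rewrite /mvok; pt. Qed.

Lemma pt_cmp u u' : PT (enc_nat ** (n3 ** n3)) enc_bool
  (fun e => @cmp_tag M u u' e.1 e.2.1 e.2.2).
Proof. by case: u u' => [[k a]|b] [[k' a']|b'] /=; pt; apply: pt_mvok; pt. Qed.

Lemma pt_diff u u' : PT (n3 ** n3) enc_bool (fun e => @diff_tag M u u' e.1 e.2).
Proof. by case: u u' => [[k a]|b] [[k' a']|b'] /=; pt. Qed.

(** For fixed tags only comparisons of numbers remain; the tags range over a finite type, so
    [pt_fin] combines the cases. *)
Lemma pt_compat E (eE : E -> string) (T : E -> nat) (o o' : E -> opt M) :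
  PT eE enc_nat T -> PT eE enc_opt o -> PT eE enc_opt o' ->
  PT eE enc_bool (fun e => compat (T e) (o e) (o' e)).
Proof.
move=> HT Ho Ho'.
have H u u' : PT (enc_nat ** (n3 ** n3)) enc_bool (fun e =>
    @compat M e.1 (u, e.2.1) (u', e.2.2)).
  rewrite /compat /=.
  have p1 := pt_comp (pt_diff u u') (pt_snd (pt_id (enc_nat ** (n3 ** n3)))).
  have p2 : PT (enc_nat ** (n3 ** n3)) enc_bool (fun e => valid_tag u e.1 e.2.1).
    by apply: (pt_comp (f := fun e : nat * ((nat * (nat * nat)) * (nat * (nat * nat))) =>
      (e.1, e.2.1)) (pt_valid u)); pt.
  have p3 : PT (enc_nat ** (n3 ** n3)) enc_bool (fun e => valid_tag u' e.1 e.2.2).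
    by apply: (pt_comp (f := fun e : nat * ((nat * (nat * nat)) * (nat * (nat * nat))) =>
      (e.1, e.2.2)) (pt_valid u')); pt.
  have p4 := pt_cmp u u'.
  have p5 : PT (enc_nat ** (n3 ** n3)) enc_bool (fun e => @cmp_tag M u' u e.1 e.2.2 e.2.1).
    by apply: (pt_comp (f := fun e : nat * ((nat * (nat * nat)) * (nat * (nat * nat))) =>
      (e.1, (e.2.2, e.2.1))) (pt_cmp u' u)); pt.
  by do 4 (apply: pt_andb => //).
have Hx : PT eE (enc_nat ** (n3 ** n3)) (fun e => (T e, ((o e).2, (o' e).2))) by pt.
apply: pt_ext (@pt_fin _ _ _ _ _ _ _ (fun e => (o e).1)
  (fun e => ((o' e).1, (T e, ((o e).2, (o' e).2))))
  (fun u x => compat x.2.1 (u, x.2.2.1) (x.1, x.2.2.2)) (pt_fst Ho)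
  (pt_pair (pt_fst Ho') Hx) _).
  by move=> e; rewrite -!surjective_pairing.
move=> u; apply: (@pt_fin _ _ _ _ _ _ _ (fun x => x.1) (fun x => x.2)
  (fun u' x => compat x.1 (u, x.2.1) (u', x.2.2))); [by pt | by pt | exact: H].
Qed.

Hypothesis HP3 : pol P3.

Lemma pt_cellok b E (eE : E -> string) (T p : E -> nat) (z : E -> string) :
  PT eE enc_nat T -> PT eE enc_raw z -> PT eE enc_nat p ->
  PT eE enc_bool (fun e => cellok (P3 (size (z e))) (T e) (z e) (p e) b).
Proof.
move=> HT Hz Hp; rewrite /cellok.
have HB : PT eE enc_nat (fun e => P3 (size (z e))) by apply: pt_pol => //; pt.
apply: pt_if; [by pt | by pt | apply: pt_if; [by pt | | by pt]].
apply: (@pt_ext _ _ _ _ (fun e => if b is Some b'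
  then b' == nth false (delimit (z e)) (p e - T e) else false)); first by case: b.
by case: b => [b|]; pt.
Qed.

Lemma pt_compatx E (eE : E -> string) (T : E -> nat) (o : E -> opt M) (z : E -> string) :
  PT eE enc_nat T -> PT eE enc_opt o -> PT eE enc_raw z ->
  PT eE enc_bool (fun e => compatx P3 (T e) (o e) (z e)).
Proof.
move=> HT Ho Hz.
apply: pt_ext (@pt_fin _ _ _ _ (enc_nat ** (n3 ** enc_raw)) _ _ (fun e => (o e).1)
  (fun e => (T e, ((o e).2, z e)))
  (fun u x => compatx P3 x.1 (u, x.2.1) x.2.2) (pt_fst Ho) _ _).
- by move=> e; rewrite -!surjective_pairing.
- by pt.
- by case=> [ka|b]; rewrite /compatx /=; [pt |
    apply: (@pt_cellok b _ _ (fun x => x.1) (fun x => x.2.1.2.1) (fun x => x.2.2)); pt].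
Qed.

Lemma enc_opt_inj : injective enc_opt.
Proof.
apply: enc_prod_inj; first exact: enc_fin_inj.
by apply: enc_prod_inj; [|apply: enc_prod_inj]; exact: enc_nat_inj.
Qed.

Lemma pt_adj E (eE : E -> string) (T : E -> nat) (a b : E -> lab M) :
  PT eE enc_nat T -> PT eE enc_lab a -> PT eE enc_lab b ->
  PT eE enc_bool (fun e => adj P3 (T e) (a e) (b e)).
Proof.
move=> HT Ha Hb.
have H r r' : PT (enc_nat ** (oz ** oz)) enc_bool (fun x =>
    adj P3 x.1 (r, x.2.1) (r', x.2.2)).
  case: r r' => [[] []] [[] []]; rewrite /adj /=; try exact: pt_const.
  - by apply: pt_compatx; pt.
  - by apply: pt_compatx; pt.
  - by apply: pt_compat; pt.
  - by apply: pt_eq; [exact: enc_opt_inj | |]; pt.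
  - by apply: pt_eq; [exact: enc_opt_inj | |]; pt.
apply: pt_ext (@pt_fin _ _ _ _ (enc_fin (T := _) ** (enc_nat ** (oz ** oz))) _ _
  (fun e => (a e).1) (fun e => ((b e).1, (T e, ((a e).2, (b e).2))))
  (fun r x => adj P3 x.2.1 (r, x.2.2.1) (x.1, x.2.2.2)) (pt_fst Ha) _ _).
- by move=> e; rewrite -!surjective_pairing.
- by pt.
move=> r; apply: (@pt_fin _ _ _ _ _ _ _ (fun x => x.1) (fun x => x.2)
  (fun r' x => adj P3 x.1 (r, x.2.1) (r', x.2.2))); [by pt | by pt | exact: H].
Qed.

Lemma pt_cq E (eE : E -> string) (T : E -> nat) :
  PT eE enc_nat T -> PT eE enc_nat (fun e => cq M (T e)).
Proof. by move=> HT; rewrite /cq /ngroups; pt. Qed.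

Lemma pt_options E (eE : E -> string) (T : E -> nat) :
  PT eE enc_nat T -> PT eE (enc_seq enc_opt) (fun e => options M (T e)).
Proof.
move=> HT.
apply: pt_pairs; first exact: pt_const.
apply: pt_pairs; first by apply: pt_iota; pt.
by apply: pt_pairs; apply: pt_iota; pt.
Qed.

Lemma pt_labels E (eE : E -> string) (T : E -> nat) (xs : E -> seq string) :
  PT eE enc_nat T -> PT eE (enc_seq enc_raw) xs ->
  PT eE (enc_seq enc_lab) (fun e => labels M (T e) (xs e)).
Proof.
move=> HT Hxs; have HO := pt_options HT; have Hc := pt_cq HT.
rewrite /labels /others; apply: pt_cons; first by pt.
apply: pt_scat; last apply: pt_scat.
- by apply: (pt_map (g := fun _ o => labU o) HO); rewrite /labU; pt.
- apply: (pt_flatmap (g := fun e o => [seq labF o | _ <- iota 0 (cq M (T e))]) HO).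
  apply: (pt_map (eA := enc_nat) (g := fun (e : E * opt M) _ => labF e.2)
     (l := fun e => iota 0 (cq M (T e.1)))).
    by apply: pt_iota; exact: pt_comp Hc (pt_fst (pt_id _)).
  by rewrite /labF; pt.
- by apply: (pt_map (g := fun _ z => labV M z) Hxs); rewrite /labV; pt.
Qed.

Lemma pt_instance E (eE : E -> string) (T : E -> nat) (xs : E -> seq string) :
  PT eE enc_nat T -> PT eE (enc_seq enc_raw) xs ->
  PT eE wccf_enc (fun e => instance M P3 (T e) (xs e)).
Proof.
move=> HT Hxs; have HL := pt_labels HT Hxs; have Hc := pt_cq HT; have HO := pt_options HT.
apply: pt_rawE; apply: pt_ext (fun e => esym (wccf_enc_instance (T e) (xs e))) _.
have HsL := pt_ssize HL; have HsO := pt_ssize HO.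
have Htg : PT eE enc_nat (fun e => target M (T e)).
  apply: (@pt_ext _ _ _ _ (fun e => size (options M (T e)) * cq M (T e) +
    (cq M (T e) * (cq M (T e)).-1)./2)) => [e|]; first by rewrite /target bin2.
  by pt.
apply: pt_rcat; first by pt.
apply: pt_rcat; first by pt.
apply: pt_rcat; first by pt.
apply: (pt_flat (g := fun e a => flatten [seq ent (T e) a b | b <- labels M (T e) (xs e)]) HL).
apply: (pt_flat (g := fun (e : E * lab M) b => ent (T e.1) e.2 b)
  (l := fun e => labels M (T e.1) (xs e.1))).
  exact: pt_comp HL (pt_fst (pt_id _)).
have HT' : PT ((eE ** enc_lab) ** enc_lab) enc_nat (fun t => T t.1.1).
  exact: pt_comp HT (pt_fst (pt_fst (pt_id _))).
have Hc' : PT ((eE ** enc_lab) ** enc_lab) enc_nat (fun t => cq M (T t.1.1)).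
  exact: pt_cq.
rewrite /ent; apply: pt_if.
- by apply: pt_adj; pt.
- apply: pt_rpush; apply: pt_delimit; apply: pt_bits; apply: pt_if; [|by pt|by pt].
  by apply: pt_orb; (apply: pt_eq; [exact: (@enc_fin_inj (bool * bool)%type) | |]); pt.
- exact: pt_const.
Qed.

End Encoding.

(** * Distillation *)

Section Distillation.
Variables (X Y : finType) (t : nat) (F : {ffun 'I_t -> X} -> Y).
Hypothesis t_gt0 : 0 < t.
Hypothesis cardY : #|Y| <= 2 ^ t.

Definition covered (B : {set X}) (y : Y) : {set X} :=
  [set x | [exists f : {ffun 'I_t -> X},
     [&& f \in ffun_on (mem B), F f == y & [exists i, f i == x]]]].

(** A tuple over [B] with image [y] has all its entries in [covered B y]. If each of these sets had
    fewer than half of the elements, summing over the at most [2 ^ t] images would leave at most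
    [#|B|.-1 ^ t] tuples instead of [#|B| ^ t]. *)
Lemma covered_half (B : {set X}) : B != set0 -> exists y, #|B| <= 2 * #|covered B y|.
Proof.
move=> B0; have B_gt0 : 0 < #|B| by rewrite card_gt0.
case: (pickP (fun y => #|B| <= 2 * #|covered B y|)) => [y Hy|H]; first by exists y.
have lt_y y : 2 * #|covered B y| <= #|B|.-1 by have := H y; lia.
suff : #|B| ^ t <= #|B|.-1 ^ t by rewrite leq_exp2r //; lia.
rewrite -(leq_pmul2l (expn_gt0 2 t)) /=.
have -> : #|B| ^ t = \sum_y #|[set f | (f \in ffun_on (mem B)) && (F f == y)]|.
  rewrite -[t in LHS]card_ord -card_ffun_on -sum1_card (partition_big F predT) //=.
  by apply: eq_bigr => y _; rewrite sum1dep_card.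
apply: (@leq_trans (\sum_(y : Y) #|B|.-1 ^ t)); last first.
  by rewrite sum_nat_const leq_mul2r cardY orbT.
rewrite big_distrr /=; apply: leq_sum => y _.
apply: leq_trans (_ : (2 * #|covered B y|) ^ t <= _); last by rewrite leq_exp2r.
rewrite expnMn leq_mul2l; apply/orP; right.
rewrite -[t in leqRHS]card_ord -card_ffun_on; apply/subset_leq_card/subsetP => f.
rewrite inE => /andP[fB /eqP Ff]; apply/ffun_onP => i; rewrite inE.
apply/existsP; exists f; rewrite fB Ff eqxx /=.
by apply/existsP; exists i.
Qed.

(** Greedy covering: each chosen image removes at least half of the remaining elements, so [k]
    images exhaust [B]. *)
Lemma distillation k (B : {set X}) : #|B| < 2 ^ k -> exists S : seq Y,
  [/\ size S <= k,
      forall x, x \in B -> exists f : {ffun 'I_t -> X},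
        [/\ forall i, f i \in B, exists i, f i = x & F f \in S] &
      forall y, y \in S -> exists2 f : {ffun 'I_t -> X}, (forall i, f i \in B) & y = F f].
Proof.
elim: k B => [|k IHk] B ltB.
  by exists [::]; split=> // x xB; move: ltB; rewrite expn0 ltnS leqn0 cards_eq0 => /eqP EB;
    rewrite EB inE in xB.
have [->|B0] := eqVneq B set0; first by exists [::]; split=> // x; rewrite inE.
have [y Hy] := covered_half B0.
have sC : covered B y \subset B.
  apply/subsetP => x; rewrite inE => /existsP [f /and3P[/ffun_onP fB _ /existsP [i /eqP <-]]].
  exact: fB.
pose B' := B :\: covered B y.
have ltB' : #|B'| < 2 ^ k.
  have := cardsID (covered B y) B; rewrite (setIidPr sC) -/B'.
  by move: ltB; rewrite expnS; lia.
have [S [sS HS1 HS2]] := IHk B' ltB'.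
have subB f : (forall i, f i \in B') -> forall i, f i \in B.
  by move=> H i; have := H i; rewrite inE => /andP[].
have [C0|[x0 x0C]] := set_0Vmem (covered B y).
  move: Hy; rewrite C0 cards0 muln0 leqn0 cards_eq0 (negbTE B0).
  by [].
exists (y :: S); split=> //.
- move=> x xB; have [xC|NxC] := boolP (x \in covered B y).
    move: xC; rewrite inE => /existsP [f /and3P[/ffun_onP fB /eqP Ff /existsP [i /eqP fi]]].
    by exists f; split; [exact: fB | exists i | rewrite Ff inE eqxx].
  have [|f [fB fx fS]] := HS1 x; first by rewrite inE NxC.
  by exists f; split; [exact: subB | | rewrite inE fS orbT].
- move=> y'; rewrite inE => /orP[/eqP ->|/HS2 [f fB ->]]; last by exists f => //; exact: subB.
  move: x0C; rewrite inE => /existsP [f /and3P[/ffun_onP fB /eqP <- _]].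
  by exists f.
Qed.

End Distillation.

(** * Padding of strings to tuples, and injectivity of the encodings *)

Lemma classical_set (X : finType) (Q : X -> Prop) :
  exists N : {set X}, forall x, x \in N <-> Q x.
Proof.
suff [N HN] : exists N : {set X}, forall x, x \in enum X -> (x \in N <-> Q x).
  by exists N => x; apply: HN; rewrite mem_enum.
elim: (enum X) => [|a s [N HN]]; first by exists set0.
have [Qa|NQa] := classic (Q a).
  exists (a |: N) => x; rewrite !inE; case: eqP => [-> //|_] /=; exact: HN.
exists (N :\ a) => x; rewrite !inE; case: eqP => [-> //|_] /=; exact: HN.
Qed.

(** The marker [true] followed by zeros turns the strings of length at most [m] into elements of a
    finite type; longer ones get a junk value. *)
Definition pad m (w : string) : m.+1.-tuple bool :=
  insubd (nseq_tuple m.+1 false) (w ++ true :: nseq (m - size w) false).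

Definition unpad (w : string) : string :=
  let r := rev w in rev (behead (drop (find id r) r)).

Lemma padK m w : size w <= m -> unpad (pad m w) = w.
Proof.
move=> le_w; rewrite /pad val_insubd ifT; last first.
  by rewrite size_cat /= size_nseq; apply/eqP; lia.
rewrite /unpad rev_cat rev_cons rev_nseq cat_rcons.
have -> : find id (nseq (m - size w) false ++ true :: rev w) = size (nseq (m - size w) false).
  rewrite find_cat /= addn0; case: ifP => //.
  by rewrite has_nseq andbF.
by rewrite drop_size_cat //= revK.
Qed.

Lemma size_unpad m (w : m.+1.-tuple bool) : size (unpad w) <= m.
Proof. by rewrite size_rev size_behead size_drop size_rev size_tuple; lia. Qed.

Lemma bits_nth n i : nth false (bits n) i = odd (n %/ 2 ^ i).
Proof.
have [lt_i|le_i] := ltnP i (up_log 2 n.+1); first by rewrite nth_mkseq.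
rewrite nth_default ?size_mkseq // divn_small //.
exact: leq_trans (up_logP n.+1 (isT : 1 < 2)) (leq_pexp2l (isT : 0 < 2) le_i).
Qed.

Lemma bits_inj : injective bits.
Proof.
move=> m n E; have {E} H i : odd (m %/ 2 ^ i) = odd (n %/ 2 ^ i) by rewrite -!bits_nth E.
have [k le_k] := ubnP (m + n); elim: k m n H le_k => // k IHk m n H le_k.
have [E0|N0] := eqVneq (m + n) 0; first by lia.
have := H 0; rewrite expn0 !divn1 => Eodd.
have Eh : m./2 = n./2.
  apply: IHk => [i|]; last by lia.
  by rewrite -!divn2 -!divnMA -expnS H.
by rewrite -(odd_double_half m) -(odd_double_half n) Eodd Eh.
Qed.

Lemma delimit_inj : injective delimit.
Proof.
move=> u v E; have [] // : u = v /\ ([::] : string) = [::].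
by apply: spair_inj; rewrite /spair E.
Qed.

(** The matrix entries form a prefix-free code, so their concatenation determines each of them. *)
Definition codeword (w : string) := w = [:: false] \/ exists u, w = true :: delimit u.

Lemma codeword_cat w w' r r' : codeword w -> codeword w' -> w ++ r = w' ++ r' ->
  w = w' /\ r = r'.
Proof.
move=> [->|[u ->]] [->|[u' ->]] //=; first by case.
by case=> /spair_inj [-> ->].
Qed.

Lemma flatten_codewords (A : eqType) (f g : A -> string) s :
  (forall a, codeword (f a)) -> (forall a, codeword (g a)) ->
  flatten [seq f a | a <- s] = flatten [seq g a | a <- s] ->
  forall a, a \in s -> f a = g a.
Proof.
move=> Hf Hg; elim: s => //= a s IHs /(codeword_cat (Hf a) (Hg a)) [E1 E2] b.
by rewrite inE => /orP[/eqP -> //|]; exact: IHs.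
Qed.

Lemma enc_entry_codeword x i j : codeword (@enc_entry x i j).
Proof. by rewrite /enc_entry; case: insub => [e|]; [right; eexists | left]. Qed.

(** Kernels are compared as strings, and it is enough that the answer depends on the encoding only.
    This sidesteps equality of records whose weight functions have domains depending on the edge
    sets. *)
Lemma wccf_enc_yes x y : wccf_enc x = wccf_enc y -> wccf_yes x -> wccf_yes y.
Proof.
rewrite /wccf_enc => /spair_inj [/bits_inj En] /spair_inj [/bits_inj Ec].
move=> /spair_inj [/bits_inj Et].
case: x y En Ec Et => [n E h w c t] [n' E' h' w' c' t'] /= En Ec Et.
subst n' c' t'; set x := WCCF h w c t; set y := WCCF h' w' c t => Ef.
have Eent i j : @enc_entry x i j = @enc_entry y i j.
  have mapE (f : 'I_n -> 'I_n -> string) :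
    [seq f i j | i <- enum 'I_n, j <- enum 'I_n] =
    [seq f p.1 p.2 | p <- [seq (i, j) | i <- enum 'I_n, j <- enum 'I_n]].
    by rewrite map_allpairs.
  move: Ef; rewrite !mapE => Ef.
  have := @flatten_codewords _ (fun p : 'I_n * 'I_n => @enc_entry x p.1 p.2)
    (fun p => @enc_entry y p.1 p.2) _ (fun p => enc_entry_codeword _ _)
    (fun p => enc_entry_codeword _ _) Ef (i, j).
  by apply; rewrite mem_pairs !mem_enum.
(* Extending the weights by 0 to all sets gives the two weight functions a common domain. *)
pose W (E0 : {set {set 'I_n}}) (w0 : {e | e \in E0} -> nat) e :=
  if (insub e : option {e | e \in E0}) is Some e' then w0 e' else 0.
have valE (E0 : {set {set 'I_n}}) (w0 : {e | e \in E0} -> nat) P :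
    partition_value w0 P = \sum_(C in P) \sum_(e in E0 | e \subset C) W E0 w0 e.
  apply: eq_bigr => C _; rewrite big_sub_cond; apply: eq_bigr => e _.
  by rewrite /W valK.
have Eset (e : {set 'I_n}) : #|e| = 2 -> (e \in E) = (e \in E') /\ W E w e = W E' w' e.
  move=> /eqP/cards2P [i [j [_ ->]]]; have := Eent i j; rewrite /enc_entry /W /=.
  case: insubP => [e1 H1 _|/negbTE ->]; case: insubP => [e2 H2 _|/negbTE ->] //.
  by rewrite H1 H2 => -[] /delimit_inj/bits_inj ->.
have EE : E = E'.
  apply/setP => e; have [/eqP H2|/negbTE H2] := boolP (#|e| == 2).
    by have [] := Eset e H2.
  by apply/idP/idP => [/h|/h'] H0; rewrite H0 in H2.
case=> P [capP le_t]; exists P; split=> //=.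
rewrite /= in le_t; apply: leq_trans le_t _; rewrite !valE.
apply: leq_sum => C _; apply: eq_leq; apply: eq_big => [e|e /andP[eE _]].
  by rewrite EE.
by have [] := Eset e (h _ eE).
Qed.

(** * Collapse of the polynomial hierarchy *)

Section Compression.
Variables (chi : string -> bool) (P3 : nat -> nat).
Hypothesis chiP : polytime (fun x : string => x) (fun b : bool => [:: b]) chi.
Hypothesis HP3 : pol P3.

Definition accepted (z : string) : Prop :=
  exists2 y, size y <= P3 (size z) & chi (spair z y).

Definition short s (xs : seq string) := all (fun z => size z <= s) xs.

(** All that is kept of the kernel: the length bound depends on [s] alone, however many strings [xs]
    has, and on short strings the value determines whether one of them is accepted. *)
Definition compression (Fk : nat -> seq string -> string) (q : nat -> nat) :=
  [/\ pol q, PT (enc_nat ** enc_seq enc_raw) enc_raw (fun e => Fk e.1 e.2),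
      forall s xs, size (Fk s xs) <= q s &
      forall s xs xs', short s xs -> short s xs' -> Fk s xs = Fk s xs' ->
        (exists2 z, z \in xs & accepted z) -> exists2 z, z \in xs' & accepted z].

Lemma kernel_compression :
  admits_polynomial_kernel wccf_enc wccf_yes wccf_vc_plus_capacity ->
  exists Fk q, compression Fk q.
Proof.
case=> K [HK Kyes [pk Kbound]]; have [M [pM HM]] := chiP.
(* [N s] bounds the length of [spair z y]. The first summand of [T s] covers the running time, the
   second makes room for the input as [T_large] demands. *)
pose N s := 2 * s + 1 + P3 s; pose T s := (pM.[N s])%R + N s.
have HN : pol N by rewrite /N; solve_pol.
have HT : pol T by apply: pol_add => //; exact: pol_comp (pol_horner pM) HN.
pose inst s xs := instance M P3 (T s) xs.
(* The kernel bound at the size of the vertex cover plus the capacity, neither of which involves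
   [xs]. *)
pose q s := (pk.[size (options M (T s)) + (cq M (T s)).+1])%R.
have Nmono s z : size z <= s -> N (size z) <= N s by exact: pol_mono.
have Tl s xs : short s xs -> forall z, z \in xs -> size (delimit z) + P3 (size z) <= T s.
  move=> /allP Hs z /Hs/Nmono; rewrite size_delimit -/(N (size z)) => H.
  exact: leq_trans H (leq_addl _ _).
have Mc s xs : short s xs -> forall z, z \in xs -> forall y, size y <= P3 (size z) ->
    exists2 m, m <= T s & tm_computes_within M m (spair z y) [:: chi (spair z y)].
  move=> /allP Hs z /Hs/Nmono Hz y le_y; exists (pM.[size (spair z y)])%R => //.
  apply: leq_trans (leq_addr _ _); apply: (pol_mono (pol_horner pM)).
  by apply: leq_trans Hz; rewrite size_spair /N leq_add2l.
have yesP s xs : short s xs ->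
    (wccf_yes (inst s xs) <-> exists2 z, z \in xs & accepted z).
  move=> Hs; split=> [|[z zxs [y le_y Hy]]].
    exact: (instance_sound (Tl s xs Hs) (Mc s xs Hs)).
  exact: (instance_complete (Tl s xs Hs) (Mc s xs Hs) zxs le_y Hy).
exists (fun s xs => wccf_enc (K (inst s xs))), q; split.
- rewrite /q; apply: (pol_comp (pol_horner pk)).
  rewrite (_ : (fun n => _) = fun s => #|otag M| * ((T s).+1 * ((2 * T s).+1 * (T s).+1)) +
    ((T s).+1 * (tm_tapes M).+1 + (2 * T s).+1).+2); first by solve_pol.
  by apply: functional_extensionality => s; rewrite size_options.
- have Hin : PT (enc_nat ** enc_seq enc_raw) wccf_enc (fun e => inst e.1 e.2).
    apply: pt_instance => //; last by pt.
    by apply: pt_pol => //; pt.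
  exact: (pt_comp (proj1 (polytimeP _ _ _) HK) Hin).
- move=> s xs; apply: leq_trans (Kbound _) _; apply: (pol_mono (pol_horner pk)).
  by rewrite /wccf_vc_plus_capacity leq_add2r; exact: vc_edges.
- move=> s xs xs' Hs Hs' EF /(yesP s xs Hs)/Kyes Hy.
  by apply/(yesP s xs' Hs')/Kyes; exact: wccf_enc_yes EF Hy.
Qed.

(** The advice consists of the images that [distillation] selects for the set of negative strings.
    It is sound because each entry is the image of an all-negative tuple: another list of short
    strings with that image has no accepted member either. *)
Lemma advice_exists Fk q : compression Fk q -> forall s, exists a : seq string,
  [/\ size a <= s.+2, short (q s) a,
      forall z, size z <= s -> ~ accepted z -> exists xs,
        [/\ size xs = (q s).+1, short s xs, z \in xs & Fk s xs \in a] &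
      forall xs z, short s xs -> Fk s xs \in a -> z \in xs -> ~ accepted z].
Proof.
case=> _ _ Fsize Finv s.
(* Padding adds one bit, so images have [t = (q s).+1] bits and number at most [2 ^ t]. Likewise
   inputs have [s.+1] bits, whence [s.+2] rounds. *)
pose t := (q s).+1; pose X : finType := s.+1.-tuple bool; pose Y : finType := t.-tuple bool.
pose tolist (f : {ffun 'I_t -> X}) := [seq unpad (f i) | i <- enum 'I_t].
pose F f : Y := pad (q s) (Fk s (tolist f)).
have short_tolist f : short s (tolist f).
  by apply/allP => _ /mapP [i _ ->]; exact: size_unpad.
have [B HB] := classical_set (fun x : X => ~ accepted (unpad x)).
have cY : #|Y| <= 2 ^ t by rewrite card_tuple card_bool.
have cB : #|B| < 2 ^ s.+2.
  apply: leq_ltn_trans (max_card _) _.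
  by rewrite card_tuple card_bool ltn_exp2l.
have [S [sS HS1 HS2]] := @distillation X Y t F (ltn0Sn _) cY _ _ cB.
exists [seq unpad (val (y : t.-tuple bool)) | y <- S]; split.
- by rewrite size_map.
- by apply/allP => _ /mapP [y _ ->]; exact: size_unpad.
- move=> z le_z Nz; have [|f [_ [i Ei] FS]] := HS1 (pad s z).
    by apply/HB; rewrite padK.
  exists (tolist f); split=> //; first by rewrite size_map size_enum_ord.
    by apply/mapP; exists i; rewrite ?mem_enum // Ei padK.
  by apply/mapP; exists (F f) => //; rewrite /F padK.
- move=> xs z Hxs /mapP [y /HS2 [f fB ->]] EF zxs Az.
  have [_ /mapP [i _ ->]] : exists2 z', z' \in tolist f & accepted z'.
    apply: (Finv s xs) => //; last by exists z.
    by rewrite EF /F padK.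
  exact/HB.
Qed.

End Compression.

Lemma size_enc_short s xs :
  short s xs -> size (enc_seq enc_raw xs) <= size xs * (2 * s + 1).
Proof.
elim: xs => //= x xs IHxs /andP[le_x /IHxs H]; rewrite enc_seq_cons size_spair mulSn.
by apply: leq_add => //; rewrite /enc_raw; lia.
Qed.

(** * One quantifier less at the fourth level *)

Section Collapse.
Hypothesis kernel : admits_polynomial_kernel wccf_enc wccf_yes wccf_vc_plus_capacity.

(** The guesses are regrouped into three: [A] holds [y0] and the advice; [W] holds [y1] and an
    attack on the advice, that is, a string [z], a witness [y3] for it and a tuple [xs']; [C] holds
    [y2] and a certificate [xs]. *)
Lemma Sigma4_Sigma3 L : SigmaP 4 L -> SigmaP 3 L.
Proof.
move=> [V1 [p1 [[V2 [p2 [[V3 [p3 [[V4 [p4 [[chi' [chiP' HV4]] HV3]]] HV2]]] HV1]]] HL]]].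
pose chi z := ~~ chi' z.
have chiPT : PT enc_raw enc_bool chi by apply: pt_negb; exact/polytimeP.
have chiP : polytime (fun x : string => x) (fun b : bool => [:: b]) chi by exact/polytimeP.
have V4E z : V4 z <-> chi z.
  split=> [Hz|/negP Nc]; first by apply/negP => /HV4.
  by apply: NNPP => /HV4.
pose P4 n := (p4.[n])%R; have HP4 : pol P4 by exact: pol_horner.
have V3E z : ~ V3 z <-> accepted chi P4 z.
  rewrite HV3; split=> [[y [le_y /V4E Hy]]|[y le_y /V4E Hy]]; by exists y.
have [Fk [q cF]] := kernel_compression chiP HP4 kernel.
have [Hq HFk Fsize _] := cF; have adv := advice_exists cF.
(* Bounds for the lengths of [x] paired successively with [y0], [y1] and [y2]; the advice is taken
   for length [b3 n]. *)
pose b1 n := 2 * n + 1 + (p1.[n])%R.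
pose b2 n := 2 * b1 n + 1 + (p2.[b1 n])%R.
pose b3 n := 2 * b2 n + 1 + (p3.[b2 n])%R.
have Hp1 := pol_horner p1.
have Hb1 : pol b1 by rewrite /b1; solve_pol.
have Hp2 := pol_comp (pol_horner p2) Hb1.
have Hb2 : pol b2 by rewrite /b2; solve_pol.
have Hp3 := pol_comp (pol_horner p3) Hb2.
have Hb3 : pol b3 by rewrite /b3; solve_pol.
have Hqb := pol_comp Hq Hb3; have Hp4 := pol_comp HP4 Hb3.
pose t n := (q (b3 n)).+1.
have Ht : pol t by rewrite /t; solve_pol.
(* Bounds for the three regrouped guesses; a string in a list costs twice its length plus one. *)
pose fA n := 2 * (p1.[n])%R + 1 + (b3 n).+2 * (2 * q (b3 n) + 1).
pose fX n := t n * (2 * b3 n + 1).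
pose fW n := 2 * (p2.[b1 n])%R + 1 + (2 * b3 n + 1 + (2 * P4 (b3 n) + 1 + fX n)).
pose fC n := 2 * (p3.[b2 n])%R + 1 + fX n.
have HfA : pol fA by rewrite /fA; solve_pol.
have HfW : pol fW by rewrite /fW /fX; solve_pol.
have HfC : pol fC by rewrite /fC /fX; solve_pol.
have [pA EA] := pol_poly HfA; have [pW EW] := pol_poly HfW; have [pC EC] := pol_poly HfC.
pose cert n (xs a : seq string) := [&& size xs <= t n, short (b3 n) xs & Fk (b3 n) xs \in a].
(* [xs] certifies that the matrix holds at [y0, y1, y2]; the last conjunct says
   that [xs'] is no certificate against the soundness of the advice [a]. *)
pose Phi (x y0 : string) (a : seq string) (y1 z y3 : string) (xs' : seq string)
    (y2 : string) (xs : seq string) :=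
  [&& size y0 <= (p1.[size x])%R,
      (size y1 <= (p2.[size (spair x y0)])%R) ==>
        [&& size y2 <= (p3.[size (spair (spair x y0) y1)])%R,
            spair (spair (spair x y0) y1) y2 \in xs & cert (size x) xs a] &
      ~~ [&& z \in xs', cert (size x) xs' a, size y3 <= P4 (size z) & chi (spair z y3)]].
pose PhiR (w : string) :=
  let w1 := (und w).1 in let C := (und w).2 in
  let w2 := (und w1).1 in let W := (und w1).2 in
  let x := (und w2).1 in let A := (und w2).2 in
  Phi x (und A).1 (dec_seq (und A).2) (und W).1 (und (und W).2).1
    (und (und (und W).2).2).1 (dec_seq (und (und (und W).2).2).2)
    (und C).1 (dec_seq (und C).2).
have PhiPT : PT enc_raw enc_bool PhiR.
  have Hcert (n : string -> nat) xs a : PT enc_raw enc_nat n ->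
      PT enc_raw (enc_seq enc_raw) xs -> PT enc_raw (enc_seq enc_raw) a ->
      PT enc_raw enc_bool (fun w => cert (n w) (xs w) (a w)).
    move=> Hn Hxs Ha; have Hs := pt_pol Hb3 Hn; rewrite /cert.
    apply: pt_andb; first by apply: pt_leq; [exact: pt_ssize Hxs | exact: pt_pol Ht Hn].
    apply: pt_andb.
      apply: (pt_all (p := fun w z => size z <= b3 (n w)) Hxs).
      have Hs' := pt_comp Hs (pt_fst (pt_id (enc_raw ** enc_raw))).
      by apply: pt_leq => //; pt.
    by apply: pt_mem => //; exact: (pt_comp HFk (pt_pair Hs Hxs)).
  have Hpoly (p : {poly nat}) (f : string -> nat) : PT enc_raw enc_nat f ->
      PT enc_raw enc_nat (fun w => (p.[f w])%R).
    exact: (pt_pol (pol_horner p)).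
  have Hpair (f g : string -> string) : PT enc_raw enc_raw f -> PT enc_raw enc_raw g ->
      PT enc_raw enc_raw (fun w => spair (f w) (g w)).
    by move=> Hf Hg; exact: (pt_pair Hf Hg).
  rewrite /PhiR /Phi; apply: pt_andb.
    by apply: pt_leq; [pt | apply: (Hpoly); pt].
  apply: pt_andb.
    apply: pt_implyb.
      by apply: pt_leq; [pt | apply: (Hpoly); apply: pt_rsize; apply: (Hpair); pt].
    apply: pt_andb.
      apply: pt_leq; first by pt.
      by apply: (Hpoly); apply: pt_rsize; apply: (Hpair); [apply: (Hpair) |]; pt.
    apply: pt_andb; last by apply: (Hcert); [pt | apply: pt_dec_seq; pt | apply: pt_dec_seq; pt].
    apply: pt_mem; last by apply: pt_dec_seq; pt.
    by apply: (Hpair); [apply: (Hpair); [apply: (Hpair) |] |]; pt.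
  apply: pt_negb; apply: pt_andb; first by apply: pt_mem; [pt | apply: pt_dec_seq; pt].
  apply: pt_andb; first by apply: (Hcert); [pt | apply: pt_dec_seq; pt | apply: pt_dec_seq; pt].
  apply: pt_andb; first by apply: pt_leq; [pt | apply: (pt_pol HP4); pt].
  by apply: (pt_comp chiPT); apply: (Hpair); pt.
have PhiE x A W C : PhiR (spair (spair (spair x A) W) C) =
    Phi x (und A).1 (dec_seq (und A).2) (und W).1 (und (und W).2).1
    (und (und (und W).2).2).1 (dec_seq (und (und (und W).2).2).2)
    (und C).1 (dec_seq (und C).2) by rewrite /PhiR !und_spair.
have main x : L x <-> exists A, size A <= (pA.[size x])%R /\
    ~ exists W, size W <= (pW.[size (spair x A)])%R /\
    ~ exists C, size C <= (pC.[size (spair (spair x A) W)])%R /\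
      PhiR (spair (spair (spair x A) W) C).
  set n := size x.
  have sz1 y0 : size y0 <= (p1.[n])%R -> size (spair x y0) <= b1 n.
    by move=> H; rewrite size_spair -/n /b1; lia.
  have sz2 y0 y1 : size y0 <= (p1.[n])%R -> size y1 <= (p2.[size (spair x y0)])%R ->
      size y1 <= (p2.[b1 n])%R /\ size (spair (spair x y0) y1) <= b2 n.
    move=> H0 H1; have H2 := leq_trans H1 (pol_mono (pol_horner p2) (sz1 _ H0)).
    by split=> //; rewrite size_spair /b2; have := sz1 _ H0; lia.
  have sz3 y0 y1 y2 : size y0 <= (p1.[n])%R -> size y1 <= (p2.[size (spair x y0)])%R ->
      size y2 <= (p3.[size (spair (spair x y0) y1)])%R ->
      size y2 <= (p3.[b2 n])%R /\ size (spair (spair (spair x y0) y1) y2) <= b3 n.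
    move=> H0 H1 H2; have [_ H3] := sz2 _ _ H0 H1.
    have H4 := leq_trans H2 (pol_mono (pol_horner p3) H3).
    by split=> //; rewrite size_spair /b3; lia.
  have nA A : n <= size (spair x A) by rewrite size_spair -/n; lia.
  have nW A W : n <= size (spair (spair x A) W).
    by apply: leq_trans (nA A) _; rewrite [leqRHS]size_spair; lia.
  have szX xs : size xs <= t n -> short (b3 n) xs -> size (enc_seq enc_raw xs) <= fX n.
    move=> H1 H2; apply: leq_trans (size_enc_short H2) _.
    by rewrite /fX leq_mul2r H1 orbT.
  rewrite HL; split=> [[y0 [le_y0 HV]]|[A [_ HA]]].
    have [a [sa qa compl sound]] := adv (b3 n).
    exists (spair y0 (enc_seq enc_raw a)); split.
      rewrite -EA /fA size_spair; apply: leq_add; first by rewrite leq_add2r leq_mul2l.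
      by apply: leq_trans (size_enc_short qa) _; rewrite leq_mul2r sa orbT.
    case=> W [_ NC]; apply: NC.
    set y1 := (und W).1.
    have Hsound z y3 xs' : ~~ [&& z \in xs', cert n xs' a, size y3 <= P4 (size z)
        & chi (spair z y3)].
      apply/negP => /and4P[zxs /and3P[_ Hs HF] le_y3 Hc].
      by apply: (sound _ _ Hs HF zxs); exists y3.
    (* For an overlong [y1] the implication in [Phi] is void, and the empty guess will do. *)
    have [le_y1|lt_y1] := leqP (size y1) (p2.[size (spair x y0)])%R; last first.
      exists [::]; split=> //; rewrite PhiE und_spair dec_seqK /Phi le_y0 Hsound andbT.
      by apply/implyP; rewrite leqNgt lt_y1.
    have [y2 [le_y2 HV3']] : exists y2, size y2 <= (p3.[size (spair (spair x y0) y1)])%R /\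
        V3 (spair (spair (spair x y0) y1) y2).
      apply/HV2 => HV2'; have : ~ V1 (spair x y0) by apply/HV1; exists y1.
      exact.
    have [le_y2' le_z] := sz3 _ _ _ le_y0 le_y1 le_y2.
    have [xs [sxs Hs zxs HF]] := compl _ le_z (fun Hacc => (proj2 (V3E _) Hacc) HV3').
    exists (spair y2 (enc_seq enc_raw xs)); split.
      rewrite -EC; apply: leq_trans (pol_mono HfC (nW _ W)); rewrite /fC size_spair.
      apply: leq_add; first by rewrite leq_add2r leq_mul2l.
      by apply: szX; rewrite // sxs.
    rewrite PhiE !und_spair /= !dec_seqK /Phi le_y0 Hsound andbT; apply/implyP => _.
    by rewrite le_y2 zxs /cert sxs leqnn Hs HF.
  set y0 := (und A).1 in HA *; set a := dec_seq (und A).2.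
  have HAW W : size W <= fW n -> exists C, PhiR (spair (spair (spair x A) W) C).
    move=> le_W; apply: NNPP => NC; apply: HA; exists W; split.
      by rewrite -EW; apply: leq_trans le_W _; exact: pol_mono HfW _ _ (nA A).
    by case=> C [_ HC]; apply: NC; exists C.
  have le_y0 : size y0 <= (p1.[n])%R.
    have [C] := HAW [::] (leq0n _); rewrite PhiE => /and3P[H _ _].
    exact: H.
  exists y0; split=> //; apply: NNPP => /HV1 [y1 [le_y1 HV2']].
  have [le_y1' _] := sz2 _ _ le_y0 le_y1.
  (* An empty attack, used only to extract [y2] and its certificate from the formula. *)
  have [|C] := HAW (spair y1 (spair [::] (spair [::] [::]))).
    by rewrite !size_spair /fW /=; lia.
  rewrite PhiE !und_spair /= => /and3P[_ /implyP/(_ le_y1) /and3P[le_y2 zxs Hcert] _].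
  move: le_y2 zxs Hcert; rewrite -/y0 -/a.
  set y2 := (und C).1; set xs := dec_seq _ => le_y2 zxs Hcert.
  set z := spair (spair (spair x y0) y1) y2 in zxs.
  have [_ le_z] := sz3 _ _ _ le_y0 le_y1 le_y2.
  suff HV3' : V3 z.
    by have : ~ V2 (spair (spair x y0) y1) by apply/HV2; exists y2.
  apply: NNPP => /V3E [y3 le_y3 Hc].
  have [sxs Hs _] := and3P Hcert.
  have le_y3' : size y3 <= P4 (b3 n) := leq_trans le_y3 (pol_mono HP4 le_z).
  (* The certificate just obtained is turned into an attack: if [z] had a witness [y3], then [xs]
     would refute the soundness of [a]. This argument applies to any guessed [a]. *)
  have [|C'] := HAW (spair y1 (spair z (spair y3 (enc_seq enc_raw xs)))).
    have := szX _ sxs Hs; rewrite !(size_spair y1) !(size_spair z) !(size_spair y3) /fW -/z.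
    by move: le_z; rewrite -/z; lia.
  rewrite PhiE !und_spair /= dec_seqK => /and3P[_ _].
  by rewrite -/a zxs Hcert le_y3 Hc.
exists (fun u => ~ exists W, size W <= (pW.[size u])%R /\
    ~ exists C, size C <= (pC.[size (spair u W)])%R /\ PhiR (spair (spair u W) C)), pA.
split=> //; exists (fun v => ~ exists C, size C <= (pC.[size v])%R /\ PhiR (spair v C)), pW.
split; last by move=> u; split=> [/NNPP //|H]; exact.
exists (fun w => PhiR w), pC; split; last by move=> v; split=> [/NNPP //|H]; exact.
exists (fun w => ~~ PhiR w); split; first by apply/polytimeP; exact: pt_negb.
by move=> w; split=> /negP.
Qed.

Lemma SigmaP0_1 L : SigmaP 0 L -> SigmaP 1 L.
Proof.
case=> chi [chiP HL]; have chiPT := proj1 (polytimeP _ _ _) chiP.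
exists (fun z => chi (und z).1), 0%R; split.
  exists (fun z => ~~ chi (und z).1); split; last by move=> z; split=> /negP.
  apply/polytimeP; apply: pt_negb.
  exact: (pt_comp chiPT (pt_und1 (pt_id enc_raw))).
move=> x; rewrite HL; split=> [Hx|[y [_]]]; last by rewrite und_spair.
by exists [::]; rewrite und_spair.
Qed.

(** A dummy quantifier is added at the innermost place, where [SigmaP0_1] provides it. *)
Lemma SigmaP_succ k L : SigmaP k L -> SigmaP k.+1 L.
Proof.
elim: k L => [|k IHk] L; first exact: SigmaP0_1.
by case=> V [p [HV HL]]; exists V, p; split=> //; exact: IHk.
Qed.

(** By induction the language behind the outermost quantifier drops to the third level, so [L] is at
    the fourth and [Sigma4_Sigma3] applies. *)
Lemma PH_Sigma3 L : PH L -> SigmaP 3 L.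
Proof.
case=> k; elim: k L => [|k IHk] L HL; first by do 3 apply: SigmaP_succ.
have [V [p [/IHk HV HV']]] := HL.
by apply: Sigma4_Sigma3; exists V, p.
Qed.

End Collapse.

Theorem theorem1p6 :
  ~ PH_collapses ->
  ~ admits_polynomial_kernel wccf_enc wccf_yes wccf_vc_plus_capacity.
Proof.
by move=> Ncol kernel; apply: Ncol; exists 3 => L; exact: PH_Sigma3.
Qed.
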